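(* Let $\Omega\subset\mathbb{R}^N$ be a smooth bounded domain, $s_1,s_2\in(0,1)$, $1<p_i<N/s_i$ and $p_i^*=\frac{Np_i}{N-s_ip_i}$ for $i=1,2$. Let $\mathbb{R}^+=[0,\infty)$ and let $f_1,f_2:\Omega\times\mathbb{R}^+\times\mathbb{R}^+\to\mathbb{R}^+$ be Carathéodory functions satisfying the following conditions. (A1) There exists $F\in C^1(\Omega\times\mathbb{R}^+\times\mathbb{R}^+,\mathbb{R})$ such that $\frac{\partial F}{\partial u}(x,u,v)=f_1(x,u,v)$ and $\frac{\partial F}{\partial v}(x,u,v)=f_2(x,u,v)$ for all $(x,u,v)\in\Omega\times\mathbb{R}^+\times\mathbb{R}^+$. (A6) There exist constants $q\in(1,\min\{p_1^*,p_2^*\})$ and $C_3>0$ such that $|f_1(x,u,v)|+|f_2(x,u,v)|\le C_3(|u|^{q-1}+|v|^{q-1}+1)$. (A8) There is $h\in L^\infty(\Omega)$ such that $$\limsup_{|u|^{p_1}+|v|^{p_2}\to\infty}\frac{\max\{p_1,p_2\}\,F(x,u,v)}{|u|^{p_1}+|v|^{p_2}}\le h(x)\quad\text{uniformly for a.e. }x\in\Omega.$$ Assume further that, with $\bar\lambda=\min\{\lambda_{1,p_1},\lambda_{1,p_2}\}$, one has $h(x)\le\bar\lambda$ in $\Omega$ and $h(x)<\bar\lambda$ on a subset of $\Omega$ of positive measure. Then there exists a weak solution $(u,v)\in X_{0,s_1,p_1}(\Omega)\times X_{0,s_2,p_2}(\Omega)$ of the system $$\begin{cases} (-\Delta)^{s_1}_{p_1}u=f_1(x,u,v)&\text{in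 }\Omega, \\ (-\Delta)^{s_2}_{p_2}v=f_2(x,u,v)&\text{in }\Omega, \\ u=v=0&\text{in }\mathbb{R}^N\setminus\Omega. \end{cases}$$
   Context: For $s\in(0,1)$, $p>1$, $N>sp$, let $Q=\mathbb{R}^{2N}\setminus(\Omega^c\times\Omega^c)$ with $\Omega^c=\mathbb{R}^N\setminus\Omega$, and let $X_{0,s,p}(\Omega)$ be the space of measurable $u:\mathbb{R}^N\to\mathbb{R}$ with $u|_\Omega\in L^p(\Omega)$, $u=0$ a.e. in $\mathbb{R}^N\setminus\Omega$ and finite norm $\|u\|_{0,s,p}=\left(\int_Q\frac{|u(x)-u(y)|^p}{|x-y|^{N+sp}}\,dx\,dy\right)^{1/p}$ (the integral may equivalently be taken over $\mathbb{R}^{2N}$). Put $X=X_{0,s_1,p_1}(\Omega)\times X_{0,s_2,p_2}(\Omega)$. $\lambda_{1,p_i}=\inf_{u\in X_{0,s_i,p_i}(\Omega)\setminus\{0\}}\|u\|_{0,s_i,p_i}^{p_i}/|u|_{p_i}^{p_i}$, where $|u|_r$ is the $L^r(\Omega)$ norm. The fractional $p$-Laplacian is understood weakly: for $u,w\in X_{0,s,p}(\Omega)$, $$\langle(-\Delta)^s_pu,w\rangle=\int_{\mathbb{R}^{2N}}\frac{|u(x)-u(y)|^{p-2}(u(x)-u(y))(w(x)-w(y))}{|x-y|^{N+sp}}\,dx\,dy.$$ A weak solution of the system is $(u,v)\in X$, with $u,v\ge0$ a.e. (so that $f_i(x,u,v)$ is defined), such that for all $(w,z)\in X$ $$\langle(-\Delta)^{s_1}_{p_1}u,w\rangle+\langle(-\Delta)^{s_2}_{p_2}v,z\rangle=\int_\Omega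 f_1(x,u,v)w\,dx+\int_\Omega f_2(x,u,v)z\,dx.$$
   Formalization: The formal theorem adds the hypothesis that x ↦ F(x,0,0) is integrable on Ω; without it F may tend to −∞ at the boundary so fast that (A8) puts no real constraint on f_1, f_2 there, and the claim fails. *)

(* Defs.v *)
From HB Require Import structures.
From mathcomp Require Import all_boot all_order all_algebra.
From mathcomp Require Import all_classical all_reals all_analysis.
Set Implicit Arguments.
Unset Strict Implicit.
Unset Printing Implicit Defensive.
Import Order.TTheory GRing.Theory Num.Theory numFieldNormedType.Exports.
Local Open Scope classical_set_scope.
Local Open Scope ring_scope.

(* R^N is 'rV[R]_N. Its sigma-algebra is generated by the coordinate maps,
   i.e. it is the Borel sigma-algebra. Every Lebesgue measurable function is
   a.e. equal to a Borel one, so that working with Borel representatives does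
   not change spaces of functions modulo a.e. equality. *)
Definition rV_display : measure_display. Proof. exact. Qed.

Section measurable_rV.
Context {R : realType} (n : nat).

Let coord_ (i : 'I_n) (x : 'rV[R]_n) : R := x ord0 i.

Let rV_set0 : g_sigma_preimage coord_ set0.
Proof. exact: sigma_algebra0. Qed.

Let rV_setC A : g_sigma_preimage coord_ A -> g_sigma_preimage coord_ (~` A).
Proof. exact: sigma_algebraC. Qed.

Let rV_bigcup (F : (set 'rV[R]_n)^nat) :
  (forall i, g_sigma_preimage coord_ (F i)) ->
  g_sigma_preimage coord_ (\bigcup_i (F i)).
Proof. exact: sigma_algebra_bigcup. Qed.

HB.instance Definition _ := @isMeasurable.Build rV_display 'rV[R]_n
  (g_sigma_preimage coord_) rV_set0 rV_setC rV_bigcup.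

Lemma measurable_rV_coord (i : 'I_n) :
  measurable_fun [set: 'rV[R]_n] (fun x => x ord0 i).
Proof.
move=> _ Y mY; rewrite setTI; apply: sub_sigma_algebra => /=.
rewrite -bigcup_seq/=; exists i => /=; first by rewrite mem_index_enum.
by exists Y => //; rewrite setTI.
Qed.

Lemma measurable_fun_rVP d (T : measurableType d) (f : T -> 'rV[R]_n) :
  (forall i, measurable_fun [set: T] (fun t => f t ord0 i)) ->
  measurable_fun [set: T] f.
Proof.
move=> mf _ A mA; rewrite setTI.
suff : (g_sigma_preimage coord_) `<=` [set A | measurable (f @^-1` A)].
  by apply.
apply: smallest_sub.
  split => /=.
  - by rewrite preimage_set0; exact: measurable0.
  - by move=> B mB; rewrite setTD preimage_setC; exact: measurableC.
  - by move=> B mB; rewrite preimage_bigcup; exact: bigcup_measurable.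
rewrite -bigcup_seq; apply: bigcup_sub => i _ _ [B mB <-] /=.
rewrite setTI -comp_preimage -[_ @^-1` _]setTI.
exact: mf.
Qed.

End measurable_rV.

Section rV_cons.
Context {R : realType} (n : nat).

Definition rV_cons (z : R * 'rV[R]_n) : 'rV[R]_n.+1 :=
  row_mx (const_mx z.1 : 'rV_1) z.2.

Definition rV_uncons (x : 'rV[R]_n.+1) : R * 'rV[R]_n :=
  (x ord0 ord0, rsubmx (x : 'rV_(1 + n))).

Lemma rV_consK : cancel rV_cons rV_uncons.
Proof.
move=> [t y]; rewrite /rV_uncons /rV_cons; congr pair; last exact: row_mxKr.
transitivity (row_mx (const_mx t : 'rV[R]_1) y ord0 (lshift n ord0)).
  by congr (fun_of_matrix _ _ _); exact: val_inj.
by rewrite row_mxEl mxE.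
Qed.

Lemma rV_unconsK : cancel rV_uncons rV_cons.
Proof.
move=> x; transitivity (row_mx (@lsubmx _ 1 1 n x) (@rsubmx _ 1 1 n x)).
  rewrite /rV_cons /=; apply: (f_equal (fun a => @row_mx _ 1 1 n a _)).
  apply/rowP => i; rewrite !mxE; congr (fun_of_matrix _ _ _).
  by rewrite ord1; exact: val_inj.
exact: (@hsubmxK R 1 1 n x).
Qed.

Lemma rV_cons0 z : rV_cons z ord0 ord0 = z.1.
Proof. by rewrite -[in RHS](rV_consK z). Qed.

Lemma rV_consS z i : rV_cons z ord0 (lift ord0 i) = z.2 ord0 i.
Proof.
rewrite -[in RHS](rV_consK z) /= [RHS]mxE.
by apply: (f_equal (fun k => rV_cons z ord0 k)); exact: val_inj.
Qed.

Lemma measurable_rV_cons : measurable_fun [set: R * 'rV[R]_n] rV_cons.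
Proof.
apply: measurable_fun_rVP => i; case: (unliftP ord0 i) => [j ->|->].
  under eq_fun do rewrite rV_consS.
  exact: (measurableT_comp (measurable_rV_coord j)).
by under eq_fun do rewrite rV_cons0; exact: measurable_fst.
Qed.

Lemma measurable_rV_uncons : measurable_fun [set: 'rV[R]_n.+1] rV_uncons.
Proof.
apply/measurable_fun_pairP; split; first exact: measurable_rV_coord.
apply: measurable_fun_rVP => i.
under eq_fun do rewrite /= mxE.
exact: measurable_rV_coord.
Qed.

End rV_cons.

Section leb_succ.
Context {R : realType} (n : nat).
Variable m : {sigma_finite_measure set 'rV[R]_n -> \bar R}.
Local Open Scope ereal_scope.

Definition leb_succ : set 'rV[R]_n.+1 -> \bar R :=
  pushforward ((@lebesgue_measure R) \x m) (@rV_cons R n).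

Let mcons (A : set 'rV[R]_n.+1) :
  measurable A -> measurable (@rV_cons R n @^-1` A).
Proof.
by move=> mA; rewrite -[X in measurable X]setTI; exact: measurable_rV_cons.
Qed.

Let leb_succ0 : leb_succ set0 = 0.
Proof. by rewrite /leb_succ /pushforward preimage_set0 measure0. Qed.

Let leb_succ_ge0 A : 0 <= leb_succ A.
Proof. by rewrite /leb_succ /pushforward measure_ge0. Qed.

Let leb_succ_sigma_additive : semi_sigma_additive leb_succ.
Proof.
move=> F mF tF mUF; rewrite /leb_succ /pushforward preimage_bigcup.
apply: measure_semi_sigma_additive.
- by move=> k; exact: mcons.
- apply/trivIsetP => /= i j _ _ ij; rewrite -preimage_setI.
  by move/trivIsetP : tF => /(_ _ _ _ _ ij) ->//; rewrite preimage_set0.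
- by rewrite -preimage_bigcup; exact: mcons.
Qed.

HB.instance Definition _ := isMeasure.Build _ _ _ leb_succ
  leb_succ0 leb_succ_ge0 leb_succ_sigma_additive.

Let leb_succ_sigma_finite : sigma_finite setT leb_succ.
Proof.
have /sigma_finiteP[F [FT ndF Foo]] := sigma_finiteT (@lebesgue_measure R).
have /sigma_finiteP[G [GT ndG Goo]] := sigma_finiteT m.
exists (fun k => @rV_uncons R n @^-1` (F k `*` G k)).
  rewrite -preimage_bigcup; apply/esym; rewrite -subTset => x _ /=.
  have : [set: R] (rV_uncons x).1 by [].
  have : setT (rV_uncons x).2 by [].
  rewrite FT GT => -[j _ Gj] [i _ Fi]; exists (maxn i j) => //; split.
  - by move: Fi; exact/subsetPset/ndF/leq_maxl.
  - by move: Gj; exact/subsetPset/ndG/leq_maxr.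
move=> k; have [mF Fk] := Foo k; have [mG Gk] := Goo k; split.
  rewrite -[X in measurable X]setTI.
  by apply: measurable_rV_uncons => //; exact: measurableX.
rewrite /leb_succ /pushforward -comp_preimage (_ : _ \o _ = id); last first.
  by apply/funext => z /=; rewrite rV_consK.
by rewrite preimage_id product_measure1E// lte_mul_pinfty// ge0_fin_numE.
Qed.

HB.instance Definition _ := Measure_isSigmaFinite.Build _ _ _ leb_succ
  leb_succ_sigma_finite.

End leb_succ.

(* N-dimensional Lebesgue measure, as the iterated product of the
   1-dimensional one. *)
Fixpoint leb {R : realType} (n : nat) :
    {sigma_finite_measure set 'rV[R]_n -> \bar R} :=
  match n with
  | 0%N => \d_(0 : 'rV[R]_0)
  | k.+1 => leb_succ (leb k)
  end.

Lemma leb_box (R : realType) (n : nat) (A : 'I_n -> set R) :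
  (forall i, measurable (A i)) ->
  leb n [set x | forall i, A i (x ord0 i)] =
  (\prod_(i < n) @lebesgue_measure R (A i))%E.
Proof.
elim: n A => [|n IH] A mA.
  rewrite big_ord0 /= diracE.
  by rewrite mem_set //= => -[].
have mB : measurable [set x : 'rV[R]_n | forall i, A (lift ord0 i) (x ord0 i)].
  rewrite (_ : [set _ | _] = \bigcap_(i in [set: 'I_n])
    ((fun x : 'rV[R]_n => x ord0 i) @^-1` A (lift ord0 i))).
    apply: fin_bigcap_measurable => // i _.
    by rewrite -[X in measurable X]setTI; exact: measurable_rV_coord.
  by apply/seteqP; split=> x /= H i; [move=> _; exact: H|exact: H].
rewrite big_ord_recl -IH; last by move=> i; exact: mA.
rewrite -product_measure1E //; last exact: mA.
rewrite /= /leb_succ /pushforward; congr (_ _).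
apply/seteqP; split=> [z /= H|z /= [H0 H1] i].
  by split=> [|i]; [rewrite -rV_cons0|rewrite -rV_consS]; exact: H.
by case: (unliftP ord0 i) => [j ->|->]; rewrite ?rV_consS ?rV_cons0.
Qed.

Section domains.
Context {R : realType}.

(* The Euclidean norm; `|x| on 'rV[R]_n is the sup norm. *)
Definition enorm (n : nat) (x : 'rV[R]_n) : R :=
  Num.sqrt (\sum_(i < n) x ord0 i ^+ 2).

Fixpoint iter_partial (n : nat) (l : seq 'I_n) (g : 'rV[R]_n -> R) :
    'rV[R]_n -> R :=
  match l with
  | [::] => g
  | i :: l' => fun x => 'D_(delta_mx ord0 i) (iter_partial l' g) x
  end.

(* C^oo on R^n: all iterated partial derivatives exist and are continuous. *)
Definition smooth (n : nat) (g : 'rV[R]_n -> R) : Prop :=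
  forall l : seq 'I_n, continuous (iter_partial l g) /\
    forall (i : 'I_n) x, derivable (iter_partial l g) x (delta_mx ord0 i).

(* Near each boundary point, after choosing a coordinate axis k and an
   orientation, the set is the strict epigraph of a C^oo function of the other
   N - 1 coordinates (col' k x is x with its k-th coordinate removed). *)
Definition smooth_boundary (N : nat) (Omega : set 'rV[R]_N) : Prop :=
  forall x0, (closure Omega `\` interior Omega) x0 ->
  exists (k : 'I_N) (b : bool) (r : R) (gamma : 'rV[R]_N.-1 -> R),
    [/\ 0 < r, smooth gamma &
        forall x, enorm (x - x0) < r ->
          (Omega x <-> gamma (col' k x) < (-1) ^+ b * x ord0 k)].

Definition smooth_bounded_domain (N : nat) (Omega : set 'rV[R]_N) : Prop :=
  [/\ Omega !=set0, open Omega, connected Omega, bounded_set Omega &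
      smooth_boundary Omega].

End domains.

Section spaces.
Context {R : realType} {N : nat}.
Implicit Types (Omega : set 'rV[R]_N) (s p : R) (u w h : 'rV[R]_N -> R).
Local Notation mu := (@leb R N).

Definition Qset Omega : set ('rV[R]_N * 'rV[R]_N) :=
  ~` ((~` Omega) `*` (~` Omega)).

Definition gagliardo s p (D : set ('rV[R]_N * 'rV[R]_N)) u : \bar R :=
  (\int[mu \x mu]_(z in D)
    (`|u z.1 - u z.2| `^ p / enorm (z.1 - z.2) `^ (N%:R + s * p))%:E)%E.

Definition int_pow p Omega u : \bar R :=
  (\int[mu]_(x in Omega) (`|u x| `^ p)%:E)%E.

Definition X0 s p Omega : set ('rV[R]_N -> R) :=
  [set u | [/\ measurable_fun setT u,
               (int_pow p Omega u < +oo)%E,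
               {ae mu, forall x, ~ Omega x -> u x = 0} &
               (gagliardo s p (Qset Omega) u < +oo)%E]].

Definition X0_norm s p Omega u : R :=
  fine (gagliardo s p (Qset Omega) u) `^ p^-1.

Definition Lp_norm p Omega u : R := fine (int_pow p Omega u) `^ p^-1.

(* Elements of X0 are classes modulo a.e. equality, hence the form taken by
   u <> 0. *)
Definition lambda1 s p Omega : \bar R :=
  ereal_inf [set ((X0_norm s p Omega u) `^ p / (Lp_norm p Omega u) `^ p)%:E
            | u in X0 s p Omega `\` [set u | {ae mu, forall x, u x = 0}]].

Definition Linfty Omega h : Prop :=
  measurable_fun Omega h /\
  exists M : R, {ae mu, forall x, Omega x -> `|h x| <= M}.

(* When u x = u y the integrand is 0, also for p <= 2, because of the factor
   u x - u y. *)
Definition plap_form s p u w : \bar R :=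
  (\int[mu \x mu]_z
    (`|u z.1 - u z.2| `^ (p - 2) * (u z.1 - u z.2) * (w z.1 - w z.2)
      / enorm (z.1 - z.2) `^ (N%:R + s * p))%:E)%E.

End spaces.

Section nonlinearities.
Context {R : realType} {N : nat}.
Implicit Types (Omega : set 'rV[R]_N) (f F : 'rV[R]_N -> R -> R -> R).
Local Notation mu := (@leb R N).

(* Functions on Omega x [0,oo) x [0,oo) are represented by total functions
   whose values elsewhere are irrelevant. *)
Definition nonneg_quadrant : set (R * R) := [set z | 0 <= z.1 /\ 0 <= z.2].

Definition xuv_domain Omega : set ('rV[R]_N * R * R) :=
  [set z | [/\ Omega z.1.1, 0 <= z.1.2 & 0 <= z.2]].

Definition caratheodory Omega f : Prop :=
  (forall u v, 0 <= u -> 0 <= v -> measurable_fun Omega (fun x => f x u v)) /\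
  {ae mu, forall x, Omega x ->
    {within nonneg_quadrant, continuous (fun z => f x z.1 z.2)}}.

(* Derivative at a >= 0 of a function on [0,oo): one-sided at a = 0. *)
Definition is_derive_ge0 (g : R -> R) (a l : R) : Prop :=
  (fun t => (g t - g a) / (t - a)) @ within [set t | 0 <= t] a^' --> l.

(* F is C^1 on Omega x [0,oo) x [0,oo): F and all its first order partial
   derivatives are continuous there; F_u and F_v are one-sided on the faces. *)
Definition C1_xuv Omega F : Prop :=
  [/\ {within xuv_domain Omega, continuous (fun z => F z.1.1 z.1.2 z.2)},
      forall i : 'I_N,
        (forall x u v, Omega x -> 0 <= u -> 0 <= v ->
          derivable (fun y => F y u v) x (delta_mx ord0 i)) /\
        {within xuv_domain Omega, continuous (fun z =>
          'D_(delta_mx ord0 i) (fun y => F y z.1.2 z.2) z.1.1)},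
      exists Fu : 'rV[R]_N -> R -> R -> R,
        (forall x u v, Omega x -> 0 <= u -> 0 <= v ->
          is_derive_ge0 (fun t => F x t v) u (Fu x u v)) /\
        {within xuv_domain Omega, continuous (fun z => Fu z.1.1 z.1.2 z.2)} &
      exists Fv : 'rV[R]_N -> R -> R -> R,
        (forall x u v, Omega x -> 0 <= u -> 0 <= v ->
          is_derive_ge0 (fun t => F x u t) v (Fv x u v)) /\
        {within xuv_domain Omega, continuous (fun z => Fv z.1.1 z.1.2 z.2)}].

(* limsup of G(x,u,v) as |u|^p1 + |v|^p2 -> oo, u, v >= 0, is at most h(x),
   uniformly for a.e. x in Omega. *)
Definition limsup_le_unif (p1 p2 : R) Omega (G : 'rV[R]_N -> R -> R -> R)
    (h : 'rV[R]_N -> R) : Prop :=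
  forall e : R, 0 < e -> exists M : R,
    {ae mu, forall x, Omega x -> forall u v, 0 <= u -> 0 <= v ->
      M < `|u| `^ p1 + `|v| `^ p2 -> G x u v <= h x + e}.

Definition weak_solution (s1 p1 s2 p2 : R) Omega f1 f2
    (u v : 'rV[R]_N -> R) : Prop :=
  [/\ X0 s1 p1 Omega u, X0 s2 p2 Omega v,
      {ae mu, forall x, 0 <= u x /\ 0 <= v x} &
      forall w z, X0 s1 p1 Omega w -> X0 s2 p2 Omega z ->
        (plap_form s1 p1 u w + plap_form s2 p2 v z =
         \int[mu]_(x in Omega) (f1 x (u x) (v x) * w x)%:E +
         \int[mu]_(x in Omega) (f2 x (u x) (v x) * z x)%:E)%E].

End nonlinearities.

(* Main.v *)
(* Direct method. The energy
     J(u,v) = |u|^p1 / p1 + |v|^p2 / p2 - int F(x,|u|,|v|)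
   is coercive: by a compactness argument the condition on h yields d > 0 with
   int h |u|^p <= (1 - d) |u|^p on X_0. Indeed, otherwise a minimizer of the
   Rayleigh quotient would vanish where h < lambda_1, and raising it slightly on
   that set lowers the quotient. A minimizing sequence converges a.e. along a
   subsequence, dominated in L^p, and J is lower semicontinuous along it. Since
   J(|u|,|v|) <= J(u,v), there is a nonnegative minimizer; as f_1, f_2 >= 0, it
   satisfies the Euler-Lagrange equations. Compactness comes from averaging over
   small cubes, and the subcritical integrability of X_0 from a pointwise lower
   bound for the Gagliardo integrand. *)
Require Import Defs.
From mathcomp Require Import all_boot all_order all_algebra.
From mathcomp Require Import all_classical all_reals all_analysis.
From mathcomp Require Import measurable_realfun ring lra zify.
Import Order.TTheory GRing.Theory Num.Theory numFieldNormedType.Exports.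
Set Implicit Arguments.
Unset Strict Implicit.
Unset Printing Implicit Defensive.
Local Open Scope classical_set_scope.
Local Open Scope ring_scope.

(** * Real powers, cubes and the Euclidean norm *)

(** The unknowns interact only through [F], and every step is arranged to be scalar. As
    [1 / p_i >= 1 / max(p_1, p_2)], the upper bound on [F] splits into a term in [|u|^p_1] and one
    in [|v|^p_2], so coercivity asks for one gap per pair [(s_i, p_i)]; this is why [h] is compared
    with the smaller eigenvalue. The weak formulation splits likewise, and each equation is derived
    with the other component frozen. Since [f_1, f_2 >= 0], [F] increases in both variables:
    [F(x, 0, 0)] bounds it below, and the condition at infinity bounds it above by the powers [p_1]
    and [p_2]. Hence an [L^p_i] majorant for each component is enough to pass to the limit in the
    potential. The exponent [q] matters when the energy is differentiated: increments of [F] are of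
    the size of [q]-th powers, and subcriticality makes these integrable. The set where
    [h < lambda_1] is merely measurable; the raising is therefore done by a bump living in a small
    cube that meets this set in positive measure. *)

Lemma le_of_eq (R : realType) (a b : R) : a = b -> a <= b.
Proof. by move->. Qed.

Section powR_extra.
Context {R : realType}.
Implicit Types a b c p : R.

Lemma powR_le a b p : 0 <= p -> 0 <= a -> a <= b -> a `^ p <= b `^ p.
Proof.
by move=> p0 a0 ab; rewrite ge0_ler_powR ?nnegrE // (le_trans a0).
Qed.

Lemma powRK a p : 0 <= a -> p != 0 -> (a `^ p) `^ p^-1 = a.
Proof. by move=> a0 p0; rewrite -powRrM divff // powRr1. Qed.

Lemma powR_le1 a p : 0 <= p -> 0 <= a -> a <= 1 -> a `^ p <= 1.
Proof. by move=> p0 a0 /(powR_le p0 a0); rewrite (@powR1 R). Qed.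

(** Doubling the larger summand gives the constant [2 ^ p], for every [p >= 0] and without
    convexity. *)
Lemma powR_add_le a b p : 0 <= p -> 0 <= a -> 0 <= b ->
  (a + b) `^ p <= 2 `^ p * (a `^ p + b `^ p).
Proof.
move=> p0 a0 b0; wlog ab : a b a0 b0 / a <= b.
  by move=> h; case/orP: (le_total a b) => /h; [|rewrite addrC [X in _ * X]addrC]; exact.
apply: (@le_trans _ _ ((2 * b) `^ p)).
  by apply: powR_le => //; [rewrite addr_ge0|lra].
by rewrite powRM // ler_wpM2l ?powR_ge0 // lerDr powR_ge0.
Qed.

(** A crude Young inequality: the product is at most the [p]-th power of the larger of [a] and
    [b]. *)
Lemma powR_young a b p : 1 <= p -> 0 <= a -> 0 <= b ->
  a `^ (p - 1) * b <= a `^ p + b `^ p.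
Proof.
move=> p1 a0 b0.
have p0 : 0 < p by exact: lt_le_trans p1.
have p10 : 0 <= p - 1 by rewrite subr_ge0.
case/orP: (le_total a b) => ab.
  apply: (@le_trans _ _ (b `^ (p - 1) * b)); first by rewrite ler_wpM2r // powR_le.
  by rewrite mulrC mulr_powRB1 // lerDr powR_ge0.
apply: (@le_trans _ _ (a `^ (p - 1) * a)); first by rewrite ler_wpM2l // powR_ge0.
by rewrite mulrC mulr_powRB1 // lerDl powR_ge0.
Qed.

End powR_extra.

Section euclidean.
Context {R : realType} {N : nat}.
Local Notation T := 'rV[R]_N.
Implicit Types (x y c : T) (r : R).

(** The open sup-norm ball, spelled out by coordinates so that its measure can be read off from
    [leb_box]. The Gagliardo kernel uses the Euclidean norm instead; [enorm_coord] and [enorm_le]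
    compare the two. *)
Definition cube c r : set T := [set x | forall i, `|x ord0 i - c ord0 i| < r].

Lemma measurable_preimage_coord (A : 'I_N -> set R) :
  (forall i, measurable (A i)) -> measurable [set x : T | forall i, A i (x ord0 i)].
Proof.
move=> mA; rewrite (_ : [set _ | _] = \bigcap_(i in [set: 'I_N])
    ((fun x : T => x ord0 i) @^-1` A i)).
  apply: fin_bigcap_measurable => // i _.
  by rewrite -[X in measurable X]setTI; exact: measurable_rV_coord.
by apply/seteqP; split=> x /= H i; [move=> _; exact: H|exact: H].
Qed.

Lemma cubeE c r :
  cube c r = [set x | forall i, [set` `]c ord0 i - r, c ord0 i + r[] (x ord0 i)].
Proof.
apply/seteqP; split => x /= H i; move: (H i); rewrite /= in_itv /= ltr_norml;
  lra.
Qed.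

Lemma measurable_cube c r : measurable (cube c r).
Proof.
rewrite cubeE; apply: (@measurable_preimage_coord (fun i =>
  [set` `]c ord0 i - r, c ord0 i + r[])) => i; exact: measurable_itv.
Qed.

Lemma leb_cube c r : 0 <= r -> leb N (cube c r) = ((2 * r) ^+ N)%:E.
Proof.
move=> r0; rewrite cubeE (@leb_box _ _ (fun i => [set` `]c ord0 i - r, c ord0 i + r[])) // (eq_bigr (fun=> (2 * r)%:E)); last first.
  move=> i _; rewrite lebesgue_measure_itv /= lte_fin.
  case: ifPn => [_|]; first by rewrite -EFinB; congr EFin; lra.
  by rewrite -leNgt => h; congr EFin; lra.
by rewrite prodEFin prodr_const card_ord.
Qed.

Lemma cube_ball c r : 0 < r -> cube c r = ball c r.
Proof.
move=> r0; apply/seteqP; split => x /= H.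
  by split => // i j; rewrite ord1 /ball /= distrC; exact: H.
by move=> i; case: H => _ /(_ ord0 i); rewrite /ball /= distrC.
Qed.

(** A countable family: rational centre and radius [m / (k.2 + 1)]. The factor [m] dilates about the
    centre, so [rat_cube k 1] and [rat_cube k 2] are a cube and its double. *)
Definition rat_cube (k : 'rV[rat]_N * nat) (m : R) : set T :=
  cube (\row_i ratr (k.1 ord0 i)) (m * k.2.+1%:R^-1).

(** The double is kept inside [A] because a bump equal to 1 on a cube needs the double cube as its
    support. *)
Lemma open_rat_cube (A : set T) (x : T) : open A -> A x ->
  exists k, rat_cube k 1 x /\ rat_cube k 2 `<=` A.
Proof.
move=> oA Ax.
have /nbhs_ballP [e /= e0 eA] : nbhs x A by apply: open_nbhs_nbhs.
have [n ne] : exists n : nat, n.+1%:R^-1 < e / 4.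
  have e40 : 0 < e / 4 by rewrite divr_gt0.
  have [n _ /(_ n (leqnn n)) h] := near_infty_natSinv_lt (PosNum e40).
  by exists n.
have /choice [g gP] : forall i, exists g : rat, `|x ord0 i - ratr g| < n.+1%:R^-1.
  move=> i; have n0 : 0 < n.+1%:R^-1 :> R by [].
  move: (n.+1%:R^-1) n0 => d d0.
  have [|g] := @rat_in_itvoo R (x ord0 i - d) (x ord0 i + d); first by lra.
  by rewrite in_itv /= => gg; exists g; rewrite ltr_norml; lra.
exists (\row_i g i, n); split; first by move=> i; rewrite !mxE mul1r; exact: gP.
move=> y /= By; apply: eA; rewrite -cube_ball // => i.
have := By i; have := gP i; rewrite !mxE !ltr_norml.
by move: (n.+1%:R^-1) ne => d; move: (y ord0 i) (x ord0 i) (ratr _) => a b k; lra.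
Qed.

(** The sigma-algebra is generated by the coordinate maps, so an open set has to be written as a
    countable union of cubes. *)
Lemma measurable_open (A : set T) : open A -> measurable A.
Proof.
move=> oA.
have -> : A = \bigcup_(k in [set k | rat_cube k 1 `<=` A]) rat_cube k 1.
  apply/seteqP; split => [x Ax|x [k /= kA Bx]]; last exact: kA.
  have [k [kx kA]] := open_rat_cube oA Ax.
  exists k => //= y ky; apply: kA => i; apply: (lt_le_trans (ky i)).
  by rewrite ler_wpM2r ?invr_ge0 // ler1n.
rewrite bigcup_mkcond; apply: countable_bigcupT_measurable => [|k].
  exact: countableP.
by case: ifPn => // _; exact: measurable_cube.
Qed.

Lemma measurable_fun_within (A : set T) (g : T -> R) :
  open A -> {within A, continuous g} -> measurable_fun A g.
Proof.
move=> oA; rewrite continuous_open_subspace // => cg.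
apply: (measurability _ (RGenOpens.measurableE R)).
move=> _ [_ [a [b ->] <-]]; apply: measurable_open.
rewrite openE => x [Ax] abx; rewrite /interior.
have h : nbhs x (g @^-1` `]a, b[%classic).
  by apply: (cg x); [exact: mem_set|exact: open_nbhs_nbhs].
by apply: filterI => //; exact: open_nbhs_nbhs.
Qed.

Lemma enorm_ge0 x : 0 <= enorm x.
Proof. exact: sqrtr_ge0. Qed.

Lemma enorm_coord x i : `|x ord0 i| <= enorm x.
Proof.
rewrite -sqrtr_sqr ler_wsqrtr // (bigD1 i) //= lerDl.
by apply: sumr_ge0 => j _; exact: sqr_ge0.
Qed.

Lemma enorm_le x r : 0 <= r -> (forall i, `|x ord0 i| <= r) ->
  enorm x <= Num.sqrt N%:R * r.
Proof.
move=> r0 xr; rewrite -(ger0_norm r0) -sqrtr_sqr -sqrtrM ?ler0n //.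
apply: ler_wsqrtr; rewrite mulr_natl -[X in _ *+ X](card_ord N) -sumr_const.
by apply: ler_sum => i _; rewrite -real_normK ?num_real // lerXn2r ?nnegrE.
Qed.

Lemma enorm_eq0 x : enorm x = 0 -> x = 0.
Proof.
move=> x0; apply/rowP => i; rewrite mxE; apply/normr0_eq0/le_anti.
by rewrite normr_ge0 -x0 enorm_coord.
Qed.

Lemma enormN x : enorm (- x) = enorm x.
Proof.
by congr Num.sqrt; apply: eq_bigr => i _; rewrite mxE sqrrN.
Qed.

Lemma enorm_gt0 x : x != 0 -> 0 < enorm x.
Proof.
move=> x0; rewrite lt_neqAle enorm_ge0 andbT; apply: contra_neq x0 => h.
exact: enorm_eq0.
Qed.

Lemma measurable_fun_enorm d (S : measurableType d) (f : S -> T) :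
  measurable_fun setT f -> measurable_fun setT (fun t => enorm (f t)).
Proof.
move=> mf; rewrite /enorm.
apply: (@measurableT_comp _ _ _ _ _ _ (@Num.sqrt R)).
  apply: continuous_measurable_fun.
  exact: sqrt_continuous.
apply: measurable_sum => i; apply: measurable_funX.
exact: (measurableT_comp (measurable_rV_coord i)).
Qed.

Lemma measurable_rV_sub :
  measurable_fun setT (fun z : T * T => z.1 - z.2).
Proof.
apply: measurable_fun_rVP => i; under eq_fun do rewrite !mxE.
apply: measurable_funB; apply: (measurableT_comp (measurable_rV_coord i)) => //.
Qed.

End euclidean.

(** * The Gagliardo seminorm *)

Section ae_product.
Context d1 d2 (T1 : measurableType d1) (T2 : measurableType d2) (R : realType).
Variables (m1 : {sigma_finite_measure set T1 -> \bar R})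
  (m2 : {sigma_finite_measure set T2 -> \bar R}).

Lemma ae_prod1 (P : T1 -> Prop) :
  {ae m1, forall x, P x} -> {ae (m1 \x m2)%E, forall z, P z.1}.
Proof.
move=> [A [mA A0 PA]]; exists (A `*` setT); split.
- exact: measurableX.
- by rewrite -(mul0e (m2 setT)) -A0; apply: product_measure1E.
- by move=> z /= nP; split => //; exact: PA.
Qed.

Lemma ae_prod2 (P : T2 -> Prop) :
  {ae m2, forall x, P x} -> {ae (m1 \x m2)%E, forall z, P z.2}.
Proof.
move=> [A [mA A0 PA]]; exists (setT `*` A); split.
- exact: measurableX.
- by rewrite -(mule0 (m1 setT)) -A0; apply: product_measure1E.
- by move=> z /= nP; split => //; exact: PA.
Qed.

End ae_product.

Section gagliardo.
Context {R : realType} {N : nat}.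
Local Notation T := 'rV[R]_N.
Local Notation mu := (@leb R N).
Variables (s p : R).
Hypotheses (s0 : 0 < s) (p1 : 1 < p).
Implicit Types (u v w : T -> R) (x y : T).

Let p0 : 0 < p. Proof. exact: lt_trans p1. Qed.

Let a0 : 0 < N%:R + s * p.
Proof. by rewrite ltr_wpDl // mulr_gt0. Qed.

Definition gag u (z : T * T) : R :=
  `|u z.1 - u z.2| `^ p / enorm (z.1 - z.2) `^ (N%:R + s * p).

Definition gagx u x : \bar R := (\int[mu]_y (gag u (x, y))%:E)%E.

Lemma gag_ge0 u z : 0 <= gag u z.
Proof. by rewrite divr_ge0 ?powR_ge0. Qed.

Lemma gagx_ge0 u x : (0 <= gagx u x)%E.
Proof. by apply: integral_ge0 => y _; rewrite lee_fin gag_ge0. Qed.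

Lemma measurable_kernel_rV (a : R) :
  measurable_fun setT (fun z : T * T => (enorm (z.1 - z.2) `^ a)^-1).
Proof.
under eq_fun do rewrite -powRN.
apply: (measurableT_comp (measurable_powR _)).
exact: (measurable_fun_enorm measurable_rV_sub).
Qed.

Lemma measurable_gag u : measurable_fun setT u -> measurable_fun setT (gag u).
Proof.
move=> mu_; apply: measurable_funM; last exact: measurable_kernel_rV.
apply: (measurableT_comp (measurable_powR _)).
apply: measurableT_comp => //.
by apply: measurable_funB; apply: measurableT_comp.
Qed.

Lemma measurable_gag1 u x : measurable_fun setT u ->
  measurable_fun setT (fun y => gag u (x, y)).
Proof.
move=> mu_; apply: (@measurableT_comp _ _ _ _ _ _ (gag u)).
  exact: measurable_gag.
exact: measurable_pair1.
Qed.

Lemma measurable_gagx u : measurable_fun setT u -> measurable_fun setT (gagx u).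
Proof.
move=> mu_; apply: (@measurable_fun_fubini_tonelli_F _ _ _ _ R mu
  (fun z => (gag u z)%:E)).
  by apply/measurable_EFinP; exact: measurable_gag.
by move=> z; rewrite lee_fin gag_ge0.
Qed.

Lemma gagliardoE u : measurable_fun setT u ->
  gagliardo s p setT u = (\int[mu]_x gagx u x)%E.
Proof.
move=> mu_; apply: (@fubini_tonelli1 _ _ _ _ R mu mu (fun z => (gag u z)%:E)).
  by apply/measurable_EFinP; exact: measurable_gag.
by move=> z; rewrite lee_fin gag_ge0.
Qed.

Lemma gagliardo_ge0 u D : (0 <= gagliardo s p D u)%E.
Proof. by apply: integral_ge0 => z _; rewrite lee_fin gag_ge0. Qed.

(** On the product of the complements the numerator vanishes almost everywhere. This lets the
    seminorm be taken over the whole space from here on. *)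
Lemma gagliardo_Qset Omega u : measurable Omega -> measurable_fun setT u ->
  {ae mu, forall x, ~ Omega x -> u x = 0} ->
  gagliardo s p (Qset Omega) u = gagliardo s p setT u.
Proof.
move=> mO mu_ u0; rewrite /gagliardo integral_mkcond.
have mg := measurable_gag mu_.
apply: ge0_ae_eq_integral => //.
- apply/(measurable_restrictT _ _).1.
    by apply: measurableC; apply: measurableX; exact: measurableC.
  by apply/measurable_EFinP; exact: measurable_funTS.
- exact/measurable_EFinP.
- by move=> z _; rewrite patchE; case: ifPn => // _; rewrite lee_fin gag_ge0.
- by move=> z _; rewrite lee_fin gag_ge0.
- have h1 := ae_prod1 mu u0; have h2 := ae_prod2 mu u0.
  apply: filterS2 h1 h2 => z z1 z2 _; rewrite patchE.
  case: ifPn => //; rewrite notin_setE /Qset /= => /contrapT [] Oz1 Oz2.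
  by rewrite z1 // z2 // subrr normr0 powR0 ?mul0r // gt_eqF.
Qed.

(** A bound [d] on the coordinate differences bounds the Euclidean distance by [sqrt N * d], hence
    the kernel from below. *)
Lemma gag_lower u x y (d : R) : 0 < d ->
  (forall i, `|x ord0 i - y ord0 i| <= d) ->
  `|u x - u y| `^ p <= (Num.sqrt N%:R * d) `^ (N%:R + s * p) * gag u (x, y).
Proof.
(* On the diagonal the kernel is [0^-1 = 0], so the estimate of the kernel fails there; but the left
   side is 0 too. *)
move=> d0 xyd; have [->|xy] := eqVneq x y.
  by rewrite subrr normr0 powR0 ?gt_eqF // mulr_ge0 ?powR_ge0 ?gag_ge0.
have e0 : 0 < enorm (x - y) by apply: enorm_gt0; rewrite subr_eq0.
have ea0 : 0 < enorm (x - y) `^ (N%:R + s * p) by exact: powR_gt0.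
rewrite /gag /= mulrCA ler_peMr ?powR_ge0 // ler_pdivlMr // mul1r.
apply: ge0_ler_powR; rewrite ?nnegrE ?(ltW a0) ?enorm_ge0 ?mulr_ge0 ?sqrtr_ge0 ?(ltW d0) //.
by apply: enorm_le => [|i]; [exact: ltW|rewrite !mxE].
Qed.

Lemma bounded_set_coord (A : set T) : bounded_set A ->
  exists2 B : R, 0 < B & forall x i, A x -> `|x ord0 i| <= B.
Proof.
move=> [M [_ h]].
have B0 : 0 < `|M| + 1 by rewrite ltr_wpDl.
exists (`|M| + 1) => // x i Ax.
have := h (`|M| + 1) _ x Ax.
rewrite (le_lt_trans (ler_norm _)) ?ltrDl // => /(_ isT); apply: le_trans.
rewrite [leRHS]mx_normrE.
exact: (@le_bigmax _ _ _ _ (fun k => `|x k.1 k.2|) (ord0, i)).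
Qed.

(** Integrates the pointwise bound over a set [Y] near [x] where [u] differs from [u x] by at least
    [r]. Both the Poincaré inequality and the gain of integrability come from a suitable choice of
    [Y]. *)
Lemma gagx_lower u x (Y : set T) (d r : R) : measurable_fun setT u ->
  measurable Y -> 0 < d -> 0 <= r ->
  (forall y, Y y -> (forall i, `|x ord0 i - y ord0 i| <= d) /\ r <= `|u x - u y|) ->
  ((r `^ p)%:E * mu Y <= ((Num.sqrt N%:R * d) `^ (N%:R + s * p))%:E * gagx u x)%E.
Proof.
move=> mu_ mY d0 r0 hY.
set K := (_ * d) `^ _; have K0 : 0 <= K by exact: powR_ge0.
rewrite -integral_cst // /gagx -ge0_integralZl_EFin //; last 2 first.
- by move=> y _; rewrite lee_fin gag_ge0.
- by apply/measurable_EFinP; exact: measurable_gag1.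
apply: (@le_trans _ _ (\int[mu]_(y in Y) (K%:E * (gag u (x, y))%:E))%E).
  apply: ge0_le_integral => //.
  - by move=> y _; rewrite lee_fin powR_ge0.
  - apply/measurable_EFinP; apply: measurable_funM => //.
    by apply: measurable_funTS; exact: measurable_gag1.
  - move=> y /hY[xy ru]; rewrite -EFinM lee_fin.
    apply: le_trans (gag_lower _ d0 xy); apply: ge0_ler_powR ru => //.
    by rewrite ltW.
apply: ge0_subset_integral => //.
  apply/measurable_EFinP; apply: measurable_funM => //.
  exact: measurable_gag1.
by move=> y _; rewrite -EFinM lee_fin mulr_ge0 // gag_ge0.
Qed.

(** [u] vanishes on a cube [Y] disjoint from [Omega] and at bounded distance from it. For [x] in
    [Omega], the pairs [(x, y)] with [y] in [Y] already contribute a fixed multiple of [|u x| ^ p]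
    to the seminorm. *)
Lemma poincare (Omega : set T) : (0 < N)%N -> measurable Omega -> bounded_set Omega ->
  exists2 C : R, 0 <= C & forall u, measurable_fun setT u ->
    {ae mu, forall x, ~ Omega x -> u x = 0} ->
    (int_pow p Omega u <= C%:E * gagliardo s p setT u)%E.
Proof.
move=> N0 mO /bounded_set_coord[B B0 OB].
(* The coordinates in [Y] lie between [2 * B] and [4 * B], those in [Omega] between [- B] and [B]:
   the sets are disjoint as soon as there is one coordinate, and coordinates differ by at most
   [5 * B]. *)
pose c : T := const_mx (3 * B).
pose Y := cube c B.
pose K := (Num.sqrt N%:R * (5 * B)) `^ (N%:R + s * p).
have K0 : 0 <= K by exact: powR_ge0.
have V0 : 0 < (2 * B) ^+ N by rewrite exprn_gt0 // mulr_gt0.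
exists (K / (2 * B) ^+ N); first by rewrite divr_ge0 // ltW.
move=> u mu_ u0.
have Yd x y i : Omega x -> Y y -> `|x ord0 i - y ord0 i| <= 5 * B.
  move=> /OB - /(_ i) + /(_ i); rewrite !mxE; move: (x ord0 i) (y ord0 i) => t t'.
  rewrite ltr_norml !ler_norml; lra.
have YO y : Y y -> ~ Omega y.
  move=> /(_ (Ordinal N0)) + /OB - /(_ (Ordinal N0)); rewrite !mxE.
  move: (y ord0 _) => t; rewrite ltr_norml !ler_norml; lra.
(* [u] vanishes outside [Omega] only almost everywhere; removing the null set [Z] from [Y] leaves
   its measure unchanged. *)
case: u0 => Z [mZ Z0 uZ].
have uY0 y : (Y `\` Z) y -> u y = 0.
  by move=> [Yy nZy]; apply: contrapT => /= uy; apply/nZy/uZ => /(_ (YO _ Yy)).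
have muY : mu Y = ((2 * B) ^+ N)%:E by rewrite /Y leb_cube // ltW.
have mYZ : mu (Y `\` Z) = ((2 * B) ^+ N)%:E.
  rewrite measureD //; last 2 first.
  - exact: measurable_cube.
  - by rewrite [ltLHS]muY ltry.
  rewrite [X in (X - _)%E]muY [X in (_ - X)%E](_ : _ = 0%E) ?sube0 //.
  by apply: subset_measure0 Z0 => //; apply: measurableI => //; exact: measurable_cube.
have key x : Omega x ->
    ((`|u x| `^ p)%:E <= (K / (2 * B) ^+ N)%:E * gagx u x)%E.
  move=> Ox; rewrite EFinM muleAC lee_pdivlMr // -mYZ.
  apply: gagx_lower => //; first by apply: measurableD => //; exact: measurable_cube.
    by rewrite mulr_gt0.
  move=> y Yy; split => [i|]; first by apply: Yd => //; case: Yy.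
  by rewrite (uY0 y Yy) subr0.
have mpow : measurable_fun setT (fun x => `|u x| `^ p).
  apply: (measurableT_comp (measurable_powR _)); exact: measurableT_comp.
rewrite gagliardoE // -ge0_integralZl //; last 3 first.
- exact: measurable_gagx.
- by move=> x _; exact: gagx_ge0.
- by rewrite lee_fin divr_ge0 // ltW.
have mK : measurable_fun setT (fun x => (K / (2 * B) ^+ N)%:E * gagx u x)%E.
  by apply: emeasurable_funM => //; exact: measurable_gagx.
have K0' x : (0 <= (K / (2 * B) ^+ N)%:E * gagx u x)%E.
  by rewrite mule_ge0 ?gagx_ge0 // lee_fin divr_ge0 // ltW.
apply: (@le_trans _ _ (\int[mu]_(x in Omega) ((K / (2 * B) ^+ N)%:E * gagx u x))%E).
  apply: ge0_le_integral => //.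
  - by apply/measurable_EFinP; exact: measurable_funTS.
  - exact: measurable_funTS.
exact: ge0_subset_integral.
Qed.

End gagliardo.

(** * Subcritical integrability *)

Section sobolev.
Context {R : realType} {N : nat}.
Local Notation T := 'rV[R]_N.
Local Notation mu := (@leb R N).
Variables (s p : R).
Hypotheses (N0 : (0 < N)%N) (s0 : 0 < s) (p1 : 1 < p).
Implicit Types (u v w : T -> R) (x y : T).

Let p0 : 0 < p. Proof. exact: lt_trans p1. Qed.

Let a0 : 0 < N%:R + s * p.
Proof. by rewrite ltr_wpDl // mulr_gt0. Qed.

Lemma measurable_normr_powR d (S : measurableType d) (D : set S) (f : S -> R) (m : R) :
  measurable_fun D f -> measurable_fun D (fun t => `|f t| `^ m).
Proof.
move=> mf; apply: (measurableT_comp (measurable_powR _)).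
exact: measurableT_comp.
Qed.

(** [V] is chosen so that [(|u x| / 2) ^ m * (V / 2) = M + 1]. By Chebyshev's inequality the points
    with [|u y| > |u x| / 2] then fill at most half of the cube, whose volume is [V]. The summand 1
    keeps [V] positive when [M = 0]. *)
Lemma half_cube u x (m M V : R) : measurable_fun setT u -> 0 < m -> 0 <= M ->
  (int_pow m setT u <= M%:E)%E -> u x != 0 -> 0 < V ->
  V = 2 * 2 `^ m * (M + 1) * `|u x| `^ (- m) ->
  ((V / 2)%:E <= mu (cube x (V `^ N%:R^-1 / 2) `&`
     [set y : T | `|u x| / 2 <= `|u x - u y|]%R))%E.
Proof.
move=> mu_ m0 M0 uM ux0 V0 VE.
set l := `|u x|; have l0 : 0 < l by rewrite normr_gt0.
set r := V `^ _ / 2.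
have r0 : 0 <= r by rewrite divr_ge0 ?powR_ge0.
have mC : measurable (cube x r) by exact: measurable_cube.
have muC : mu (cube x r) = V%:E.
  rewrite leb_cube // /r; congr EFin; rewrite mulrCA divff // mulr1.
  by rewrite -powR_mulrn ?powR_ge0 // -powRrM mulVf ?powRr1 ?(ltW V0) // pnatr_eq0 -lt0n.
pose Z := cube x r `&` [set y | l / 2 < `|u y|].
have mZ : measurable Z.
  apply: measurableI => //; rewrite -[X in measurable X]setTI.
  apply: (@measurable_fun_ltr _ _ _ setT (cst (l / 2)) (fun y => `|u y|)) => //.
  exact: measurableT_comp.
have ZV : (mu Z <= (V / 2)%:E)%E.
  have l2m : 0 < (l / 2) `^ m by rewrite powR_gt0 // divr_gt0.
  rewrite -(@lee_pmul2l _ ((l / 2) `^ m)%:E) //.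
  rewrite -integral_cst //.
  apply: (@le_trans _ _ M%:E).
    apply: le_trans uM; rewrite /int_pow.
    apply: (@le_trans _ _ (\int[mu]_(y in Z) (`|u y| `^ m)%:E)%E).
      apply: ge0_le_integral => //.
      - by move=> y _; rewrite lee_fin powR_ge0.
      - apply/measurable_EFinP; apply: measurable_funTS.
        exact: measurable_normr_powR.
      - move=> y [_ /= ly]; rewrite lee_fin ge0_ler_powR ?nnegrE ?(ltW ly) ?(ltW m0) //.
        by rewrite divr_ge0 // ltW.
    apply: ge0_subset_integral => //.
    by apply/measurable_EFinP; exact: measurable_normr_powR.
  rewrite -EFinM lee_fin VE -/l.
  have hl : 2 `^ m * (l / 2) `^ m * l `^ (- m) = 1.
    rewrite -powRM ?divr_ge0 ?(ltW l0) // mulrCA divff // mulr1 powRN divff //.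
    by rewrite gt_eqF // powR_gt0.
  rewrite (_ : (l / 2) `^ m * _ = (M + 1) * (2 `^ m * (l / 2) `^ m * l `^ (- m))).
    by rewrite hl mulr1 lerDl.
  by field.
have mY : measurable (cube x r `&` [set y : T | l / 2 <= `|u x - u y|]).
  apply: measurableI => //; rewrite -[X in measurable X]setTI.
  apply: (@measurable_fun_ler _ _ _ setT (cst (l / 2)) (fun y => `|u x - u y|)) => //.
  by apply: measurableT_comp => //; exact: measurable_funB.
have mCZ : measurable (cube x r `\` Z) by exact: measurableD.
apply: (@le_trans _ _ (mu (cube x r `\` Z))).
  have -> : mu (cube x r `\` Z) = (V%:E - mu Z)%E.
    rewrite measureD //; last by rewrite [ltLHS]muC ltry.
    rewrite [X in (X - _)%E]muC (_ : cube x r `&` Z = Z) //.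
    by rewrite setIidr // => y [].
  move: ZV; case: (mu Z) (measure_ge0 mu Z) => [z _|_|//].
    by rewrite -EFinB !lee_fin; lra.
  by rewrite leye_eq.
apply: le_measure; rewrite ?inE // => y [Cy nZy]; split => //=.
have : ~ (l / 2 < `|u y|) by move=> h; apply: nZy.
move/negP; rewrite -leNgt => uy.
have := lerB_dist (u x) (u y); rewrite -/l; move: uy; lra.
Qed.

(* If V ~ |u x|^(-m), Chebyshev's inequality gives |u y| <= |u x| / 2 on at least
   half of a cube of volume V around x, so the Gagliardo integrand integrated in
   y is at least of order |u x|^p V^(- s p / N) = |u x|^(p + m s p / N). *)
Lemma sobolev_step u (m : R) : measurable_fun setT u -> 0 < m ->
  (int_pow m setT u < +oo)%E -> (gagliardo s p setT u < +oo)%E ->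
  (int_pow (p + m * (s * p / N%:R)) setT u < +oo)%E.
Proof.
move=> mu_ m0 um uE.
have /fineK : int_pow m setT u \is a fin_num.
  by rewrite ge0_fin_numE // integral_ge0 // => y _; rewrite lee_fin powR_ge0.
have : 0 <= fine (int_pow m setT u).
  by rewrite fine_ge0 // integral_ge0 // => y _; rewrite lee_fin powR_ge0.
move: (fine _) => M M0 uM.
pose t := s * p / N%:R; rewrite -/t.
have n0 : 0 < N%:R :> R by rewrite ltr0n.
have t0 : 0 < t by rewrite divr_gt0 // mulr_gt0.
pose W := 2 * 2 `^ m * (M + 1).
have W0 : 0 < W by rewrite mulr_gt0 ?ltr_wpDl // mulr_gt0 // powR_gt0.
pose K := (Num.sqrt N%:R / 2) `^ (N%:R + s * p).
pose C := 2 * 2 `^ p * K * W `^ t.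
have K0 : 0 < K by rewrite powR_gt0 // divr_gt0 // sqrtr_gt0.
have C0 : 0 < C by rewrite !mulr_gt0 // powR_gt0.
have key x : ((`|u x| `^ (p + m * t))%:E <= C%:E * gagx s p u x)%E.
  have [u0|ux0] := eqVneq (u x) 0.
    rewrite u0 normr0 powR0; first by rewrite mule_ge0 ?gagx_ge0 // lee_fin ltW.
    by rewrite gt_eqF // addr_gt0 // mulr_gt0.
  set l := `|u x|; have l0 : 0 < l by rewrite normr_gt0.
  pose V := W * l `^ (- m).
  have V0 : 0 < V by rewrite mulr_gt0 // powR_gt0.
  have uM' : (int_pow m setT u <= M%:E)%E by rewrite uM.
  have YV := half_cube mu_ m0 M0 uM' ux0 V0 erefl.
  set r := V `^ N%:R^-1 / 2 in YV.
  have r0 : 0 < r by rewrite divr_gt0 // powR_gt0.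
  set Y := _ `&` _ in YV.
  have mY : measurable Y.
    apply: measurableI; first exact: measurable_cube.
    rewrite -[X in measurable X]setTI.
    apply: (@measurable_fun_ler _ _ _ setT (cst (l / 2)) (fun y => `|u x - u y|)) => //.
    by apply: measurableT_comp => //; exact: measurable_funB.
  have l20 : 0 <= l / 2 by rewrite divr_ge0 // ltW.
  have := @gagx_lower _ _ s p s0 p1 u x Y r (l / 2) mu_ mY r0 l20.
  move=> /(_ _)/wrap[].
    move=> y [Cy ly]; split => // i.
    by rewrite ltW // distrC; exact: Cy.
  set D := (_ * r) `^ _ => hG.
  have {hG} : (((l / 2) `^ p * (V / 2))%:E <= D%:E * gagx s p u x)%E.
    by apply: le_trans hG; rewrite EFinM lee_wpmul2l // lee_fin powR_ge0.
  (* The radius is of order [V ^ (1 / N)], so its power [N + s p] splits into [V * V ^ t]. The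
     factor [V] cancels the measure of [Y], and [V ^ t = W ^ t * |u x| ^ (- m t)] is the gain. *)
  have DE : D = K * (V * V `^ t).
    rewrite /D /r (_ : _ * _ = Num.sqrt N%:R / 2 * V `^ N%:R^-1); last by ring.
    rewrite powRM ?powR_ge0 ?divr_ge0 ?sqrtr_ge0 // -/K; congr (_ * _).
    rewrite -powRrM -[X in _ = X * _](powRr1 (ltW V0)) -powRD ?(gt_eqF V0) ?implybT //.
    by congr (_ `^ _); rewrite /t; field; rewrite gt_eqF.
  have D0 : 0 < D by rewrite DE; apply: mulr_gt0 => //; apply: mulr_gt0 => //; exact: powR_gt0.
  case: (gagx s p u x) (gagx_ge0 s p u x) => [g||] // g0.
    rewrite -!EFinM !lee_fin DE => hg.
    have Vt : V `^ t * l `^ (m * t) = W `^ t.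
      rewrite /V powRM ?powR_ge0 ?(ltW W0) // -powRrM -mulrA -powRD ?(gt_eqF l0) ?implybT //.
      by rewrite mulNr addNr powRr0 mulr1.
    have lp : 2 `^ p * (l / 2) `^ p = l `^ p.
      by rewrite -powRM // mulrCA divff // mulr1.
    have {}hg : (l / 2) `^ p <= 2 * K * V `^ t * g.
      rewrite -(ler_pM2r (divr_gt0 V0 (ltr0Sn _ 1))); apply: le_trans hg _.
      by apply: le_of_eq; field.
    rewrite powRD ?(gt_eqF l0) ?implybT // -lp /C -Vt.
    apply: (@le_trans _ _ (2 `^ p * (2 * K * V `^ t * g) * l `^ (m * t))).
      by rewrite ler_wpM2r ?powR_ge0 // ler_wpM2l ?powR_ge0.
    by apply: le_of_eq; ring.
  by move=> _; rewrite gt0_muley ?leey // lte_fin.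
apply: (@le_lt_trans _ _ (C%:E * gagliardo s p setT u)%E); last first.
  by rewrite lte_mul_pinfty // lee_fin ltW.
rewrite gagliardoE // -ge0_integralZl //; last 3 first.
- exact: measurable_gagx.
- by move=> x _; exact: gagx_ge0.
- by rewrite lee_fin ltW.
apply: ge0_le_integral => //.
- by apply/measurable_EFinP; exact: measurable_normr_powR.
- by apply: emeasurable_funM => //; exact: measurable_gagx.
Qed.

Lemma int_pow_setT (Omega : set T) u (m : R) : measurable Omega ->
  measurable_fun setT u -> {ae mu, forall y, ~ Omega y -> u y = 0} -> m != 0 ->
  int_pow m setT u = int_pow m Omega u.
Proof.
move=> mO mu_ u0 m0; rewrite /int_pow [RHS]integral_mkcond.
have mp := measurable_normr_powR m mu_.
apply: ge0_ae_eq_integral => //.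
- exact/measurable_EFinP.
- apply/(measurable_restrictT _ _).1 => //.
  by apply/measurable_EFinP; exact: measurable_funTS.
- by move=> z _; rewrite patchE; case: ifPn => // _; rewrite lee_fin powR_ge0.
- apply: filterS u0 => z u0 _; rewrite patchE.
  by case: ifPn => //; rewrite notin_setE => /u0 ->; rewrite normr0 powR0.
Qed.

(* The fixed point of m |-> p + m s p / N is the critical exponent. *)
Lemma sobolev (Omega : set T) u (q : R) : measurable Omega ->
  (mu Omega < +oo)%E -> s * p < N%:R -> X0 s p Omega u ->
  0 < q < N%:R * p / (N%:R - s * p) -> (int_pow q Omega u < +oo)%E.
Proof.
move=> mO Ofin spN [mu_ up u0 uE] /andP[q0 qp].
have n0 : 0 < N%:R :> R by rewrite ltr0n.
rewrite (gagliardo_Qset s p1 mO mu_ u0) in uE.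
pose t := s * p / N%:R.
have t0 : 0 < t by rewrite divr_gt0 // mulr_gt0.
have t1 : t < 1 by rewrite ltr_pdivrMr // mul1r.
(* Started at [m = p], the recursion [m |-> p + m t] gives the geometric sums
   [p (1 - t^(k+1)) / (1 - t)], which increase to [p / (1 - t) = N p / (N - s p)]. *)
have it k : (int_pow (p * (1 - t ^+ k.+1) / (1 - t)) setT u < +oo)%E.
  elim: k => [|k IH].
    rewrite expr1 mulfK; first by rewrite (int_pow_setT mO mu_ u0) ?gt_eqF.
    by rewrite gt_eqF // subr_gt0.
  have m0 : 0 < p * (1 - t ^+ k.+1) / (1 - t).
    by rewrite divr_gt0 ?subr_gt0 // mulr_gt0 // subr_gt0 exprn_ilt1 // ltW.
  have := sobolev_step mu_ m0 IH uE.
  rewrite (_ : p + _ = p * (1 - t ^+ k.+2) / (1 - t)) //.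
  rewrite -/t [in RHS]exprS; move: (t ^+ k.+1) => tk.
  by field; rewrite gt_eqF // subr_gt0.
have [k qk] : exists k, q <= p * (1 - t ^+ k.+1) / (1 - t).
  have qt : 0 < 1 - q * (1 - t) / p.
    rewrite subr_gt0 ltr_pdivrMr // mul1r -ltr_pdivlMr ?subr_gt0 //.
    apply: lt_le_trans qp _; apply: le_of_eq; rewrite /t; field.
    by rewrite !gt_eqF ?subr_gt0.
  have : (GRing.exp t : R^nat) @ \oo --> 0.
    by apply: cvg_expr; rewrite ger0_norm // ltW.
  move=> /cvgrPdist_lt /(_ _ qt)[k _ /(_ k.+1 (leqnSn k))].
  rewrite /= sub0r normrN ger0_norm ?exprn_ge0 ?(ltW t0) // => h.
  exists k; rewrite ler_pdivlMr ?subr_gt0 // -ler_pdivrMl // mulrC; lra.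
move: (it k) qk; set m := _ / _ => um qm.
have m0 : 0 < m by exact: lt_le_trans qm.
rewrite (int_pow_setT mO mu_ u0 (lt0r_neq0 m0)) in um.
have mp (l : R) : measurable_fun Omega (fun y => (`|u y| `^ l)%:E).
  by apply/measurable_EFinP; apply: measurable_funTS; exact: measurable_normr_powR.
(* On a set of finite measure a larger exponent controls a smaller one, through
   [|u| ^ q <= 1 + |u| ^ m]. *)
apply: (@le_lt_trans _ _ (mu Omega + int_pow m Omega u)%E); last exact: lte_add_pinfty.
have -> : (mu Omega = \int[mu]_(y in Omega) 1)%E.
  by rewrite integral_cst // mul1e.
rewrite /int_pow -ge0_integralD //.
apply: ge0_le_integral => //.
- by apply: emeasurable_funD.
- move=> y _; rewrite -EFinD lee_fin.
  have [u1|u1] := leP `|u y| 1.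
    apply: (@le_trans _ _ 1); last by rewrite lerDl powR_ge0.
    by apply: powR_le1 => //; exact: ltW.
  by apply: ler_wpDl => //; rewrite ler_powR // ltW.
Qed.

End sobolev.

(** * The space [X0] and its closure properties *)

Section X0_theory.
Context {R : realType} {N : nat}.
Local Notation T := 'rV[R]_N.
Local Notation mu := (@leb R N).
Variables (s p : R) (Omega : set T).
Hypotheses (N0 : (0 < N)%N) (s0 : 0 < s) (p1 : 1 < p).
Hypotheses (mO : measurable Omega) (bO : bounded_set Omega).
Implicit Types (u v w : T -> R).
Local Notation G u := (gagliardo s p setT u).

Let p0 : 0 < p. Proof. exact: lt_trans p1. Qed.

Lemma X0_gagliardo u : X0 s p Omega u -> (G u < +oo)%E.
Proof. by case=> mu_ _ u0; rewrite (gagliardo_Qset s p1 mO mu_ u0). Qed.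

Lemma X0_fin_num u : X0 s p Omega u -> G u \is a fin_num.
Proof.
by move=> Xu; rewrite ge0_fin_numE ?gagliardo_ge0 //; exact: X0_gagliardo.
Qed.

Lemma X0_measurable u : X0 s p Omega u -> measurable_fun setT u.
Proof. by case. Qed.

Lemma X0_ae0 u : X0 s p Omega u -> {ae mu, forall x, ~ Omega x -> u x = 0}.
Proof. by case. Qed.

Lemma X0_int_pow u : X0 s p Omega u -> (int_pow p Omega u < +oo)%E.
Proof. by case. Qed.

(** The Poincaré inequality supplies the [L^p] condition in the definition of [X0]. *)
Lemma X0_intro u : measurable_fun setT u ->
  {ae mu, forall x, ~ Omega x -> u x = 0} -> (G u < +oo)%E -> X0 s p Omega u.
Proof.
move=> mu_ u0 Gu; split => //; last by rewrite (gagliardo_Qset s p1 mO mu_ u0).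
have [C C0 /(_ u mu_ u0)] := poincare s0 p1 N0 mO bO.
by move/le_lt_trans; apply; rewrite lte_mul_pinfty // lee_fin.
Qed.

Lemma le_gagliardo u v w (a b : R) : 0 <= a -> 0 <= b ->
  measurable_fun setT u -> measurable_fun setT v -> measurable_fun setT w ->
  (forall x y, `|w x - w y| <= a * `|u x - u y| + b * `|v x - v y|) ->
  (G w <= (2 `^ p * a `^ p)%:E * G u + (2 `^ p * b `^ p)%:E * G v)%E.
Proof.
move=> a0 b0 mu_ mv mw h.
have mE f (mf : measurable_fun setT f) :
    measurable_fun setT (fun z => (gag s p f z)%:E).
  by apply/measurable_EFinP; exact: measurable_gag.
have g0 f z : (0 <= (gag s p f z)%:E)%E by rewrite lee_fin gag_ge0.
rewrite /gagliardo -ge0_integralZl //; last 3 first.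
- exact: mE.
- by move=> z _; exact: g0.
- by rewrite lee_fin mulr_ge0 ?powR_ge0.
rewrite -ge0_integralZl //; last 3 first.
- exact: mE.
- by move=> z _; exact: g0.
- by rewrite lee_fin mulr_ge0 ?powR_ge0.
rewrite -ge0_integralD //; last 4 first.
- by move=> z _; rewrite mule_ge0 ?g0 // lee_fin mulr_ge0 ?powR_ge0.
- by apply: emeasurable_funM => //; exact: mE.
- by move=> z _; rewrite mule_ge0 ?g0 // lee_fin mulr_ge0 ?powR_ge0.
- by apply: emeasurable_funM => //; exact: mE.
apply: ge0_le_integral => //.
- by move=> z _; exact: g0.
- exact: mE.
- by apply: emeasurable_funD; apply: emeasurable_funM => //; exact: mE.
move=> z _; rewrite -!EFinM -EFinD lee_fin.
rewrite !mulrA -mulrDl ler_wpM2r ?invr_ge0 ?powR_ge0 //.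
apply: (@le_trans _ _ ((a * `|u z.1 - u z.2| + b * `|v z.1 - v z.2|) `^ p)).
  by apply: powR_le; rewrite ?(ltW p0).
apply: le_trans (powR_add_le _ _ _) _; rewrite ?(ltW p0) ?mulr_ge0 //.
by rewrite !powRM // mulrDr !mulrA.
Qed.

(** A single closure principle behind absolute values, linear combinations, opposites and maxima:
    every operation that is Lipschitz in two arguments and sends [(0, 0)] to 0 preserves [X0]. *)
Lemma X0_dom u v w (a b : R) : X0 s p Omega u -> X0 s p Omega v ->
  measurable_fun setT w -> 0 <= a -> 0 <= b ->
  (forall x, u x = 0 -> v x = 0 -> w x = 0) ->
  (forall x y, `|w x - w y| <= a * `|u x - u y| + b * `|v x - v y|) ->
  X0 s p Omega w.
Proof.
move=> Xu Xv mw a0 b0 uvw h; apply: X0_intro => //.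
  apply: filterS2 (X0_ae0 Xu) (X0_ae0 Xv) => x u0 v0 Ox.
  by rewrite uvw ?u0 ?v0.
have := le_gagliardo a0 b0 (X0_measurable Xu) (X0_measurable Xv) mw h.
move=> /le_lt_trans; apply; apply: lte_add_pinfty;
  apply: lte_mul_pinfty; rewrite ?lee_fin ?mulr_ge0 ?powR_ge0 //;
  exact: X0_gagliardo.
Qed.

Lemma X0_norm_fun u : X0 s p Omega u -> X0 s p Omega (fun x => `|u x|).
Proof.
move=> Xu; apply: (X0_dom Xu Xu (a := 1) (b := 0)) => //.
- by apply: measurableT_comp => //; exact: X0_measurable Xu.
- by move=> x ->; rewrite normr0.
- by move=> x y; rewrite mul1r mul0r addr0; exact: ler_dist_dist.
Qed.

Lemma gagliardo_norm_fun u : measurable_fun setT u ->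
  (G (fun x => `|u x|)%R <= G u)%E.
Proof.
move=> mu_; apply: ge0_le_integral => //.
- by move=> z _; rewrite lee_fin; exact: (gag_ge0 s p (fun x => `|u x|) z).
- apply/measurable_EFinP; apply: (@measurable_gag _ _ s p (fun x => `|u x|)); exact: measurableT_comp.
- by apply/measurable_EFinP; exact: (@measurable_gag _ _ s p u).
move=> z _; rewrite lee_fin ler_wpM2r ?invr_ge0 ?powR_ge0 //.
by apply: powR_le; rewrite ?(ltW p0) //; exact: ler_dist_dist.
Qed.

Lemma X0_addZ u w (t : R) : X0 s p Omega u -> X0 s p Omega w ->
  X0 s p Omega (fun x => u x + t * w x).
Proof.
move=> Xu Xw; apply: (X0_dom Xu Xw (a := 1) (b := `|t|)) => //.
- apply: measurable_funD; first exact: X0_measurable Xu.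
  by apply: measurable_funM => //; exact: X0_measurable Xw.
- by move=> x -> ->; rewrite mulr0 addr0.
- move=> x y; rewrite mul1r -normrM mulrBr (_ : _ - _ = (u x - u y) + (t * w x - t * w y)).
    exact: ler_normD.
  by ring.
Qed.

Lemma X0_opp w : X0 s p Omega w -> X0 s p Omega (fun x => - w x).
Proof.
move=> Xw; apply: (X0_dom Xw Xw (a := 1) (b := 0)) => //.
- by apply: measurable_funN; exact: X0_measurable Xw.
- by move=> x ->; rewrite oppr0.
- by move=> x y; rewrite mul1r mul0r addr0 -opprD normrN.
Qed.

Lemma max_dist_le (a b c d m : R) : `|a - b| <= m -> `|c - d| <= m ->
  `|Num.max a c - Num.max b d| <= m.
Proof.
by rewrite !ler_norml => /andP[h1 h2] /andP[h3 h4];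
  case: (leP a c) => ac; case: (leP b d) => bd; apply/andP; split; lra.
Qed.

Lemma X0_max u w (t : R) : 0 <= t -> X0 s p Omega u -> X0 s p Omega w ->
  (forall x, 0 <= u x) -> X0 s p Omega (fun x => Num.max (u x) (t * w x)).
Proof.
move=> t0 Xu Xw u0; apply: (X0_dom Xu Xw (a := 1) (b := t)) => //.
- apply: measurable_maxr; first exact: X0_measurable Xu.
  by apply: measurable_funM => //; exact: X0_measurable Xw.
- by move=> x -> ->; rewrite mulr0 maxxx.
- move=> x y; rewrite mul1r; apply: max_dist_le.
    by rewrite lerDl mulr_ge0.
  by rewrite -mulrBr normrM (ger0_norm t0) lerDr.
Qed.

Lemma int_pow_setTE u : X0 s p Omega u -> int_pow p setT u = int_pow p Omega u.
Proof.
move=> Xu; apply: int_pow_setT => //; last by rewrite gt_eqF.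
  exact: X0_measurable Xu.
exact: X0_ae0.
Qed.

Lemma X0_poincare : exists2 C : R, 0 < C & forall u, X0 s p Omega u ->
  (int_pow p Omega u <= C%:E * G u)%E.
Proof.
have [C C0 h] := poincare s0 p1 N0 mO bO.
exists (C + 1); first by rewrite ltr_wpDl.
move=> u Xu; apply: le_trans (h u (X0_measurable Xu) (X0_ae0 Xu)) _.
by apply: lee_wpmul2r; rewrite ?gagliardo_ge0 // lee_fin lerDl.
Qed.

End X0_theory.

(** * Bump functions *)

Section bump.
Context {R : realType} {N : nat}.
Local Notation T := 'rV[R]_N.
Local Notation mu := (@leb R N).
Implicit Types (u v w : T -> R).

Lemma cube_norm (x y : T) (r : R) : 0 < r -> cube x r y <-> `|y - x| < r.
Proof.
by move=> r0; rewrite (cube_ball x r0) -ball_normE /= distrC.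
Qed.

Lemma nneseries_geo_le (b : nat -> \bar R) (B t : R) : 0 <= t < 1 ->
  (forall n, (0 <= b n)%E) -> (forall n, (b n <= (B * t ^+ n)%:E)%E) ->
  (\sum_(n <oo) b n <= (B / (1 - t))%:E)%E.
Proof.
move=> /andP[t0 t1] b0 bB.
apply: lime_le.
  by apply: is_cvg_nneseries => n _ _; exact: b0.
apply: nearW => n.
apply: (@le_trans _ _ (\sum_(0 <= k < n) (B * t ^+ k)%:E)%E).
  by apply: lee_sum => k _.
rewrite sumEFin lee_fin -mulr_sumr.
have B0 : 0 <= B by have := le_trans (b0 0%N) (bB 0%N); rewrite lee_fin expr0 mulr1.
rewrite ler_wpM2l //.
rewrite big_mkord -[leRHS]mul1r ler_pdivlMr ?subr_gt0 //.
have := subrX1 t n; have : 0 <= t ^+ n by rewrite exprn_ge0.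
by move: (\sum_(i < n) _) (t ^+ n) => S tn; lra.
Qed.

(** [g] is dominated by the sum of the [c n] times the indicators of the cubes of radius [rho n],
    and their integrals are dominated by a geometric series. Whole cubes replace the shells between
    them, so disjointness does not have to be tracked. *)
Lemma shell_integral (x : T) (c rho : nat -> R) (g : T -> R) (B t : R) :
  0 <= t < 1 -> (forall n, 0 <= c n) -> (forall n, 0 <= rho n) ->
  (forall n, c n * (2 * rho n) ^+ N <= B * t ^+ n) ->
  measurable_fun setT g -> (forall y, 0 <= g y) ->
  (forall y, g y != 0 -> exists2 n, cube x (rho n) y & g y <= c n) ->
  (\int[mu]_y (g y)%:E <= (B / (1 - t))%:E)%E.
Proof.
move=> t01 c0 rho0 crho mg g0 hg.
pose b n (y : T) : \bar R := (c n * \1_(cube x (rho n)) y)%:E.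
have b0 n y : (0 <= b n y)%E by rewrite lee_fin mulr_ge0.
have mb n : measurable_fun setT (b n).
  apply/measurable_EFinP; apply: measurable_funM => //.
  by apply: measurable_indic; exact: measurable_cube.
apply: (@le_trans _ _ (\int[mu]_y (\sum_(n <oo) b n y))%E).
  apply: ge0_le_integral => //.
  - by move=> y _; rewrite lee_fin.
  - exact/measurable_EFinP.
  - by apply: ge0_emeasurable_sum.
  move=> y _; have [->|gy0] := eqVneq (g y) 0.
    by apply: nneseries_ge0 => n _ _; exact: b0.
  have [n xy gy] := hg y gy0.
  apply: (@le_trans _ _ (b n y)).
    by rewrite /b indicE mem_set // mulr1 lee_fin.
  apply: le_trans (nneseries_lim_ge n.+1 (fun k _ _ => b0 k y)).
  rewrite big_nat_recr //=; apply: leeDr.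
  by apply: sume_ge0 => k _; exact: b0.
rewrite integral_nneseries //.
apply: nneseries_geo_le => // n; first by apply: integral_ge0 => y _; exact: b0.
rewrite /b; under eq_integral do rewrite EFinM.
rewrite ge0_integralZl_EFin //; last first.
  by apply/measurable_EFinP; apply: measurable_indic; exact: measurable_cube.
rewrite integral_indic //; last exact: measurable_cube.
rewrite setIT [X in (_ * X)%E](leb_cube x (rho0 n)) -EFinM lee_fin; exact: crho.
Qed.

Lemma powR_exprn (a al : R) n : 0 <= a -> (a ^+ n) `^ al = (a `^ al) ^+ n.
Proof.
by move=> a0; rewrite -powR_mulrn // -powRrM mulrC powRrM powR_mulrn // powR_ge0.
Qed.

Lemma powR_lt1 (a al : R) : 0 < al -> 0 <= a -> a < 1 -> a `^ al < 1.
Proof.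
move=> al0 a0 a1; have <- : 1 `^ al = 1 :> R by rewrite powR1.
by rewrite gt0_ltr_powR ?nnegrE.
Qed.

Lemma dyadic_far (r d : R) : 0 < r -> r <= d ->
  exists n : nat, r * 2 ^+ n <= d < r * 2 ^+ n.+1.
Proof.
move=> r0 rd.
have ex : exists n, d < r * 2 ^+ n.+1.
  exists (Num.truncn (d / r)); rewrite -ltr_pdivrMl // mulrC.
  apply: lt_trans (truncnS_gt _) _.
  by rewrite -natrX ltr_nat ltn_expl.
case: (ex_minnP ex) => -[|n] dn mn; first by exists 0%N; rewrite dn expr0 mulr1 rd.
exists n.+1; rewrite dn andbT leNgt; apply/negP => /mn; by rewrite ltnn.
Qed.

Lemma dyadic_near (r d : R) : 0 < d -> d < r ->
  exists n : nat, r * 2^-1 ^+ n.+1 <= d < r * 2^-1 ^+ n.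
Proof.
move=> d0 dr; have r0 : 0 < r by exact: lt_trans dr.
have ex : exists n, r * 2^-1 ^+ n.+1 <= d.
  exists (Num.truncn (r / d)); rewrite exprVn ler_pdivrMr ?exprn_gt0 //.
  rewrite -ler_pdivrMl // mulrC ltW //; apply: lt_trans (truncnS_gt _) _.
  by rewrite -natrX ltr_nat ltn_expl.
case: (ex_minnP ex) => -[|n] dn mn; first by exists 0%N; rewrite dn expr0 mulr1 dr.
exists n.+1; rewrite dn /= ltNge; apply/negP => /mn; by rewrite ltnn.
Qed.

(* Dominates the Gagliardo integrand of a (1/r)-Lipschitz function with values
   in [0, 1]. *)
Definition lipker (r p a : R) (z : T * T) : R :=
  Num.min 1 ((`|z.1 - z.2| / r) `^ p) / enorm (z.1 - z.2) `^ a.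

Lemma lipker_ge0 r p a z : 0 <= lipker r p a z.
Proof. by rewrite divr_ge0 ?powR_ge0 // le_min ler01 powR_ge0. Qed.

Lemma lipkerC r p a x y : lipker r p a (x, y) = lipker r p a (y, x).
Proof. by rewrite /lipker /= -[in LHS](opprB y x) normrN enormN. Qed.

Lemma measurable_mxnorm d (S : measurableType d) (f : S -> T) :
  measurable_fun setT f -> measurable_fun setT (fun t => `|f t|).
Proof.
move=> mf; apply: (@measurableT_comp _ _ _ _ _ _ (fun x : T => `|x|)) => //.
apply: measurable_fun_within; first exact: openT.
by apply: continuous_subspaceT => x; exact: norm_continuous.
Qed.

Lemma measurable_lipker r p a : measurable_fun setT (lipker r p a).
Proof.
apply: measurable_funM; last exact: measurable_kernel_rV.
apply: measurable_minr => //; apply: (measurableT_comp (measurable_powR _)).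
by apply: measurable_funM => //; apply: measurable_mxnorm; exact: measurable_rV_sub.
Qed.

Lemma enorm0 : enorm (0 : T) = 0.
Proof. by rewrite /enorm big1 ?sqrtr0 // => i _; rewrite mxE expr0n. Qed.

Lemma enorm_ge_norm (x : T) : `|x| <= enorm x.
Proof.
rewrite [leLHS]mx_normrE; apply: bigmax_le => [|[i j] _]; first exact: enorm_ge0.
by rewrite ord1; exact: enorm_coord.
Qed.

(** Split at the cube of radius [r] around [x]. The dyadic cubes shrinking to [x] contribute terms
    of order [2 ^ (- n p (1 - s))], summable because [s < 1]; the growing ones contribute
    [2 ^ (- n s p)], summable because [s > 0]. *)
Lemma lipker_integral (s p r : R) : (0 < N)%N -> 0 < s < 1 -> 1 < p -> 0 < r ->
  exists2 C : R, 0 <= C &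
    forall x, (\int[mu]_y (lipker r p (N%:R + s * p) (x, y))%:E <= C%:E)%E.
Proof.
move=> N0 /andP[s0 s1] p1 r0; set a := N%:R + s * p.
have p0 : 0 < p by exact: lt_trans p1.
have a0 : 0 < a by rewrite ltr_wpDl // mulr_gt0.
pose t1 := 2^-1 `^ (p * (1 - s)).
have t1P : 0 <= t1 < 1.
  rewrite powR_ge0 powR_lt1 //; first by rewrite mulr_gt0 // subr_gt0.
  by rewrite invf_lt1 // ltr1n.
pose t2 := 2^-1 `^ (s * p).
have t2P : 0 <= t2 < 1.
  by rewrite powR_ge0 powR_lt1 ?mulr_gt0 // invf_lt1 // ltr1n.
pose B1 := (r / 2) `^ (- a) * (2 * r) ^+ N.
pose B2 := r `^ (- a) * (4 * r) ^+ N.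
exists (B1 / (1 - t1) + B2 / (1 - t2)).
  case/andP: t1P => _ t1P; case/andP: t2P => _ t2P.
  by rewrite addr_ge0 // divr_ge0 ?subr_ge0 ?(ltW t1P) ?(ltW t2P) // mulr_ge0 ?powR_ge0 // exprn_ge0 // mulr_ge0 // ltW.
move=> x; pose g y := lipker r p a (x, y).
have mg : measurable_fun setT g.
  by apply: (@measurableT_comp _ _ _ _ _ _ (lipker r p a)); [exact: measurable_lipker|exact: measurable_pair1].
have mC : measurable (cube x r) by exact: measurable_cube.
pose g1 y := g y * \1_(cube x r) y.
pose g2 y := g y * \1_(~` cube x r) y.
have g0 y : 0 <= g y by exact: lipker_ge0.
(* At [y = x] the kernel takes the default value 0, so a nonzero value of [g] forces a positive
   distance. *)
have gx0 y : g y != 0 -> 0 < enorm (x - y).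
  move=> h; apply: enorm_gt0; apply: contra_neq h => xy.
  by rewrite /g /lipker /= xy enorm0 powR0 ?invr0 ?mulr0 // gt_eqF.
have mg1 : measurable_fun setT g1.
  by apply: measurable_funM => //; exact: measurable_indic.
have mg2 : measurable_fun setT g2.
  by apply: measurable_funM => //; apply: measurable_indic; exact: measurableC.
have -> : (\int[mu]_y (g y)%:E = \int[mu]_y (g1 y)%:E + \int[mu]_y (g2 y)%:E)%E.
  rewrite -ge0_integralD //; last 4 first.
  - by move=> y _; rewrite lee_fin mulr_ge0.
  - exact/measurable_EFinP.
  - by move=> y _; rewrite lee_fin mulr_ge0.
  - exact/measurable_EFinP.
  apply: eq_integral => y _; rewrite -EFinD -mulrDr !indicE in_setC.
  by case: (y \in _); rewrite /= ?addr0 ?add0r mulr1.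
rewrite EFinD; apply: leeD.
  (* On the shell between [r / 2^(n+1)] and [r / 2^n], the numerator is bounded through the outer
     radius and the kernel through the inner one. *)
  pose c n := ((2^-1 ^+ n) `^ p) * (r * 2^-1 ^+ n / 2) `^ (- a).
  apply: (@shell_integral x c (fun n => r * 2^-1 ^+ n)) => //.
  - by move=> n; rewrite mulr_ge0 ?powR_ge0.
  - by move=> n; rewrite mulr_ge0 ?exprn_ge0 // ltW.
  - move=> n; rewrite /c /B1 /t1 -powR_exprn //; set e := 2^-1 ^+ n.
    have e0 : 0 < e by rewrite exprn_gt0.
    have -> : p * (1 - s) = p - a + N%:R by rewrite /a; ring.
    rewrite (_ : r * e / 2 = r / 2 * e); last by ring.
    rewrite powRM ?divr_ge0 ?(ltW r0) ?(ltW e0) // (_ : 2 * (r * e) = 2 * r * e); last by ring.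
    rewrite exprMn !powRD ?(gt_eqF e0) ?implybT // powR_mulrn ?(ltW e0) //.
    by apply: le_of_eq; ring.
  - by move=> y; rewrite mulr_ge0.
  - move=> y; rewrite /g1 indicE; case: (boolP (y \in _)); last by rewrite mulr0 eqxx.
    rewrite inE /= mulr1 => yr gy0; have xy0 := gx0 y gy0.
    have d0 : 0 < `|x - y|.
      by rewrite normr_gt0; apply: contraTneq xy0 => ->; rewrite enorm0 ltxx.
    have dr : `|x - y| < r by move/(cube_norm _ _ r0): yr; rewrite distrC.
    have [n /andP[nd dn]] := dyadic_near d0 dr; exists n.
      by apply/cube_norm; [exact: le_lt_trans (ltW d0) dn|rewrite distrC].
    rewrite /g /lipker /c -/a powRN; apply: ler_pM; rewrite ?invr_ge0 ?powR_ge0 //.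
    + by rewrite le_min ler01 powR_ge0.
    + rewrite ge_min; apply/orP; right; apply: powR_le; rewrite ?(ltW p0) ?divr_ge0 ?(ltW r0) //.
      by rewrite ler_pdivrMr // mulrC ltW.
    + rewrite lef_pV2 ?posrE ?powR_gt0 //; last first.
        by rewrite divr_gt0 // mulr_gt0 // exprn_gt0.
      apply: powR_le; rewrite ?(ltW a0) //.
        by rewrite divr_ge0 // mulr_ge0 ?exprn_ge0 // ltW.
      apply: le_trans (enorm_ge_norm _); apply: le_trans nd.
      by rewrite exprSr mulrA.
pose c n := (r * 2 ^+ n) `^ (- a).
apply: (@shell_integral x c (fun n => r * 2 ^+ n.+1)) => //.
- by move=> n; rewrite powR_ge0.
- by move=> n; rewrite mulr_ge0 ?exprn_ge0 // ltW.
- move=> n; rewrite /c /B2 /t2 -powR_exprn // exprVn exprS; set e := 2 ^+ n.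
  have e0 : 0 < e by rewrite exprn_gt0.
  have -> : e^-1 `^ (s * p) = e `^ (- a + N%:R).
    by rewrite -powR_inv1 ?(ltW e0) // -powRrM; congr (_ `^ _); rewrite /a; ring.
  rewrite powRM ?(ltW r0) ?(ltW e0) // (_ : 2 * (r * (2 * e)) = 4 * r * e); last by ring.
  rewrite exprMn !powRD ?(gt_eqF e0) ?implybT // powR_mulrn ?(ltW e0) //.
  by apply: le_of_eq; ring.
- by move=> y; rewrite mulr_ge0.
- move=> y; rewrite /g2 indicE in_setC; case: (boolP (y \in _)); first by rewrite mulr0 eqxx.
  rewrite notin_setE /= mulr1 => yr gy0.
  have dr : r <= `|x - y|.
    by rewrite leNgt distrC; apply/negP => /(cube_norm _ _ r0).
  have [n /andP[nd dn]] := dyadic_far r0 dr; exists n.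
    by apply/cube_norm; [rewrite mulr_gt0 ?exprn_gt0|rewrite distrC].
  rewrite /g /lipker /c -/a powRN ler_pdivrMr; last by rewrite powR_gt0 // gx0.
  rewrite ler_pdivlMl; last by rewrite powR_gt0 // mulr_gt0 ?exprn_gt0.
  apply: (@le_trans _ _ ((r * 2 ^+ n) `^ a)).
    by rewrite ler_piMr ?powR_ge0 // ge_min lexx.
  apply: powR_le; rewrite ?(ltW a0) //; first by rewrite mulr_ge0 ?exprn_ge0 // ltW.
  exact: le_trans (enorm_ge_norm _).
Qed.

(** The profile [2 - |x - c| / r] cut off to [[0, 1]] is [1/r]-Lipschitz and lives on the double
    cube [Q]. The Gagliardo integrand vanishes unless [x] or [y] is in [Q], so [lipker] times the
    sum of the two indicators dominates it; Tonelli's theorem bounds each of the two integrals by a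
    constant times the measure of [Q]. *)
Lemma X0_bump (s p r : R) (Omega : set T) (c : T) :
  (0 < N)%N -> 0 < s < 1 -> 1 < p -> measurable Omega -> bounded_set Omega ->
  0 < r -> cube c (2 * r) `<=` Omega ->
  exists phi : T -> R, [/\ X0 s p Omega phi, forall x, 0 <= phi x <= 1 &
    forall x, cube c r x -> phi x = 1].
Proof.
move=> N0 s01 p1 mO bO r0 cO; have /andP[s0 s1] := s01.
have p0 : 0 < p by exact: lt_trans p1.
have r20 : 0 < 2 * r by rewrite mulr_gt0.
pose phi (x : T) : R := Num.max 0 (Num.min 1 (2 - `|x - c| / r)).
have phi01 x : 0 <= phi x <= 1.
  by rewrite le_max lexx /= ge_max ler01 ge_min lexx.
have mphi : measurable_fun setT phi.
  apply: measurable_maxr => //; apply: measurable_minr => //; apply: measurable_funB => //.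
  apply: measurable_funM => //; apply: measurable_mxnorm.
  apply: measurable_fun_rVP => i; under eq_fun do rewrite !mxE.
  by apply: measurable_funB => //; exact: measurable_rV_coord.
have phi0 x : ~ cube c (2 * r) x -> phi x = 0.
  move=> nx; apply: max_l; rewrite ge_min; apply/orP; right.
  rewrite subr_le0 ler_pdivlMr // leNgt; apply/negP => h; apply: nx.
  exact/(cube_norm _ _ r20).
have lip x y : `|phi x - phi y| <= Num.min 1 (`|x - y| / r).
  rewrite le_min; apply/andP; split.
    have := phi01 x; have := phi01 y; rewrite ler_norml; lra.
  have h : `|(2 - `|x - c| / r) - (2 - `|y - c| / r)| <= `|x - y| / r.
    rewrite (_ : _ - _ = (`|y - c| - `|x - c|) / r); last by ring.
    rewrite normrM [X in _ * X]ger0_norm ?invr_ge0 ?(ltW r0) //.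
    rewrite ler_wpM2r ?invr_ge0 ?(ltW r0) //.
    apply: le_trans (ler_dist_dist _ _) _.
    have -> : y - c - (x - c) = y - x by rewrite opprB addrA subrK.
    by rewrite distrC.
  have xy0 : 0 <= `|x - y| / r by rewrite divr_ge0 // ltW.
  have minle (a b a' b' m : R) : `|a - b| <= m -> `|a' - b'| <= m ->
      `|Num.min a a' - Num.min b b'| <= m.
    by rewrite !ler_norml => /andP[h1 h2] /andP[h3 h4];
      case: (leP a a') => ac; case: (leP b b') => bd; apply/andP; split; lra.
  apply: max_dist_le; first by rewrite subrr normr0.
  by apply: minle h; rewrite subrr normr0.
exists phi; split => //; last first.
  move=> x /(cube_norm _ _ r0) xr; rewrite /phi min_l ?max_r // lerBrDl -lerBrDr.
  by rewrite ler_pdivrMr //; move: xr; move: `|x - c| => d; lra.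
have [C C0 hC] := lipker_integral N0 s01 p1 r0.
pose k := lipker r p (N%:R + s * p).
have mk : measurable_fun setT (fun z => (k z)%:E).
  by apply/measurable_EFinP; exact: measurable_lipker.
pose Q := cube c (2 * r).
have mQ : measurable Q by exact: measurable_cube.
have mQ1 : measurable_fun setT (fun z : T * T => (\1_Q z.1 : R)).
  by apply: (measurableT_comp (measurable_indic mQ)).
have mQ2 : measurable_fun setT (fun z : T * T => (\1_Q z.2 : R)).
  by apply: (measurableT_comp (measurable_indic mQ)).
have mk1 : measurable_fun setT (fun z => (k z * \1_Q z.1)%:E).
  by apply/measurable_EFinP; apply: measurable_funM => //; exact/measurable_EFinP.
have mk2 : measurable_fun setT (fun z => (k z * \1_Q z.2)%:E).
  by apply/measurable_EFinP; apply: measurable_funM => //; exact/measurable_EFinP.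
have k0 z : 0 <= k z by exact: lipker_ge0.
have k10 z : (0 <= (k z * \1_Q z.1)%:E)%E by rewrite lee_fin mulr_ge0.
have k20 z : (0 <= (k z * \1_Q z.2)%:E)%E by rewrite lee_fin mulr_ge0.
have QC : (\int[mu]_x (C%:E * (\1_Q x)%:E) < +oo)%E.
  rewrite ge0_integralZl_EFin //; last by apply/measurable_EFinP; exact: measurable_indic.
  rewrite integral_indic // setIT.
  rewrite [X in (_ * X)%E](leb_cube c (ltW r20)) -EFinM ltry //.
have mkx x : measurable_fun setT (fun y => (k (x, y))%:E).
  apply/measurable_EFinP; apply: (@measurableT_comp _ _ _ _ _ _ k).
    exact: measurable_lipker.
  exact: measurable_pair1.
have mCQ : measurable_fun setT (fun x => C%:E * (\1_Q x)%:E)%E.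
  by apply/measurable_EFinP; apply: measurable_funM => //; exact: measurable_indic.
have I1 : (\int[mu \x mu]_z (k z * \1_Q z.1)%:E < +oo)%E.
  rewrite fubini_tonelli1 //; apply: le_lt_trans QC.
  apply: ge0_le_integral => //.
  - by move=> x _; apply: integral_ge0 => y _.
  - exact: measurable_fun_fubini_tonelli_F.
  move=> x _; rewrite /fubini_F /=.
  under eq_integral do rewrite EFinM muleC.
  rewrite ge0_integralZl_EFin //; last by move=> y _; rewrite lee_fin.
  by rewrite muleC lee_wpmul2r ?lee_fin.
have I2 : (\int[mu \x mu]_z (k z * \1_Q z.2)%:E < +oo)%E.
  rewrite fubini_tonelli1 // fubini_tonelli //; apply: le_lt_trans QC.
  apply: ge0_le_integral => //.
  - by move=> x _; apply: integral_ge0 => y _.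
  - exact: (@measurable_fun_fubini_tonelli_G _ _ _ _ R mu (fun z => (k z * \1_Q z.2)%:E) mk2 k20).
  move=> y _; rewrite /fubini_G /=.
  under eq_integral do rewrite EFinM muleC /k lipkerC.
  rewrite ge0_integralZl_EFin //; last by move=> x _; rewrite lee_fin lipker_ge0.
  by rewrite muleC lee_wpmul2r ?lee_fin.
apply: (X0_intro N0 s0 p1 mO bO mphi).
  by apply: aeW => x Ox; apply: phi0 => /cO.
apply: (@le_lt_trans _ _ (\int[mu \x mu]_z (k z * \1_Q z.1)%:E + \int[mu \x mu]_z (k z * \1_Q z.2)%:E)%E); last exact: lte_add_pinfty.
rewrite -ge0_integralD //; apply: ge0_le_integral => //.
- by move=> z _; rewrite lee_fin; exact: (gag_ge0 s p phi z).
- by apply/measurable_EFinP; exact: (@measurable_gag _ _ s p phi).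
- exact: emeasurable_funD.
move=> [x y] _; rewrite /= -EFinD lee_fin -mulrDr.
have gk : gag s p phi (x, y) <= k (x, y).
  rewrite /gag /k /lipker ler_wpM2r ?invr_ge0 ?powR_ge0 //=.
  rewrite le_min; have := lip x y; rewrite le_min => /andP[l1 l2].
  by rewrite powR_le1 ?(ltW p0) //= powR_le // ltW.
have [xyQ|xyQ] := pselect (Q x \/ Q y); last first.
  have [xQ yQ] : ~ Q x /\ ~ Q y by split => h; apply: xyQ; [left|right].
  by rewrite !phi0 // subrr normr0 powR0 ?gt_eqF // mul0r mulr_ge0 ?addr_ge0.
apply: le_trans gk _; rewrite ler_peMr //.
case: xyQ => h; rewrite [X in X + _]indicE [X in _ + X]indicE (mem_set h).
  by rewrite lerDl.
by rewrite lerDr.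
Qed.

End bump.

(** * Compactness *)

Section selection.

Lemma ultra_finite (U : set_system nat) (I : finType) (l : nat -> I) :
  UltraFilter U -> exists c, U [set n | l n = c].
Proof.
move=> UU; apply: contrapT => h.
have hc c : U [set n | l n <> c].
  have [hc|//] := in_ultra_setVsetC [set n | l n = c] UU.
  by exfalso; apply: h; exists c.
have UF : Filter U by exact: ultra_proper.
have /filter_ex[n] := @filter_forall _ _ _ U UF hc.
by move=> /(_ (l n)).
Qed.

(* An ultrafilter containing the tails of nat picks one value of every label;
   phi k is an index >= k at which the labels 0, ..., k take these values. *)
Lemma diagonal_selection (I : nat -> finType) (l : forall k, nat -> I k) :
  exists phi : nat -> nat, (forall k, (k <= phi k)%N) /\
    forall j k, (j <= k)%N -> l j (phi k) = l j (phi j).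
Proof.
have [U [UU FU]] := @ultraFilterLemma nat \oo _.
have UF : ProperFilter U by exact: ultra_proper.
have cP k : {c | U [set n | l k n = c]} by apply: cid; exact: ultra_finite.
pose c k := sval (cP k).
have /choice[phi hphi] : forall k, exists n, (k <= n)%N /\
    forall j : 'I_k.+1, l j n = c j.
  move=> k; have h1 : U [set n | (k <= n)%N] by apply: FU; exact: nbhs_infty_ge.
  have h2 : U [set n | forall j : 'I_k.+1, l j n = c j].
    by apply: filter_forall => j; exact: svalP (cP j).
  have /filter_ex[n [n1 n2]] : U ([set n | (k <= n)%N] `&`
    [set n | forall j : 'I_k.+1, l j n = c j]) by exact: filterI.
  by exists n.
exists phi; split=> [k|j k jk]; first by have [] := hphi k.
have [_ /(_ (inord j))] := hphi k; rewrite inordK ?ltnS // => ->.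
by have [_ /(_ ord_max)] := hphi j.
Qed.
End selection.

(** * Averaging over the cells of a grid *)

Section grid.
Context {R : realType} {N : nat}.
Local Notation T := 'rV[R]_N.
Local Notation mu := (@leb R N).
Variables (B : R) (L : nat).
Hypotheses (B0 : 0 < B) (L0 : (0 < L)%N).
(** The grid covers [[- B, 2 B)] in each coordinate. Cells are half-open, so a grid ending at [B]
    would miss the points with a coordinate equal to [B]. *)
Let d : R := 3 * B / L%:R.

Let d0 : 0 < d. Proof. by rewrite divr_gt0 ?mulr_gt0 ?ltr0n. Qed.

Definition cell (k : {ffun 'I_N -> 'I_L}) : set T :=
  [set x | forall i, [set` `[- B + (k i)%:R * d, - B + (k i).+1%:R * d[] (x ord0 i)].

Lemma measurable_cell k : measurable (cell k).
Proof.
apply: (@measurable_preimage_coord _ _ (fun i =>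
  [set` `[- B + (k i)%:R * d, - B + (k i).+1%:R * d[])) => i.
exact: measurable_itv.
Qed.

Lemma leb_cell k : mu (cell k) = (d ^+ N)%:E.
Proof.
rewrite (@leb_box _ _ (fun i => [set` `[- B + (k i)%:R * d, - B + (k i).+1%:R * d[])) //.
rewrite (eq_bigr (fun=> d%:E)) => [|i _]; first by rewrite prodEFin prodr_const card_ord.
rewrite lebesgue_measure_itv /= lte_fin ltrD2l ltr_pM2r // ltr_nat ltnSn.
by rewrite -EFinB; congr EFin; rewrite -natr1; ring.
Qed.

Lemma cell_dist k (x y : T) i : cell k x -> cell k y -> `|x ord0 i - y ord0 i| <= d.
Proof.
move=> /(_ i) + /(_ i); rewrite /= !in_itv /= -natr1 mulrDl mul1r ler_norml.
by move: (_ * d) (x _ _) (y _ _) => kd a b; lra.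
Qed.

Lemma cell_cover (x : T) : (forall i, `|x ord0 i| <= B) -> exists k, cell k x.
Proof.
move=> xB.
have h i : (Num.truncn ((x ord0 i + B) / d) < L)%N.
  have := xB i; rewrite ler_norml => /andP[h1 h2].
  rewrite truncn_lt_nat ?ltr_pdivrMr //; last by rewrite divr_ge0 ?(ltW d0) //; lra.
  have -> : L%:R * d = 3 * B by rewrite /d mulrC divfK // pnatr_eq0 -lt0n.
  by apply: (le_lt_trans (lerD h2 (lexx B))); move: B0; lra.
exists [ffun i => Ordinal (h i)] => i; rewrite /= in_itv /= ffunE /=.
have := xB i; rewrite ler_norml => /andP[h1 h2].
have q0 : 0 <= (x ord0 i + B) / d by rewrite divr_ge0 ?(ltW d0) //; lra.
have /andP[] := truncn_itv q0.
rewrite ler_pdivlMr // ltr_pdivrMr //.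
by move=> e1 e2; rewrite [leLHS]addrC [ltRHS]addrC lerBlDr ltrBrDr e1.
Qed.

Lemma cell_disjoint : trivIset setT cell.
Proof.
move=> k k' _ _ [x [kx kx']]; apply/ffunP => i; apply/val_inj/eqP => /=.
move: (kx i) (kx' i); rewrite /= !in_itv /= => /andP[a1 a2] /andP[b1 b2].
have h1 : (k i)%:R * d < (k' i).+1%:R * d by lra.
have h2 : (k' i)%:R * d < (k i).+1%:R * d by lra.
move: h1 h2; rewrite !ltr_pM2r // !ltr_nat !ltnS eqn_leq => -> ->; done.
Qed.

Variables (s p : R).
Hypotheses (s0 : 0 < s) (p1 : 1 < p).
Local Notation G u := (gagliardo s p setT u).

Let p0 : 0 < p. Proof. exact: lt_trans p1. Qed.

(** Some point of the cell does not exceed the mean of [gagx] by more than 1. The slack, which is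
    [d ^+ N] after multiplication by the volume, makes the contradiction strict when the opposite
    inequality is integrated over the cell. *)
Lemma gagx_mean u k : measurable_fun setT u -> (G u < +oo)%E ->
  exists2 y, cell k y &
    ((d ^+ N)%:E * gagx s p u y <= \int[mu]_(x in cell k) gagx s p u x + (d ^+ N)%:E)%E.
Proof.
move=> mu_ Gu; apply: contrapT => h.
have mg := measurable_gagx s p mu_.
have mc := measurable_cell k.
have dN : 0 < d ^+ N by rewrite exprn_gt0.
have g0 := gagx_ge0 s p u.
set I := (\int[mu]_(x in _) _)%E in h.
have I0 : (0 <= I)%E by exact: integral_ge0.
have Ifin : (I < +oo)%E.
  apply: le_lt_trans Gu; rewrite gagliardoE //.
  by apply: ge0_subset_integral => //.
have Ifn : I \is a fin_num by rewrite ge0_fin_numE.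
have hI y : cell k y -> (I + (d ^+ N)%:E <= (d ^+ N)%:E * gagx s p u y)%E.
  move=> ky; rewrite leNgt; apply/negP => hy; apply: h; exists y => //; exact: ltW.
have : ((I + (d ^+ N)%:E) * (d ^+ N)%:E <= (d ^+ N)%:E * I)%E.
  rewrite /I -ge0_integralZl //; last 2 first.
  - exact: measurable_funTS.
  - by rewrite lee_fin ltW.
  rewrite -[X in (_ * X <= _)%E](leb_cell k) -integral_cst //.
  apply: ge0_le_integral => //.
  - by move=> y _; rewrite adde_ge0 // lee_fin ltW.
  - by apply: emeasurable_funM => //; exact: measurable_funTS.
rewrite -(fineK Ifn) -EFinD -!EFinM lee_fin mulrDl addrC [_ * fine I]mulrC gerDr.
by rewrite leNgt mulr_gt0.
Qed.

(** The constant on a cell is the value of [u] at the point given by [gagx_mean]. The factor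
    [(sqrt N * d) ^ (N + s p)] of the pointwise bound contains the volume [d ^ N], which turns
    [gagx] at that point into its integral over the cell; the remaining [d ^ (s p)] tends to 0 with
    the mesh, uniformly for bounded seminorm. The slacks add up to [(3 * B) ^+ N]. *)
Lemma cell_approx u (M : R) : measurable_fun setT u -> (G u <= M%:E)%E ->
  exists a : {ffun 'I_N -> 'I_L} -> R,
    (\sum_k \int[mu]_(x in cell k) (`|u x - a k| `^ p)%:E <=
      (Num.sqrt N%:R `^ (N%:R + s * p) * d `^ (s * p) * (M + (3 * B) ^+ N))%:E)%E.
Proof.
move=> mu_ GM.
have Gu : (G u < +oo)%E by apply: le_lt_trans GM (ltry _).
have a0 : 0 < N%:R + s * p by rewrite ltr_wpDl // mulr_gt0.
have dN : 0 < d ^+ N by rewrite exprn_gt0.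
have /choice[y hy] : forall k, exists y, cell k y /\
    ((d ^+ N)%:E * gagx s p u y <= \int[mu]_(x in cell k) gagx s p u x + (d ^+ N)%:E)%E.
  by move=> k; have [y ky gy] := gagx_mean k mu_ Gu; exists y.
exists (fun k => u (y k)).
set K := (Num.sqrt N%:R * d) `^ (N%:R + s * p).
have KE : K = Num.sqrt N%:R `^ (N%:R + s * p) * d `^ (s * p) * d ^+ N.
  rewrite /K powRM ?sqrtr_ge0 ?(ltW d0) // -mulrA; congr (_ * _).
  by rewrite powRD ?(gt_eqF d0) ?implybT // powR_mulrn ?(ltW d0) // mulrC.
have K0 : 0 <= K by exact: powR_ge0.
set K' := Num.sqrt N%:R `^ _ * d `^ _ in KE *.
have K'0 : 0 <= K' by rewrite mulr_ge0 ?powR_ge0.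
have g0 := gagx_ge0 s p u.
have mg := measurable_gagx s p mu_.
have key k : (\int[mu]_(x in cell k) (`|u x - u (y k)| `^ p)%:E <=
    K'%:E * (\int[mu]_(x in cell k) gagx s p u x + (d ^+ N)%:E))%E.
  have [ky gy] := hy k; have mc := measurable_cell k.
  apply: (@le_trans _ _ (K%:E * gagx s p u (y k))%E); last first.
    by rewrite KE EFinM -muleA; apply: lee_wpmul2l.
  have mgy : measurable_fun setT (fun x => (gag s p u (y k, x))%:E).
    by apply/measurable_EFinP; exact: measurable_gag1.
  have gy0 x : (0 <= (gag s p u (y k, x))%:E)%E by rewrite lee_fin gag_ge0.
  rewrite /gagx -ge0_integralZl_EFin //.
  apply: (@le_trans _ _ (\int[mu]_(x in cell k) (K%:E * (gag s p u (y k, x))%:E))%E).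
    apply: ge0_le_integral => //.
    - apply/measurable_EFinP; apply: measurable_normr_powR.
      by apply: measurable_funB => //; exact: measurable_funTS.
    - by apply: emeasurable_funM => //; exact: measurable_funTS.
    - move=> x kx; rewrite -EFinM lee_fin distrC; apply: gag_lower => // i.
      exact: cell_dist ky kx.
  apply: ge0_subset_integral => //.
  - by apply: emeasurable_funM.
  - by move=> x _; exact: mule_ge0.
apply: (@le_trans _ _ (\sum_k (K'%:E * (\int[mu]_(x in cell k) gagx s p u x + (d ^+ N)%:E)))%E).
  by apply: lee_sum => k _; exact: key.
rewrite -ge0_sume_distrr; last first.
  by move=> k _; rewrite adde_ge0 ?integral_ge0 // lee_fin ltW.
rewrite [leRHS]EFinM; apply: lee_wpmul2l => //.
rewrite big_split /= EFinD; apply: leeD.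
  rewrite -ge0_integral_bigsetU //=; last 4 first.
  - exact: measurable_cell.
  - exact: index_enum_uniq.
  - by move=> k k' _ _; exact: cell_disjoint.
  - exact: measurable_funTS.
  apply: le_trans GM; rewrite gagliardoE //; apply: ge0_subset_integral => //.
  by apply: bigsetU_measurable => k _; exact: measurable_cell.
rewrite sumEFin lee_fin sumr_const card_ffun !card_ord -[X in X <= _]mulr_natl natrX -exprMn.
by rewrite /d mulrCA divff ?mulr1 // pnatr_eq0 -lt0n.
Qed.

End grid.

Section compactness.
Context {R : realType} {N : nat}.
Local Notation T := 'rV[R]_N.
Local Notation mu := (@leb R N).
Variables (s p : R) (Omega : set T).
Hypotheses (N0 : (0 < N)%N) (s0 : 0 < s) (p1 : 1 < p).
Hypotheses (mO : measurable Omega) (bO : bounded_set Omega).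
Local Notation G u := (gagliardo s p setT u).

Let p0 : 0 < p. Proof. exact: lt_trans p1. Qed.

Lemma powR_add3_le (a b c : R) : 0 <= a -> 0 <= b -> 0 <= c ->
  (a + b + c) `^ p <= 4 `^ p * (a `^ p + b `^ p + c `^ p).
Proof.
move=> a0 b0 c0.
apply: (le_trans (powR_add_le (ltW p0) (addr_ge0 a0 b0) c0)).
have -> : 4 `^ p = 2 `^ p * 2 `^ p :> R.
  by rewrite -powRM //; congr (_ `^ _); rewrite -natrM.
rewrite -mulrA ler_wpM2l ?powR_ge0 // [leRHS]mulrDr lerD ?powR_add_le ?(ltW p0) //.
by rewrite ler_peMl ?powR_ge0 // -[leLHS](powRr0 2) ler_powR ?ler1n // (ltW p0).
Qed.

(* The label of u collects the constants of [cell_approx], rounded to a finite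
   grid. *)
Lemma totally_bounded (M eps : R) : 0 < eps -> exists (I : finType) (l : (T -> R) -> I),
  forall u w, X0 s p Omega u -> X0 s p Omega w ->
    (G u <= M%:E)%E -> (G w <= M%:E)%E -> l u = l w ->
    (int_pow p Omega (fun x => u x - w x)%R <= eps%:E)%E.
Proof.
move=> eps0.
have [B B0 OB] := bounded_set_coord bO.
have [C C0 hC] := X0_poincare N0 s0 p1 mO bO.
have p4 : 0 < 4 `^ p :> R by rewrite powR_gt0.
have p2 : 0 < 2 `^ p :> R by rewrite powR_gt0.
have V0 : 0 < (3 * B) ^+ N by rewrite exprn_gt0 // mulr_gt0.
(* The inequality for three summands costs [4 ^ p]: the two approximation errors use [eps / 4] each,
   the rounding of the constants [eps / 2]. *)
pose delta := eps / (4 * 4 `^ p).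
have delta0 : 0 < delta by rewrite divr_gt0 // mulr_gt0.
pose Q := Num.sqrt N%:R `^ (N%:R + s * p) * (`|M| + (3 * B) ^+ N) + 1.
have Q0 : 0 < Q by rewrite ltr_wpDl // mulr_ge0 ?powR_ge0 // addr_ge0 // ltW.
pose rho := (delta / Q) `^ (s * p)^-1.
have rho0 : 0 < rho by rewrite powR_gt0 // divr_gt0.
pose L := (Num.truncn (3 * B / rho)).+1.
have L0 : (0 < L)%N by [].
pose d := 3 * B / L%:R.
have d0 : 0 < d by rewrite divr_gt0 ?mulr_gt0 ?ltr0n.
have dle : d `^ (s * p) <= delta / Q.
  have -> : delta / Q = rho `^ (s * p).
    have sp0 : s * p != 0 by rewrite gt_eqF // mulr_gt0.
    by rewrite /rho -powRrM mulVf // powRr1 // divr_ge0 // ltW.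
  apply: powR_le; rewrite ?(ltW d0) //; first by rewrite mulr_ge0 // ltW.
  rewrite /d ler_pdivrMr ?ltr0n // -ler_pdivrMl // [leLHS]mulrC; apply: ltW; exact: truncnS_gt.
have small : Num.sqrt N%:R `^ (N%:R + s * p) * d `^ (s * p) * (M + (3 * B) ^+ N) <= delta.
  rewrite mulrAC (_ : delta = Q * (delta / Q)); last by rewrite mulrC divfK // gt_eqF.
  apply: (@le_trans _ _ (Q * d `^ (s * p))); last by rewrite ler_wpM2l // ltW.
  rewrite ler_wpM2r ?powR_ge0 // /Q ler_wpDr // ler_wpM2l ?powR_ge0 //.
  by rewrite lerD2r ler_norm.
pose eta := (eps / (2 * 4 `^ p * (3 * B) ^+ N)) `^ p^-1.
have etaE : eta `^ p = eps / (2 * 4 `^ p * (3 * B) ^+ N).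
  rewrite /eta -powRrM mulVf ?powRr1 ?gt_eqF //.
  by rewrite divr_ge0 ?(ltW eps0) // !mulr_ge0 ?(ltW p4) ?(ltW V0).
have eta0 : 0 < eta.
  by rewrite powR_gt0 // divr_gt0 // !mulr_gt0.
have mc (k : {ffun 'I_N -> 'I_L}) : measurable (cell B k) by exact: measurable_cell.
have lc (k : {ffun 'I_N -> 'I_L}) : mu (cell B k) = (d ^+ N)%:E by exact: (leb_cell B0 L0 k).
have good u : exists a : {ffun 'I_N -> 'I_L} -> R,
    X0 s p Omega u -> (G u <= M%:E)%E ->
    (\sum_k \int[mu]_(x in cell B k) (`|u x - a k| `^ p)%:E <= delta%:E)%E.
  have [[Xu GM]|h] := pselect (X0 s p Omega u /\ (G u <= M%:E)%E); last first.
    by exists (fun=> 0) => Xu GM; exfalso; apply: h.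
  have [a ha] := cell_approx B0 L0 s0 p1 (X0_measurable Xu) GM.
  by exists a => _ _; apply: (le_trans ha); rewrite lee_fin.
have {good} /choice[a ha] := good.
pose W := 2 `^ p * (delta + C * `|M|).
pose A := 1 + W / d ^+ N.
have dN : 0 < d ^+ N by rewrite exprn_gt0.
have W0 : 0 <= W by rewrite mulr_ge0 ?powR_ge0 // addr_ge0 ?mulr_ge0 // ltW.
have A0 : 0 < A by rewrite ltr_pwDl // divr_ge0 // ltW.
have mpw (b : R) (u : T -> R) : measurable_fun setT u ->
    measurable_fun setT (fun x => (`|u x - b| `^ p)%:E).
  move=> mu_; apply/measurable_EFinP; apply: measurable_normr_powR.
  exact: measurable_funB.
(* On a cell, [|a u k| ^ p] is controlled by the approximation error and the [L^p] norm of [u],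
   hence by [M]. The constants thus stay in a bounded interval, which rounding to mesh [eta] makes
   finite. *)
have abound u k : X0 s p Omega u -> (G u <= M%:E)%E -> `|a u k| <= A.
  move=> Xu GM; have mu_ := X0_measurable Xu.
  have h1 : (\int[mu]_(x in cell B k) (`|u x - a u k| `^ p)%:E <= delta%:E)%E.
    apply: le_trans (ha u Xu GM); rewrite (bigD1 k) //=.
    apply: leeDl; apply: sume_ge0 => j _; apply: integral_ge0 => x _.
    by rewrite lee_fin powR_ge0.
  have h2 : (\int[mu]_(x in cell B k) (`|u x| `^ p)%:E <= (C * `|M|)%:E)%E.
    apply: (@le_trans _ _ (int_pow p setT u)).
      apply: ge0_subset_integral => //.
      by apply/measurable_EFinP; exact: measurable_normr_powR.
    rewrite (int_pow_setTE p1 mO Xu); apply: (le_trans (hC u Xu)).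
    rewrite EFinM; apply: lee_wpmul2l; first by rewrite lee_fin ltW.
    by apply: (le_trans GM); rewrite lee_fin ler_norm.
  have [a1|a1] := leP `|a u k| 1; first by rewrite (le_trans a1) // lerDl divr_ge0 // ltW.
  apply: (@le_trans _ _ (`|a u k| `^ p)).
    by rewrite -[leLHS]powRr1 // ler_powR // ltW.
  rewrite /A ler_wpDl // ler_pdivlMr //.
  rewrite -lee_fin EFinM -(lc k) -integral_cst //.
  apply: (@le_trans _ _ (\int[mu]_(x in cell B k)
      ((2 `^ p)%:E * ((`|u x - a u k| `^ p)%:E + (`|u x| `^ p)%:E)))%E).
    apply: ge0_le_integral => //.
    - by move=> x _; rewrite lee_fin powR_ge0.
    - apply: emeasurable_funM => //; apply: emeasurable_funD.
        by apply: measurable_funTS; exact: mpw.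
      apply/measurable_EFinP; apply: measurable_normr_powR; exact: measurable_funTS.
    - move=> x _; rewrite -EFinD -EFinM lee_fin.
      apply: le_trans (powR_add_le (ltW p0) (normr_ge0 _) (normr_ge0 _)).
      apply: powR_le; rewrite ?(ltW p0) //.
      by rewrite -[X in `|X| <= _](subKr (u x)) (le_trans (ler_normB _ _)) // addrC.
  rewrite ge0_integralZl_EFin //; last 2 first.
  - by move=> x _; rewrite adde_ge0 // lee_fin powR_ge0.
  - apply: emeasurable_funD; first by apply: measurable_funTS; exact: mpw.
    apply/measurable_EFinP; apply: measurable_normr_powR; exact: measurable_funTS.
  rewrite /W EFinM; apply: lee_wpmul2l => //.
  rewrite ge0_integralD //; last 2 first.
  - by apply: measurable_funTS; exact: mpw.
  - apply/measurable_EFinP; apply: measurable_normr_powR; exact: measurable_funTS.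
  by rewrite EFinD leeD.
pose m := Num.truncn (2 * A / eta).
pose l u : {ffun {ffun 'I_N -> 'I_L} -> 'I_m.+1} :=
  [ffun k => inord (Num.truncn ((a u k + A) / eta))].
exists _, l => u w Xu Xw GuM GwM luw.
have aeta k : `|a u k - a w k| <= eta.
  have q v : X0 s p Omega v -> (G v <= M%:E)%E ->
      0 <= (a v k + A) / eta /\ (Num.truncn ((a v k + A) / eta) < m.+1)%N.
    move=> Xv GvM; have := abound v k Xv GvM; rewrite ler_norml => /andP[b1 b2].
    split; first by rewrite divr_ge0 ?(ltW eta0) //; lra.
    by rewrite ltnS; apply: le_truncn; rewrite ler_pM2r ?invr_gt0 //; lra.
  have [qu lu] := q u Xu GuM; have [qw lw] := q w Xw GwM.
  have := congr1 (fun f : {ffun _ -> 'I_m.+1} => val (f k)) luw.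
  rewrite /= !ffunE !inordK // => e.
  have := truncn_itv qu; have := truncn_itv qw; rewrite e -natr1.
  have -> : a u k - a w k = ((a u k + A) / eta - (a w k + A) / eta) * eta.
    by field; rewrite gt_eqF.
  rewrite normrM (gtr0_norm eta0) => w12 u12.
  rewrite ler_piMl ?(ltW eta0) // ler_norml.
  have hlp (t y z : R) : t <= y < t + 1 -> t <= z < t + 1 -> -1 <= z - y <= 1.
    by move=> /andP[? ?] /andP[? ?]; apply/andP; split; lra.
  exact: hlp w12 u12.
have mu_ := X0_measurable Xu; have mw := X0_measurable Xw.
pose D x : \bar R := (`|u x - w x| `^ p)%:E.
have mD : measurable_fun setT D.
  by apply/measurable_EFinP; apply: measurable_normr_powR; exact: measurable_funB.
pose UC := \big[setU/set0]_(k : {ffun 'I_N -> 'I_L}) cell B k.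
have mUC : measurable UC by apply: bigsetU_measurable => k _; exact: mc.
apply: (@le_trans _ _ (\int[mu]_(x in UC) D x)%E).
  apply: ge0_subset_integral => //.
  - exact: measurable_funTS.
  move=> x Ox; rewrite /UC -bigcup_seq.
  have [k kx] := cell_cover B0 L0 (fun i => OB x i Ox).
  by exists k => //=; rewrite mem_index_enum.
rewrite ge0_integral_bigsetU //=; last 4 first.
- exact: index_enum_uniq.
- by move=> k k' _ _; exact: (cell_disjoint B0 L0).
- exact: measurable_funTS.
- by move=> x _; rewrite lee_fin powR_ge0.
apply: (@le_trans _ _ (\sum_k (4 `^ p)%:E *
    (\int[mu]_(x in cell B k) (`|u x - a u k| `^ p)%:E +
     \int[mu]_(x in cell B k) (`|w x - a w k| `^ p)%:E +
     (eta `^ p)%:E * (d ^+ N)%:E))%E).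
  apply: lee_sum => k _.
  rewrite -(lc k) -integral_cst // -ge0_integralD //; last 2 first.
  - by apply: measurable_funTS; exact: mpw.
  - by apply: measurable_funTS; exact: mpw.
  rewrite -ge0_integralD //; last 3 first.
  - by move=> x _; rewrite adde_ge0 // lee_fin powR_ge0.
  - by apply: emeasurable_funD; apply: measurable_funTS; exact: mpw.
  - by move=> x _; rewrite lee_fin powR_ge0.
  have mS : measurable_fun (cell B k) (fun x => (`|u x - a u k| `^ p)%:E +
      (`|w x - a w k| `^ p)%:E + cst (eta `^ p)%:E x)%E.
    apply: emeasurable_funD => //.
    by apply: emeasurable_funD; apply: measurable_funTS; exact: mpw.
  rewrite -ge0_integralZl_EFin //; last first.
    by move=> x _; rewrite !adde_ge0 // lee_fin powR_ge0.
  apply: ge0_le_integral => //.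
  - by move=> x _; rewrite lee_fin powR_ge0.
  - exact: measurable_funTS.
  - exact: emeasurable_funM.
  - move=> x _; rewrite -!EFinD -EFinM lee_fin.
    apply: le_trans (powR_add3_le (normr_ge0 _) (normr_ge0 _) (ltW eta0)).
    apply: powR_le; rewrite ?(ltW p0) //.
    rewrite (_ : u x - w x = (u x - a u k) - (w x - a w k) + (a u k - a w k)); last by ring.
    by rewrite (le_trans (ler_normD _ _)) // lerD // ler_normB.
rewrite -ge0_sume_distrr; last first.
  move=> k _; apply: adde_ge0; last by rewrite -EFinM lee_fin mulr_ge0 ?powR_ge0 // ltW.
  by apply: adde_ge0; apply: integral_ge0 => x _; rewrite lee_fin powR_ge0.
rewrite [X in (_ * X)%E]big_split /= [X in (_ * (X + _)%R)%E]big_split /=.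
apply: (@le_trans _ _ ((4 `^ p)%:E * (delta%:E + delta%:E + (eps / (2 * 4 `^ p))%:E))%E).
  apply: lee_wpmul2l => //; apply: leeD; first by apply: leeD; exact: ha.
  under eq_bigr do rewrite -EFinM.
  rewrite sumEFin lee_fin sumr_const card_ffun !card_ord.
  rewrite -[X in X <= _]mulr_natl natrX mulrCA -exprMn etaE.
  have -> : L%:R * d = 3 * B by rewrite /d mulrC divfK // pnatr_eq0.
  apply: le_of_eq; field.
  by rewrite !gt_eqF ?mulr_gt0.
rewrite -!EFinD -EFinM lee_fin; apply: le_of_eq; rewrite /delta; field.
by rewrite gt_eqF.
Qed.

End compactness.

(** * Differentiation of [|t| ^ p] *)

Section abs_power.
Context {R : realType}.
Variable p : R.
Hypothesis p1 : 1 < p.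

Let p0 : 0 < p. Proof. exact: lt_trans p1. Qed.

Lemma cvg_normr_powR0 (al : R) : 0 < al -> `|t| `^ al @[t --> (0 : R)] --> (0 : R).
Proof.
move=> al0; apply/cvgrPdist_lt => e e0.
near=> t; rewrite sub0r normrN ger0_norm ?powR_ge0 //.
have -> : e = (e `^ al^-1) `^ al.
  by rewrite -powRrM mulVf ?gt_eqF // powRr1 // ltW.
rewrite gt0_ltr_powR ?nnegrE ?powR_ge0 //.
near: t; apply: (@cvgr0_norm_lt _ _ _ _ _ idfun) => //.
by rewrite powR_gt0.
Unshelve. all: by end_near. Qed.

Lemma is_derive1_affine (f : R -> R) (a b r df : R) :
  is_derive (a + r * b) (1 : R) f df ->
  is_derive r (1 : R) (fun r : R => f (a + r * b)) (df * b).
Proof.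
move=> h1; have h2 : is_derive r (1 : R) (fun r : R => a + r * b) b.
  apply: is_derive_eq; rewrite add0r scaler0 add0r mul1r; exact: mulr1.
exact: (@is_derive1_comp _ f (fun r => a + r * b) r _ _ h1 h2).
Qed.

Lemma is_derive_normr_powR_gt0 (b : R) : 0 < b ->
  is_derive b (1 : R) (fun t : R => `|t| `^ p) (p * b `^ (p - 1)).
Proof.
move=> b0; have h := is_derive1_powR p b0; apply: near_eq_is_derive h.
by near=> t; rewrite ger0_norm // ltW //; near: t; exact: lt_nbhsr.
Unshelve. all: by end_near. Qed.

(** The derivative is written in the shape that occurs in [plap_form]. At 0 the difference quotient
    has absolute value [|t| ^ (p - 1)], which tends to 0 as [p > 1]; the factor [a] makes the
    formula give 0 there whatever the value of [0 ^ (p - 2)]. *)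
Lemma is_derive_normr_powR (a : R) :
  is_derive a (1 : R) (fun t : R => `|t| `^ p) (p * (`|a| `^ (p - 2) * a)).
Proof.
have powS (b : R) : 0 < b -> b `^ (p - 1) = b `^ (p - 2) * b.
  move=> b0; rewrite -[X in _ = _ * X](powRr1 (ltW b0)) -powRD ?(gt_eqF b0) ?implybT //.
  by congr (_ `^ _); ring.
have [a0|a0|->] := ltgtP a 0; last first.
- rewrite mulr0 mulr0.
  have h : (fun h : R => h^-1 *: (`|h *: (1 : R) + 0| `^ p - `|(0 : R)| `^ p)) @ 0^' --> (0 : R).
    apply/cvgrPdist_lt => e e0.
    have /cvgrPdist_lt /(_ _ e0) : `|t| `^ (p - 1) @[t --> (0 : R)] --> (0 : R).
      by apply: cvg_normr_powR0; rewrite subr_gt0.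
    move=> H; near=> t.
    have t0 : t != 0 by near: t; exact: nbhs_dnbhs_neq.
    rewrite sub0r normrN normr0 powR0 ?gt_eqF // subr0 addr0.
    rewrite -[_ *: 1]/(t * 1) mulr1 -[_ *: _]/(t^-1 * _).
    have -> : `|t^-1 * `|t| `^ p| = `|0 - `|t| `^ (p - 1)|.
      rewrite sub0r normrN normrM normfV !(ger0_norm (powR_ge0 _ _)).
      by rewrite -(mulr_powRB1 (normr_ge0 t) p0) mulrA mulVf ?mul1r // normr_eq0.
    near: t; exact: (@cvg_within _ (nbhs (0 : R))).
  by apply: DeriveDef; [apply/cvg_ex; exists 0|exact/cvg_lim].
- rewrite gtr0_norm // -powS //; exact: is_derive_normr_powR_gt0.
- have a0' : 0 < - a by rewrite oppr_gt0.
  have := is_derive_normr_powR_gt0 a0' => h1.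
  have -> : (fun t : R => `|t| `^ p) = (fun t : R => `|0 + t * -1| `^ p).
    by apply/funext => t; rewrite add0r mulrN1 normrN.
  rewrite ltr0_norm // (_ : _ * _ = p * (- a) `^ (p - 1) * -1); last first.
    by rewrite (powS _ a0'); ring.
  by apply: (@is_derive1_affine (fun t : R => `|t| `^ p)); rewrite add0r mulrN1.
Unshelve. all: by end_near. Qed.

Lemma continuous_normr_powR : continuous (fun t : R => `|t| `^ p).
Proof.
move=> a; apply/differentiable_continuous/derivable1_diffP.
by have [] := is_derive_normr_powR a.
Qed.

Lemma cvg_normr_powR (u : nat -> R) (l : R) : u @ \oo --> l ->
  `|u n| `^ p @[n --> \oo] --> `|l| `^ p.
Proof.
by move=> ul; apply: (@cvg_comp _ _ _ u (fun t : R => `|t| `^ p) \oo (nbhs l)) => //;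
  exact: continuous_normr_powR.
Qed.

(** By the mean value theorem the quotient is at most [p * |d| ^ (p - 1) * |b|] for some
    [|d| <= |a| + |b|]. The bound is independent of [t] and will dominate the difference quotients
    of the seminorm. *)
Lemma normr_powR_quotient_le (a b t : R) : 0 < t <= 1 ->
  `|(`|a + t * b| `^ p - `|a| `^ p) / t| <= p * (2 `^ p * (`|a| `^ p + `|b| `^ p)).
Proof.
move=> /andP[t0 t1].
pose f (r : R) := `|a + r * b| `^ p.
pose df (r : R) := p * (`|a + r * b| `^ (p - 2) * (a + r * b)) * b.
have fdf (r : R) : is_derive r (1 : R) f (df r).
  exact: (is_derive1_affine (is_derive_normr_powR _)).
have cf : {within `[0, t], continuous f}.
  by apply: derivable_within_continuous => r _; have [] := fdf r.
have [c c0t] := @MVT _ f df 0 t t0 (fun x _ => fdf x) cf.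
have -> : f t = `|a + t * b| `^ p by [].
have -> : f 0 = `|a| `^ p by rewrite /f mul0r addr0.
move=> ->; rewrite subr0 mulfK ?gt_eqF //.
have c1 : `|c| <= 1.
  by move: c0t; rewrite in_itv /= => /andP[c0 ct]; rewrite gtr0_norm // (le_trans (ltW ct)).
rewrite /df !normrM (gtr0_norm p0) -!mulrA ler_wpM2l ?(ltW p0) //.
set d := a + c * b.
have dle : `|d| <= `|a| + `|b|.
  by rewrite (le_trans (ler_normD _ _)) // lerD2l normrM ler_piMl.
have bd : `|b| <= `|a| + `|b| by rewrite lerDr.
have ab0 : 0 <= `|a| + `|b| by rewrite addr_ge0.
have -> : `| `|d| `^ (p - 2)| * (`|d| * `|b|) = `|d| `^ (p - 1) * `|b|.
  rewrite (ger0_norm (powR_ge0 _ _)) mulrA; congr (_ * _).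
  have [->|d0] := eqVneq d 0; first by rewrite normr0 mulr0 powR0 // subr_eq0 gt_eqF.
  rewrite -[X in _ * X]powRr1 // -powRD ?normr_eq0 ?(negbTE d0) ?implybT //.
  by congr (_ `^ _); ring.
apply: le_trans (powR_add_le (ltW p0) (normr_ge0 a) (normr_ge0 b)).
rewrite -(mulr_powRB1 ab0 p0) mulrC ler_pM ?powR_ge0 //.
by rewrite powR_le // subr_ge0 ltW.
Qed.

Lemma normr_powR_quotient_cvg (a b : R) :
  (`|a + n.+1%:R^-1 * b| `^ p - `|a| `^ p) / n.+1%:R^-1 @[n --> \oo] -->
  p * (`|a| `^ (p - 2) * a * b).
Proof.
have := @is_derive1_affine (fun t : R => `|t| `^ p) a b 0 _.
rewrite mul0r addr0 => /(_ _ (is_derive_normr_powR a)) [h1 h2].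
case/cvg_ex: (h1) => l hl.
have ll : l = p * (`|a| `^ (p - 2) * a * b).
  by rewrite mulrA -h2; apply/esym; exact: (cvg_lim (@Rhausdorff R) hl).
rewrite -ll.
have n0 : (n.+1%:R^-1 : R) @[n --> \oo] --> (0 : R)^'.
  move=> A hA; have h0 := @cvg_harmonic R _ hA.
  apply: (@filterS _ \oo _ [set n | (@harmonic R n) != 0 -> A (@harmonic R n)]).
    by move=> n; apply; rewrite invr_eq0 pnatr_eq0.
  exact: h0.
apply: cvg_trans (cvg_comp _ _ n0 hl).
apply: near_eq_cvg; near=> n.
rewrite /= -[_ *: 1]/(_ * 1) mulr1 addr0 mul0r addr0 -[_ *: _]/(_ * _).
by rewrite mulrC.
Unshelve. all: by end_near. Qed.

End abs_power.

(** * Almost everywhere limits and lower semicontinuity *)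

Lemma cvg_geometric_steps (R : realType) (a : nat -> R) (C t : R) : 0 <= t < 1 ->
  (forall n, `|a n.+1 - a n| <= C * t ^+ n) -> cvgn a.
Proof.
move=> /andP[t0 t1] ha.
pose b n := a n.+1 - a n.
have C0 : 0 <= C by have := le_trans (normr_ge0 _) (ha 0%N); rewrite expr0 mulr1.
have cb : cvgn (series b).
  apply: normed_cvg; apply: (@series_le_cvg _ _ (geometric C t)) => [n|n|n|].
  - exact: normr_ge0.
  - by rewrite /geometric /= mulr_ge0 // exprn_ge0.
  - exact: ha.
  - by apply/cvg_ex; exists (C * (1 - t)^-1); apply: cvg_geometric_series; rewrite ger0_norm.
have -> : a = series b \+ cst (a 0%N).
  apply/funext => n /=; rewrite /b /series /= telescope_sumr // subrK //.
by apply: is_cvgD => //; exact: is_cvg_cst.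
Qed.

Section fatou.
Local Open Scope ereal_scope.
Context d (T : measurableType d) (R : realType).
Variables (mu : {measure set T -> \bar R}).

(** Fatou's lemma in the form that passes to further subsequences: every level strictly below the
    integral of the limit is eventually exceeded. *)
Lemma fatou_eventually (f_ : (T -> \bar R)^nat) (f : T -> \bar R) (c : R) :
  (forall n, measurable_fun setT (f_ n)) -> (forall n x, 0 <= f_ n x) ->
  measurable_fun setT f -> (forall x, 0 <= f x) ->
  {ae mu, forall x, f_ ^~ x @ \oo --> f x} ->
  c%:E < \int[mu]_x f x -> \forall n \near \oo, c%:E < \int[mu]_x f_ n x.
Proof.
move=> mf_ f_0 mf f0 ff cf.
case: ff => Z [mZ Z0 fZ].
have mD : measurable (setT `\` Z) by exact: measurableD.
have fE : \int[mu]_x f x = \int[mu]_(x in setT `\` Z) limn_einf (f_ ^~ x).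
  rewrite (ge0_negligible_integral mZ) //; apply: eq_integral => x.
  rewrite inE => -[_ nZx]; apply/esym.
  have fx : f_ ^~ x @ \oo --> f x by apply: contrapT => h; apply/nZx/fZ.
  by have [] := cvg_limn_einf_sup fx.
have h : c%:E < limn_einf (fun n => \int[mu]_(x in setT `\` Z) f_ n x).
  have mfD n : measurable_fun (setT `\` Z) (f_ n) by exact: measurable_funTS.
  have := fatou mu mD mfD (fun n x _ => f_0 n x); rewrite -fE; exact: lt_le_trans.
rewrite limn_einf_lim (cvg_lim _ (@cvg_einfs_sup _ _)) // in h.
have [_ [n _ <-] cn] := ereal_sup_gt h.
exists n => // k /= nk; apply: (lt_le_trans cn).
apply: (@le_trans _ _ (\int[mu]_(x in setT `\` Z) f_ k x)).
  by apply: ereal_inf_lbound; exists k.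
exact: ge0_subset_integral.
Qed.

End fatou.

Section subsequence.
Context {R : realType} {N : nat}.
Local Notation T := 'rV[R]_N.
Local Notation mu := (@leb R N).
Variables (s p : R) (Omega : set T).
Hypotheses (N0 : (0 < N)%N) (s0 : 0 < s) (p1 : 1 < p).
Hypotheses (mO : measurable Omega) (bO : bounded_set Omega).
Local Notation G u := (gagliardo s p setT u).

Let p0 : 0 < p. Proof. exact: lt_trans p1. Qed.

(* The integral of (2^k |u_(k+1) - u_k|)^p is then at most 2^-k; summing over k,
   |u_(k+1) - u_k| <= C(x) 2^-k a.e. with C in L^p. *)
Definition fast_cauchy (u_ : nat -> T -> R) := forall k l, (k <= l)%N ->
  (int_pow p Omega (fun x => u_ l x - u_ k x)%R <= ((2^-1 ^+ k) `^ p * 2^-1 ^+ k)%:E)%E.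

Lemma X0_sub u w : X0 s p Omega u -> X0 s p Omega w ->
  X0 s p Omega (fun x => u x - w x).
Proof.
move=> Xu Xw; have := X0_addZ N0 s0 p1 mO bO (- 1) Xu Xw.
by under eq_fun do rewrite mulN1r.
Qed.

Lemma fast_cauchy_ae_cvg (u_ : nat -> T -> R) :
  (forall n, X0 s p Omega (u_ n)) -> fast_cauchy u_ ->
  {ae mu, forall x, cvgn (u_ ^~ x)}.
Proof.
move=> Xu fu.
pose D k x : \bar R := (((2^-1 ^+ k) `^ p)^-1 * `|u_ k.+1 x - u_ k x| `^ p)%:E.
have D0 k x : (0 <= D k x)%E by rewrite lee_fin mulr_ge0 ?invr_ge0 ?powR_ge0.
have mu_ k := X0_measurable (Xu k).
have mD k : measurable_fun setT (D k).
  apply/measurable_EFinP; apply: measurable_funM => //.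
  by apply: measurable_normr_powR; exact: measurable_funB.
have iD : (\int[mu]_x (\sum_(k <oo) D k x) <= (1 / (1 - 2^-1))%:E)%E.
  rewrite integral_nneseries //; apply: nneseries_geo_le.
  - by rewrite invr_ge0 ler0n invf_lt1 // ltr1n.
  - by move=> k; exact: integral_ge0.
  - move=> k; rewrite /D; under eq_integral do rewrite EFinM.
    have e0 : 0 < (2^-1 ^+ k) `^ p :> R by rewrite powR_gt0 // exprn_gt0.
    rewrite ge0_integralZl_EFin ?invr_ge0 ?(ltW e0) //; last first.
      by apply/measurable_EFinP; apply: measurable_normr_powR; exact: measurable_funB.
    rewrite lee_pdivrMl // -EFinM mul1r.
    have := fu k k.+1 (leqnSn k).
    by rewrite -(int_pow_setTE p1 mO (X0_sub (Xu k.+1) (Xu k))).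
have mS : measurable_fun setT (fun x => \sum_(k <oo) D k x)%E.
  by apply: ge0_emeasurable_sum.
have S0 x : (0 <= \sum_(k <oo) D k x)%E by apply: nneseries_ge0.
have /integrable_ae : mu.-integrable setT (fun x => \sum_(k <oo) D k x)%E.
  apply/integrableP; split => //; under eq_integral do rewrite gee0_abs //.
  by apply: le_lt_trans iD _; rewrite ltry.
move=> /(_ measurableT); apply: filterS => x /(_ I) Sx.
pose S := fine (\sum_(k <oo) D k x)%E.
apply: (@cvg_geometric_steps _ _ (S `^ p^-1) 2^-1).
  by rewrite invr_ge0 ler0n invf_lt1 // ltr1n.
move=> k; set e := 2^-1 ^+ k; have e0 : 0 < e by rewrite exprn_gt0.
have : (D k x <= S%:E)%E.
  rewrite fineK //; apply: le_trans (nneseries_lim_ge k.+1 (fun j _ _ => D0 j x)).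
  by rewrite big_nat_recr //=; apply: leeDr; apply: sume_ge0 => j _.
rewrite lee_fin ler_pdivrMl ?powR_gt0 // => h.
have pn0 : p != 0 by rewrite gt_eqF.
have S0' : 0 <= S by apply: fine_ge0.
rewrite -[leLHS](powRK (normr_ge0 _) pn0).
rewrite -[X in _ <= _ * X](powRK (ltW e0) pn0) -powRM ?powR_ge0 // mulrC.
by apply: powR_le; rewrite ?powR_ge0 // invr_ge0 ltW.
Qed.

Lemma fast_limit (u_ : nat -> T -> R) (M : R) :
  (forall n, X0 s p Omega (u_ n)) -> (forall n, (G (u_ n) <= M%:E)%E) ->
  fast_cauchy u_ ->
  exists (u : T -> R) (g : T -> \bar R), [/\ X0 s p Omega u,
    {ae mu, forall x, u_ ^~ x @ \oo --> u x},
    mu.-integrable Omega g,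
    {ae mu, forall x, Omega x -> forall n, ((`|u_ n x| `^ p)%:E <= g x)%E} &
    forall c : R, (c%:E < G u)%E -> \forall n \near \oo, (c%:E < G (u_ n))%E].
Proof.
move=> Xu GM fu.
have [Z [mZ Z0 uZ]] := fast_cauchy_ae_cvg Xu fu.
(* Replacing the sequence by 0 on the exceptional null set makes it converge everywhere, so that the
   limit is a measurable total function. *)
pose v_ n x : R := u_ n x * \1_(~` Z) x.
have cv x : cvgn (v_ ^~ x).
  have [xZ|xZ] := pselect (Z x).
    rewrite (_ : v_ ^~ x = cst 0); first exact: is_cvg_cst.
    by apply/funext => n; rewrite /v_ indicE memNset ?mulr0 //= => /(_ xZ).
  rewrite (_ : v_ ^~ x = u_ ^~ x); first by apply: contrapT => h; apply/xZ/uZ.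
  by apply/funext => n; rewrite /v_ indicE mem_set ?mulr1.
pose u x := limn (v_ ^~ x).
have mu_ n := X0_measurable (Xu n).
have mu0 : measurable_fun setT u.
  apply: (@measurable_fun_cvg _ _ _ _ v_) => [n|x _].
    apply: measurable_funM => //; apply: measurable_indic; exact: measurableC.
  exact: cv.
have uu : {ae mu, forall x, u_ ^~ x @ \oo --> u x}.
  exists Z; split => // x /= nx; apply: contrapT => xZ; apply: nx.
  have : v_ ^~ x @ \oo --> u x by exact: cv.
  rewrite (_ : v_ ^~ x = u_ ^~ x) //.
  by apply/funext => n; rewrite /v_ indicE mem_set ?mulr1.
have mg w : measurable_fun setT w -> measurable_fun setT (fun z => (gag s p w z)%:E).
  by move=> mw; apply/measurable_EFinP; exact: measurable_gag.
have g0 w z : (0 <= (gag s p w z)%:E)%E by rewrite lee_fin gag_ge0.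
have lsc (c : R) : (c%:E < G u)%E -> \forall n \near \oo, (c%:E < G (u_ n))%E.
  apply: (fatou_eventually (f_ := fun n z => (gag s p (u_ n) z)%:E)
    (f := fun z => (gag s p u z)%:E)) => //.
  - by move=> n; exact: mg.
  - exact: mg.
  - apply: filterS2 (ae_prod1 mu uu) (ae_prod2 mu uu) => z z1 z2.
    have hg : gag s p (u_ n) z @[n --> \oo] --> gag s p u z.
      rewrite /gag; apply: cvgM; last exact: cvg_cst.
      by apply: (cvg_normr_powR p1); apply: cvgB.
    by apply: cvg_EFin; [exact: nearW|exact: hg].
have Gu : (G u <= M%:E)%E.
  rewrite leNgt; apply/negP => /lsc [n _ /(_ n (leqnn n))] /=.
  by rewrite ltNge GM.
have u0 : {ae mu, forall x, ~ Omega x -> u x = 0}.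
  have h := ae_foralln (fun n => X0_ae0 (Xu n)).
  apply: filterS2 uu h => x ux h Ox.
  apply: (cvg_unique (@Rhausdorff R) ux).
  rewrite (_ : u_ ^~ x = cst 0); first exact: cvg_cst.
  by apply/funext => n; exact: h.
have Xu0 : X0 s p Omega u.
  by apply: (X0_intro N0 s0 p1 mO bO) => //; apply: le_lt_trans Gu _; rewrite ltry.
(* The [fast_cauchy] estimate survives the limit in its larger index, by Fatou's lemma. *)
have dist k : (int_pow p Omega (fun x => u x - u_ k x)%R <= ((2^-1 ^+ k) `^ p * 2^-1 ^+ k)%:E)%E.
  rewrite leNgt; apply/negP; rewrite -(int_pow_setTE p1 mO (X0_sub Xu0 (Xu k))) => h.
  have [] := @fatou_eventually _ _ _ mu (fun l x => (`|u_ l x - u_ k x| `^ p)%:E)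
    (fun x => (`|u x - u_ k x| `^ p)%:E) _ _ _ _ _ _ h.
  - move=> l; apply/measurable_EFinP; apply: measurable_normr_powR; exact: measurable_funB.
  - by move=> l x; rewrite lee_fin powR_ge0.
  - by apply/measurable_EFinP; apply: measurable_normr_powR; exact: measurable_funB.
  - by move=> x; rewrite lee_fin powR_ge0.
  - apply: filterS uu => x ux.
    apply: cvg_EFin; first exact: nearW.
    have : `|u_ l x - u_ k x| `^ p @[l --> \oo] --> `|u x - u_ k x| `^ p.
      by apply: (cvg_normr_powR p1); apply: cvgB => //; exact: cvg_cst.
    exact.
  move=> l _ /(_ (maxn l k) (leq_maxl _ _)) /=.
  rewrite ltNge; apply/negP/negPn.
  have := fu k (maxn l k) (leq_maxr _ _).
  by rewrite -(int_pow_setTE p1 mO (X0_sub (Xu (maxn l k)) (Xu k))).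
(* A single majorant for all [u_ n]: each [|u - u_ n| ^ p] is one term of the series, which is
   integrable because these distances decay geometrically. *)
pose g x := ((2 `^ p)%:E * ((`|u x| `^ p)%:E + \sum_(k <oo) (`|u x - u_ k x| `^ p)%:E))%E.
have mduk k : measurable_fun setT (fun x => (`|u x - u_ k x| `^ p)%:E).
  by apply/measurable_EFinP; apply: measurable_normr_powR; exact: measurable_funB.
have S0 x : (0 <= \sum_(k <oo) (`|u x - u_ k x| `^ p)%:E)%E.
  by apply: nneseries_ge0 => k _ _; rewrite lee_fin powR_ge0.
have gS0 x : (0 <= (`|u x| `^ p)%:E + \sum_(k <oo) (`|u x - u_ k x| `^ p)%:E)%E.
  by rewrite adde_ge0 // lee_fin powR_ge0.
have mS : measurable_fun setT (fun x => \sum_(k <oo) (`|u x - u_ k x| `^ p)%:E)%E.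
  by apply: ge0_emeasurable_sum => // k x _ _; rewrite lee_fin powR_ge0.
have mup : measurable_fun setT (fun x => (`|u x| `^ p)%:E).
  by apply/measurable_EFinP; exact: measurable_normr_powR.
have mgg : measurable_fun setT g.
  by apply: emeasurable_funM => //; exact: emeasurable_funD.
exists u, g; split => //.
  apply/integrableP; split; first exact: measurable_funTS.
  under eq_integral do rewrite gee0_abs ?mule_ge0 //.
  rewrite ge0_integralZl_EFin ?powR_ge0 //; last by apply: measurable_funTS; exact: emeasurable_funD.
  rewrite lte_mul_pinfty ?lee_fin ?powR_ge0 //.
  rewrite ge0_integralD //; last 2 first.
  - exact: measurable_funTS.
  - exact: measurable_funTS.
  apply: lte_add_pinfty; first exact: (X0_int_pow Xu0).
  rewrite integral_nneseries //; last by move=> k; exact: measurable_funTS.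
  apply: (@le_lt_trans _ _ (1 / (1 - 2^-1))%:E); last by rewrite ltry.
  apply: nneseries_geo_le => [|k|k].
  - by rewrite invr_ge0 ler0n invf_lt1 // ltr1n.
  - by apply: integral_ge0 => x _; rewrite lee_fin powR_ge0.
  - apply: le_trans (dist k) _; rewrite lee_fin ler_wpM2r ?exprn_ge0 ?invr_ge0 //.
    by rewrite powR_le1 ?(ltW p0) ?exprn_ge0 ?invr_ge0 // exprn_ile1 ?invr_ge0 // invf_le1 // ler1n.
apply: aeW => x _ n.
apply: (@le_trans _ _ ((2 `^ p)%:E * ((`|u x| `^ p)%:E + (`|u x - u_ n x| `^ p)%:E))%E).
  rewrite -EFinD -EFinM lee_fin.
  apply: le_trans (powR_add_le (ltW p0) (normr_ge0 _) (normr_ge0 _)).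
  apply: powR_le; rewrite ?(ltW p0) //.
  by rewrite -[X in `|X| <= _](subKr (u x)) (le_trans (ler_normB _ _)).
apply: lee_wpmul2l; first by rewrite lee_fin powR_ge0.
apply: leeD => //.
have h k (_ : (0 <= k)%N) (_ : true) : (0 <= (`|u x - u_ k x| `^ p)%:E)%E.
  by rewrite lee_fin powR_ge0.
apply: le_trans (nneseries_lim_ge n.+1 h).
by rewrite big_nat_recr //=; apply: leeDr; apply: sume_ge0 => j _; rewrite lee_fin powR_ge0.
Qed.

(** The label at stage [k] comes from total boundedness at the accuracy that [fast_cauchy] demands
    at [k]. A subsequence whose later members keep the label of stage [k] is therefore fast, and
    such a subsequence comes from [diagonal_selection]. *)
Lemma fast_subsequence (u_ : nat -> T -> R) (M : R) :
  (forall n, X0 s p Omega (u_ n)) -> (forall n, (G (u_ n) <= M%:E)%E) ->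
  exists (I : nat -> finType) (l : forall k, nat -> I k),
    forall phi : nat -> nat, (forall j k, (j <= k)%N -> l j (phi k) = l j (phi j)) ->
    fast_cauchy (fun k => u_ (phi k)).
Proof.
move=> Xu GM.
have h k : {I : finType & {l : (T -> R) -> I | forall u w, X0 s p Omega u ->
    X0 s p Omega w -> (G u <= M%:E)%E -> (G w <= M%:E)%E -> l u = l w ->
    (int_pow p Omega (fun x => u x - w x)%R <= ((2^-1 ^+ k) `^ p * 2^-1 ^+ k)%:E)%E}}.
  have e0 : 0 < (2^-1 ^+ k) `^ p * 2^-1 ^+ k :> R.
    by rewrite mulr_gt0 ?powR_gt0 // exprn_gt0.
  have /cid[I /cid[l hl]] := totally_bounded N0 s0 p1 mO bO M e0.
  by exists I, l.
exists (fun k => projT1 (h k)), (fun k n => sval (projT2 (h k)) (u_ n)).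
move=> phi hphi k l kl; case: (projT2 (h k)) (hphi k l kl) => lab hl e.
exact: (hl _ _ (Xu _) (Xu _) (GM _) (GM _) e).
Qed.

End subsequence.

(** * The spectral gap *)

Lemma fin_num_gain (R : realType) (a b c d e : \bar R) (x y : R) :
  a \is a fin_num -> b \is a fin_num -> c \is a fin_num ->
  d \is a fin_num -> e \is a fin_num -> (b <= a)%E ->
  (a + x%:E * (d * e) <= b + y%:E * c)%E -> x * (fine d * fine e) <= y * fine c.
Proof.
move=> fa fb fc fd fe.
rewrite -(fineK fa) -(fineK fb) -(fineK fc) -(fineK fd) -(fineK fe).
rewrite -!EFinM -!EFinD !lee_fin /=.
by move: (x * _) (y * _) => *; lra.
Qed.

Section rayleigh.
Context {R : realType} {N : nat}.
Local Notation T := 'rV[R]_N.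
Local Notation mu := (@leb R N).
Variables (s p : R) (Omega : set T).
Hypotheses (N0 : (0 < N)%N) (s01 : 0 < s < 1) (p1 : 1 < p).
Hypotheses (oO : open Omega) (bO : bounded_set Omega).
Local Notation G u := (gagliardo s p setT u).

Let s0 : 0 < s. Proof. by case/andP: s01. Qed.
Let p0 : 0 < p. Proof. exact: lt_trans p1. Qed.
Let mO : measurable Omega. Proof. exact: measurable_open. Qed.

Lemma lambda1_le u : X0 s p Omega u -> ~ {ae mu, forall x, u x = 0} ->
  (lambda1 s p Omega <= (fine (G u) / fine (int_pow p Omega u))%:E)%E.
Proof.
move=> Xu u0; apply: ereal_inf_lbound; exists u => //.
have powV (a : \bar R) : (0 <= a)%E -> (fine a `^ p^-1) `^ p = fine a.
  by move=> a0; rewrite -powRrM mulVf ?gt_eqF // powRr1 // fine_ge0.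
rewrite /X0_norm /Lp_norm !powV //.
- by rewrite (gagliardo_Qset s p1 mO (X0_measurable Xu) (X0_ae0 Xu)).
- by apply: integral_ge0 => x _; rewrite lee_fin powR_ge0.
- exact: gagliardo_ge0.
Qed.

Lemma int_pow_fin_num u : X0 s p Omega u -> int_pow p Omega u \is a fin_num.
Proof.
move=> Xu; rewrite ge0_fin_numE ?(X0_int_pow Xu) //.
by apply: integral_ge0 => x _; rewrite lee_fin powR_ge0.
Qed.

Lemma int_pow_eq0 u : X0 s p Omega u -> int_pow p Omega u = 0%E ->
  {ae mu, forall x, u x = 0}.
Proof.
move=> Xu h0.
have mu_ : measurable_fun setT (fun x => (`|u x| `^ p)%:E).
  by apply/measurable_EFinP; apply: measurable_normr_powR; exact: X0_measurable Xu.
have : (\int[mu]_x `| (`|u x| `^ p)%:E | = 0)%E.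
  rewrite -[RHS]h0 -(int_pow_setTE p1 mO Xu); apply: eq_integral => x _.
  by rewrite gee0_abs // lee_fin powR_ge0.
move/(ae_eq_integral_abs mu measurableT mu_); apply: filterS => x /(_ I) [].
by move/powR_eq0_eq0/normr0_eq0.
Qed.

(** Stated with a real [c] because [lambda1] is an infimum in the extended reals. Functions
    vanishing almost everywhere are not competitors in it and are treated apart. *)
Lemma lambda1_poincare u (c : R) : X0 s p Omega u -> (c%:E <= lambda1 s p Omega)%E ->
  (c%:E * int_pow p Omega u <= G u)%E.
Proof.
move=> Xu cl.
have Ifin := int_pow_fin_num Xu; have Gfin := X0_fin_num p1 mO Xu.
have I0 : (0 <= int_pow p Omega u)%E.
  by apply: integral_ge0 => x _; rewrite lee_fin powR_ge0.
have [u0|u0] := pselect {ae mu, forall x, u x = 0}.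
  rewrite (_ : int_pow p Omega u = 0%E) ?mule0 ?gagliardo_ge0 //.
  rewrite -(@integral0 _ _ _ mu Omega); apply: ge0_ae_eq_integral => //.
  - apply/measurable_EFinP; apply: measurable_normr_powR; apply: measurable_funTS.
    exact: X0_measurable Xu.
  - by apply: filterS u0 => x -> _; rewrite normr0 powR0 // gt_eqF.
have := le_trans cl (lambda1_le Xu u0); rewrite lee_fin.
rewrite -{2}(fineK Ifin) -(fineK Gfin) -EFinM lee_fin -ler_pdivlMr //.
rewrite fine_gt0 // -ge0_fin_numE // Ifin andbT lt_neqAle I0 andbT.
by apply/eqP => h; apply: u0; apply: int_pow_eq0.
Qed.

Lemma bounded_leb_lty (A : set T) : measurable A -> bounded_set A -> (mu A < +oo)%E.
Proof.
move=> mA /bounded_set_coord[B B0 AB].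
have mc := measurable_cube (0 : T) (B + 1).
have B10 : 0 <= B + 1 by rewrite addr_ge0 // ltW.
have : (mu A <= mu (cube 0 (B + 1)))%E.
  apply: le_measure; rewrite ?inE // => x Ax i; rewrite mxE subr0.
  by rewrite (le_lt_trans (AB x i Ax)) // ltrDl.
by move/le_lt_trans; apply; rewrite [ltLHS](leb_cube 0 B10) ltry.
Qed.

Lemma leb_gt0_ae (A B : set T) : measurable A -> measurable B ->
  {ae mu, forall x, A x -> B x} -> (0 < mu A)%E -> (0 < mu B)%E.
Proof.
move=> mA mB [Z [mZ Z0 ABZ]] A0; apply: (lt_le_trans A0).
apply: (@le_trans _ _ (mu (B `|` Z))).
  apply: le_measure; rewrite ?inE //; first exact: measurableU.
  move=> x Ax; have [Bx|Bx] := pselect (B x); [by left|right].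
  by apply: ABZ => /= /(_ Ax).
have := measureU2 mu mB mZ; rewrite [X in (_ <= _ + X)%E]Z0 adde0; exact: le_trans.
Qed.

Lemma leb_gt0_bigcup (A : set T) (F : nat -> set T) : measurable A ->
  (forall n, measurable (F n)) -> {ae mu, forall x, A x -> exists n, F n x} ->
  (0 < mu A)%E -> exists n, (0 < mu (F n))%E.
Proof.
move=> mA mF h A0; apply: contrapT => nF.
have F0 n : mu (F n) = 0%E.
  apply/eqP; rewrite eq_le measure_ge0 andbT leNgt; apply/negP => Fn.
  by apply: nF; exists n.
have : mu (\bigcup_n F n) = 0%E.
  apply/negligibleP; first exact: bigcupT_measurable.
  apply: negligible_bigcup => n; apply/negligibleP; [exact: mF|exact: F0].
apply/eqP; rewrite gt_eqF //; apply: leb_gt0_ae A0 => //.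
  exact: bigcupT_measurable.
by apply: filterS h => x h Ax; have [n Fx] := h Ax; exists n.
Qed.

(* Compare w with max(w, t phi), phi being a bump that equals 1 on a part of A of
   positive measure. This adds at most t^p G(phi) to the seminorm, while the pairs
   (x, y) with x in A, phi x = 1 and w y > c0 save at least a constant times t. As
   p > 1, the seminorm decreases strictly for small t, but the L^p norm does not. *)
Lemma vanishing_not_minimizer w (A : set T) (L : R) :
  X0 s p Omega w -> (forall x, 0 <= w x) -> ~ {ae mu, forall x, w x = 0} ->
  measurable A -> A `<=` Omega -> (0 < mu A)%E ->
  {ae mu, forall x, A x -> w x = 0} ->
  (forall v, X0 s p Omega v -> (L%:E * int_pow p Omega v <= G v)%E) -> 0 <= L ->
  (L%:E * int_pow p Omega w = G w)%E -> False.
Proof.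
move=> Xw w0 wn0 mA AO A0 wA hL L0 Lw.
have mw := X0_measurable Xw.
have mpre (D : set R) : measurable D -> measurable (w @^-1` D).
  by move=> mD; rewrite -[X in measurable X]setTI; exact: mw.
have [B B0 OB] := bounded_set_coord bO.
pose A1 := A `&` w @^-1` [set 0].
have mA1 : measurable A1 by apply: measurableI => //; exact: mpre.
have A10 : (0 < mu A1)%E.
  apply: leb_gt0_ae A0 => //; apply: filterS wA => x wx Ax; split => //.
  exact: wx.
(* Countably many cubes with doubles in [Omega] cover [A1]; one of them meets it in positive
   measure. *)
have [c [r [r0 cO cA]]] : exists c r, [/\ 0 < r, cube c (2 * r) `<=` Omega &
    (0 < mu (A1 `&` cube c r))%E].
  pose F n : set T := if unpickle n is Some k then
    (if `[< rat_cube k 2 `<=` Omega >] then A1 `&` rat_cube k 1 else set0) else set0.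
  have mF n : measurable (F n).
    rewrite /F; case: unpickle => // k; case: ifPn => // _.
    by apply: measurableI => //; exact: measurable_cube.
  have aF : {ae mu, forall x, A1 x -> exists n, F n x}.
    apply: aeW => x A1x; have [k [kx kO]] := open_rat_cube oO (AO _ (A1x.1)).
    by exists (pickle k); rewrite /F pickleK; case: asboolP.
  have [n] := leb_gt0_bigcup mA1 mF aF A10.
  rewrite /F; case: unpickle => [k|]; last by rewrite measure0 ltxx.
  case: asboolP => [kO|_]; last by rewrite measure0 ltxx.
  move=> h; exists (\row_i ratr (k.1 ord0 i)), (k.2.+1%:R^-1); split => //.
  by rewrite -[k.2.+1%:R^-1]mul1r.
have [phi [Xphi phi01 phi1]] := X0_bump N0 s01 p1 mO bO r0 cO.
pose E := A1 `&` cube c r.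
have mE : measurable E by apply: measurableI => //; exact: measurable_cube.
(* [w] is nonnegative and not zero almost everywhere, so one of the countably many sets
   [w > 1 / (n + 1)] has positive measure. *)
have [c0 c00 cY] : exists2 c0 : R, 0 < c0 & (0 < mu (Omega `&` w @^-1` `]c0, +oo[))%E.
  pose F n := Omega `&` w @^-1` `]n.+1%:R^-1, +oo[%classic.
  have mF n : measurable (F n) by apply: measurableI => //; exact: mpre.
  pose W : set T := w @^-1` `]0, +oo[%classic.
  have mW : measurable W by exact: mpre.
  have aF : {ae mu, forall x, W x -> exists n, F n x}.
    apply: filterS (X0_ae0 Xw) => x wx; rewrite /W /= in_itv /= andbT => wx0.
    have Ox : Omega x by apply: contrapT => /wx h; rewrite h ltxx in wx0.
    have [n _ /(_ n (leqnn n)) h] := near_infty_natSinv_lt (PosNum wx0).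
    by exists n; split => //=; rewrite in_itv /= andbT.
  have W0 : (0 < mu W)%E.
    rewrite lt_neqAle measure_ge0 andbT; apply/negP => /eqP/esym W0; apply: wn0.
    exists W; split => // x /= wx; rewrite /W /= in_itv /= andbT.
    by rewrite lt_neqAle w0 andbT eq_sym; apply/eqP.
  have [n Fn] := leb_gt0_bigcup mW mF aF W0.
  by exists n.+1%:R^-1.
pose Y := Omega `&` w @^-1` `]c0, +oo[%classic.
have mY : measurable Y by apply: measurableI => //; exact: mpre.
(* A lower bound of the kernel on [Omega] times [Omega], where coordinates differ by at most
   [2 * B]. *)
pose kap := ((Num.sqrt N%:R * (2 * B)) `^ (N%:R + s * p))^-1.
have kap0 : 0 < kap.
  by rewrite invr_gt0 powR_gt0 // !mulr_gt0 // sqrtr_gt0 ltr0n.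
pose wt t x := Num.max (w x) (t * phi x).
have Xwt t : 0 < t -> X0 s p Omega (wt t).
  by move=> t0; apply: (X0_max N0 s0 p1 mO bO) => //; exact: ltW.
have mEY : measurable (E `*` Y) by exact: measurableX.
(* The maximum is no steeper than the steeper of its two arguments, whence the bound without the
   indicator. On [E] times [Y], the value at [x] rises from 0 to [t] and the one at [y] stays at
   [w y > c0 > t], so the integrand drops from [w y ^ p] to [(w y - t) ^ p] times the kernel. *)
have ptw t z : 0 < t < c0 ->
    gag s p (wt t) z + (t * c0 `^ (p - 1) * kap) * \1_(E `*` Y) z <=
    gag s p w z + t `^ p * gag s p phi z.
  move=> /andP[t0 tc]; case: z => x y; rewrite /gag /=.
  set K := enorm (x - y) `^ _.
  have K0 : 0 <= K^-1 by rewrite invr_ge0 powR_ge0.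
  have base : `|wt t x - wt t y| `^ p <= `|w x - w y| `^ p + t `^ p * `|phi x - phi y| `^ p.
    rewrite -powRM ?(ltW t0) // -[t in t * `|_|](gtr0_norm t0) -normrM mulrBr.
    set a := `|w x - w y|; set b := `|t * phi x - t * phi y|.
    have [ab|ab] := leP a b.
      rewrite ler_wpDl ?powR_ge0 //; apply: powR_le; rewrite ?(ltW p0) //.
      exact: max_dist_le.
    rewrite ler_wpDr ?powR_ge0 //; apply: powR_le; rewrite ?(ltW p0) //.
    by apply: max_dist_le => //; exact: ltW.
  rewrite indicE; case: (boolP (_ \in _)) => [|_]; last first.
    by rewrite mulr0 addr0 mulrA -mulrDl ler_wpM2r.
  rewrite inE mulr1 => -[[[Ax /= wx0] cx] [Oy]] /=; rewrite in_itv /= andbT => wy.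
  have phix : phi x = 1 by exact: phi1.
  have /andP[py0 py1] := phi01 y.
  have tw : t < w y by exact: lt_trans wy.
  have wtx : wt t x = t by rewrite /wt wx0 phix mulr1 max_r // ltW.
  have wty : wt t y = w y.
    by rewrite /wt max_l // (le_trans _ (ltW tw)) // ler_piMr // ltW.
  have wyn0 : 0 < w y by exact: lt_trans tw.
  rewrite wtx wty wx0 sub0r normrN (gtr0_norm wyn0) distrC gtr0_norm ?subr_gt0 //.
  have h1 : (w y - t) `^ p <= w y `^ p - t * c0 `^ (p - 1).
    have wt0 : 0 <= w y - t by rewrite subr_ge0 ltW.
    rewrite -(mulr_powRB1 wt0 p0) -(mulr_powRB1 (ltW wyn0) p0).
    apply: (@le_trans _ _ ((w y - t) * w y `^ (p - 1))).
      rewrite ler_wpM2l //; apply: powR_le => //; first by rewrite subr_ge0 ltW.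
      by rewrite gerBl ltW.
    rewrite mulrBl lerD2l lerN2 ler_wpM2l ?(ltW t0) //.
    by apply: powR_le; rewrite ?subr_ge0 ?(ltW p1) ?(ltW c00) // ltW.
  have h2 : kap <= K^-1.
    have xy : 0 < enorm (x - y).
      apply: enorm_gt0; rewrite subr_eq0; apply/eqP => xy.
      by move: wyn0; rewrite -xy wx0 ltxx.
    have a0 : 0 <= N%:R + s * p by rewrite addr_ge0 // mulr_ge0 // ltW.
    rewrite /kap /K lef_pV2 ?posrE ?powR_gt0 //; last first.
      by rewrite !mulr_gt0 // sqrtr_gt0 ltr0n.
    apply: powR_le => //; first exact: ltW.
    apply: enorm_le => [|i]; first by rewrite mulr_ge0 // ltW.
    rewrite !mxE; have := OB x i (AO _ Ax); have := OB y i Oy.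
    by rewrite !ler_norml; move: (x ord0 i) (y ord0 i) => ? ?; lra.
  have h3 : 0 <= t * c0 `^ (p - 1) by rewrite mulr_ge0 ?powR_ge0 // ltW.
  apply: (@le_trans _ _ (w y `^ p * K^-1)); last first.
    by rewrite lerDl mulr_ge0 ?powR_ge0 // mulr_ge0 ?powR_ge0.
  apply: (@le_trans _ _ ((w y `^ p - t * c0 `^ (p - 1)) * K^-1 + t * c0 `^ (p - 1) * K^-1)).
    by apply: lerD; [rewrite ler_wpM2r|rewrite ler_wpM2l].
  by rewrite -mulrDl subrK.
have Gphi := X0_fin_num p1 mO Xphi.
have Gw := X0_fin_num p1 mO Xw.
pose kk := c0 `^ (p - 1) * kap * (fine (mu E) * fine (mu Y)).
have Efin : mu E \is a fin_num.
  rewrite ge0_fin_numE //; apply: le_lt_trans (bounded_leb_lty mO bO).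
  by apply: le_measure; rewrite ?inE // => x [[Ax _] _]; exact: AO.
have Yfin : mu Y \is a fin_num.
  rewrite ge0_fin_numE //; apply: le_lt_trans (bounded_leb_lty mO bO).
  by apply: le_measure; rewrite ?inE // => x [].
have kk0 : 0 < kk.
  rewrite /kk !mulr_gt0 ?powR_gt0 //.
    by rewrite fine_gt0 // cA -ge0_fin_numE.
  by rewrite fine_gt0 // cY -ge0_fin_numE.
(* [wt t] is at least [w], so its [L^p] norm is no smaller; as [L] is attained at [w], its seminorm
   is no smaller either. The saving of order [t] is then at most [t ^ p * G phi], and one factor [t]
   cancels. *)
have ineq t : 0 < t < c0 -> kk <= t `^ (p - 1) * fine (G phi).
  move=> tc; have /andP[t0 _] := tc.
  have : (G (wt t) + (t * c0 `^ (p - 1) * kap)%:E * (mu E * mu Y) <= G w + (t `^ p)%:E * G phi)%E.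
    have mg (v : T -> R) : measurable_fun setT v -> measurable_fun setT (fun z => (gag s p v z)%:E).
      by move=> mv; apply/measurable_EFinP; exact: measurable_gag.
    have mwt := mg _ (X0_measurable (Xwt t t0)).
    have mphi := mg _ (X0_measurable Xphi).
    have ct0 : 0 <= t * c0 `^ (p - 1) * kap by rewrite !mulr_ge0 ?powR_ge0 // ltW.
    have mI : measurable_fun setT (fun z : T * T => (\1_(E `*` Y) z : R)%:E).
      by apply/measurable_EFinP; exact: measurable_indic.
    rewrite -(product_measure1E mu mu mE mY).
    have -> : ((mu \x mu) (E `*` Y) = \int[mu \x mu]_z (\1_(E `*` Y) z)%:E)%E.
      by rewrite integral_indic // setIT.
    rewrite -ge0_integralZl_EFin // -ge0_integralZl_EFin ?powR_ge0 //; last first.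
      by move=> z _; rewrite lee_fin (gag_ge0 s p phi z).
    have gg0 v z : (0 <= (gag s p v z)%:E)%E by rewrite lee_fin gag_ge0.
    have GE v : G v = (\int[mu \x mu]_z (gag s p v z)%:E)%E by exact: erefl.
    have i0 z : (0 <= (t * c0 `^ (p - 1) * kap)%:E * (\1_(E `*` Y) z : R)%:E)%E.
      by rewrite mule_ge0 // lee_fin.
    have tphi0 z : (0 <= (t `^ p)%:E * (gag s p phi z)%:E)%E.
      by rewrite mule_ge0 // lee_fin powR_ge0.
    have mw0 := mg _ mw.
    have mi : measurable_fun setT (fun z : T * T =>
        (t * c0 `^ (p - 1) * kap)%:E * (\1_(E `*` Y) z : R)%:E)%E.
      exact: emeasurable_funM.
    have mtphi : measurable_fun setT (fun z => (t `^ p)%:E * (gag s p phi z)%:E)%E.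
      exact: emeasurable_funM.
    rewrite !GE -ge0_integralD // -ge0_integralD //; last by move=> z _; exact: tphi0.
    apply: ge0_le_integral => //.
    - by move=> z _; exact: adde_ge0.
    - exact: emeasurable_funD.
    - exact: emeasurable_funD.
    - by move=> z _; rewrite -!EFinM -!EFinD lee_fin; exact: ptw.
  have Gwt := X0_fin_num p1 mO (Xwt t t0).
  have GG : (G w <= G (wt t))%E.
    rewrite -Lw; apply: le_trans (hL _ (Xwt t t0)); apply: lee_wpmul2l => //.
    apply: ge0_le_integral => //.
    - by apply/measurable_EFinP; apply: measurable_funTS; exact: measurable_normr_powR.
    - apply/measurable_EFinP; apply: measurable_funTS; apply: measurable_normr_powR.
      exact: X0_measurable (Xwt t t0).
    - move=> x _; rewrite lee_fin; apply: powR_le; rewrite ?(ltW p0) //.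
      rewrite !ger0_norm //; first by rewrite le_max lexx.
      by rewrite le_max w0.
  move=> /(fin_num_gain Gwt Gw Gphi Efin Yfin GG).
  by rewrite -(mulr_powRB1 (ltW t0) p0) /kk -!mulrA ler_pM2l.
have Gphi0 : 0 <= fine (G phi) by rewrite fine_ge0 // gagliardo_ge0.
(* This gives [t ^ (p - 1) * G phi <= (kk / 2) * G phi / (G phi + 1) < kk], while [c0 / 2] keeps [t]
   below [c0]. *)
pose t := Num.min (c0 / 2) ((kk / (2 * (fine (G phi) + 1))) `^ (p - 1)^-1).
have q0 : 0 < p - 1 by rewrite subr_gt0.
have G10 : 0 < 2 * (fine (G phi) + 1) by rewrite mulr_gt0 // ltr_wpDl.
have t0 : 0 < t by rewrite lt_min divr_gt0 //= powR_gt0 // divr_gt0.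
have tc : t < c0 by rewrite gt_min; apply/orP; left; lra.
have := ineq t; rewrite t0 tc => /(_ isT); apply/negP; rewrite -ltNge.
apply: (@le_lt_trans _ _ (kk / (2 * (fine (G phi) + 1)) * fine (G phi))).
  rewrite ler_wpM2r //; apply: (@le_trans _ _ (((kk / (2 * (fine (G phi) + 1))) `^ (p - 1)^-1) `^ (p - 1))).
    by apply: powR_le; rewrite ?(ltW q0) ?(ltW t0) // ge_min lexx orbT.
  by rewrite -powRrM mulVf ?gt_eqF // powRr1 // divr_ge0 // ltW.
rewrite mulrAC ltr_pdivrMr // ltr_pM2l //; lra.
Qed.

End rayleigh.

Lemma ae_le_integral d (S : measurableType d) (R : realType)
    (m : {measure set S -> \bar R}) (D : set S) (f g : S -> \bar R) :
  measurable D -> m.-integrable D f -> m.-integrable D g ->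
  {ae m, forall x, D x -> (f x <= g x)%E} ->
  (\int[m]_(x in D) f x <= \int[m]_(x in D) g x)%E.
Proof.
move=> mD mf mg [Z [mZ Z0 fgZ]].
rewrite (negligible_integral mZ mD mf Z0) (negligible_integral mZ mD mg Z0).
have mDZ : measurable (D `\` Z) by exact: measurableD.
apply: le_integral => //.
- by apply: (integrableS mD) => //; exact: subDsetl.
- by apply: (integrableS mD) => //; exact: subDsetl.
- move=> x; rewrite inE => -[Dx Zx]; apply: contrapT => fg.
  by apply: Zx; apply: fgZ => /(_ Dx).
Qed.

Section spectral_gap.
Context {R : realType} {N : nat}.
Local Notation T := 'rV[R]_N.
Local Notation mu := (@leb R N).
Variables (s p : R) (Omega : set T).
Hypotheses (N0 : (0 < N)%N) (s01 : 0 < s < 1) (p1 : 1 < p).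
Hypotheses (oO : open Omega) (bO : bounded_set Omega).
Local Notation G u := (gagliardo s p setT u).

Let s0 : 0 < s. Proof. by case/andP: s01. Qed.
Let p0 : 0 < p. Proof. exact: lt_trans p1. Qed.
Let mO : measurable Omega. Proof. exact: measurable_open. Qed.

Lemma X0_compact (u_ : nat -> T -> R) (M : R) :
  (forall n, X0 s p Omega (u_ n)) -> (forall n, (G (u_ n) <= M%:E)%E) ->
  exists (phi : nat -> nat) (u : T -> R) (g : T -> \bar R),
  (forall k, (k <= phi k)%N) /\ [/\ X0 s p Omega u,
    {ae mu, forall x, u_ (phi n) x @[n --> \oo] --> u x},
    mu.-integrable Omega g,
    {ae mu, forall x, Omega x -> forall n, ((`|u_ (phi n) x| `^ p)%:E <= g x)%E} &
    forall c : R, (c%:E < G u)%E -> \forall n \near \oo, (c%:E < G (u_ (phi n)))%E].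
Proof.
move=> Xu GM.
have [I [l hl]] := fast_subsequence N0 s0 p1 mO bO Xu GM.
have [phi [kphi lphi]] := diagonal_selection l.
have [u [g h]] := @fast_limit _ _ s p Omega N0 s0 p1 mO bO (fun n => u_ (phi n)) M
  (fun n => Xu _) (fun n => GM _) (hl phi lphi).
by exists phi, u, g.
Qed.

Lemma gagliardo_scale (u : T -> R) (c : R) : measurable_fun setT u -> 0 <= c ->
  (G (fun x : T => c * u x)%R = (c `^ p)%:E * G u)%E.
Proof.
move=> mu_ c0; have mg : measurable_fun setT (fun z => (gag s p u z)%:E).
  by apply/measurable_EFinP; exact: measurable_gag.
transitivity (\int[mu \x mu]_z ((c `^ p)%:E * (gag s p u z)%:E))%E.
  apply: eq_integral => z _; rewrite -EFinM /gag -mulrBr normrM powRM // ger0_norm //.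
  by rewrite mulrA.
rewrite ge0_integralZl_EFin ?powR_ge0 //.
by move=> z _; rewrite lee_fin gag_ge0.
Qed.

Lemma X0_scale u (c : R) : 0 <= c -> X0 s p Omega u -> X0 s p Omega (fun x => c * u x).
Proof.
move=> c0 Xu; apply: (X0_dom N0 s0 p1 mO bO Xu Xu (a := c) (b := 0)) => //.
- by apply: measurable_funM => //; exact: X0_measurable Xu.
- by move=> x ->; rewrite mulr0.
- by move=> x y; rewrite -mulrBr normrM mul0r addr0 (ger0_norm c0).
Qed.

Lemma integrable_X0_powR u : X0 s p Omega u ->
  mu.-integrable Omega (fun x => (`|u x| `^ p)%:E).
Proof.
move=> Xu; apply/integrableP; split.
  apply/measurable_EFinP; apply: measurable_normr_powR; apply: measurable_funTS.
  exact: X0_measurable Xu.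
under eq_integral do rewrite gee0_abs ?lee_fin ?powR_ge0 //.
exact: X0_int_pow Xu.
Qed.

Lemma integrable_weight_powR u h : Linfty Omega h -> X0 s p Omega u ->
  mu.-integrable Omega (fun x => (h x * `|u x| `^ p)%:E).
Proof.
move=> [mh [M hM]] Xu.
have mp : measurable_fun Omega (fun x => `|u x| `^ p).
  by apply: measurable_normr_powR; apply: measurable_funTS; exact: X0_measurable Xu.
have mhp : measurable_fun Omega (fun x => (h x * `|u x| `^ p)%:E).
  by apply/measurable_EFinP; exact: measurable_funM.
apply/integrableP; split => //.
have := integrableZl mO `|M| (integrable_X0_powR Xu).
move=> /integrableP[m1]; apply: le_lt_trans.
apply: ae_ge0_le_integral => //.
- exact: measurableT_comp.
- exact: measurableT_comp.
- apply: filterS hM => x hx Ox; rewrite -EFinM !abse_EFin lee_fin !normrM.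
  by rewrite (normr_id M) ler_wpM2r // (le_trans (hx Ox)) // ler_norm.
Qed.

Lemma lambda1_ge0 : (0 <= lambda1 s p Omega)%E.
Proof.
apply: le_ereal_inf_tmp => _ [u _ <-]; rewrite lee_fin divr_ge0 // powR_ge0 //.
Qed.

Lemma ae0_integral_weight u h : X0 s p Omega u -> Linfty Omega h ->
  {ae mu, forall x, u x = 0} -> (\int[mu]_(x in Omega) (h x * `|u x| `^ p)%:E = 0)%E.
Proof.
move=> Xu Lh u0; rewrite -(@integral0 _ _ _ mu Omega); apply: ae_eq_integral => //.
  by have /integrableP[] := integrable_weight_powR Lh Xu.
by apply: filterS u0 => x -> _; rewrite normr0 powR0 ?mulr0 // gt_eqF.
Qed.

(** The chain from 1 to the weighted integral, to [L] times the integral of [v ^ p], to [G v], and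
    back to 1 forces equalities. So [v] attains the infimum, and [(L - h) * v ^ p] vanishes almost
    everywhere, whence [v = 0] on [A]. The infimum is finite since [v] is itself a competitor. *)
Lemma no_rayleigh_equality (h v : T -> R) (A : set T) : Linfty Omega h ->
  {ae mu, forall x, Omega x -> ((h x)%:E <= lambda1 s p Omega)%E} ->
  measurable A -> A `<=` Omega -> (0 < mu A)%E ->
  (forall x, A x -> ((h x)%:E < lambda1 s p Omega)%E) ->
  X0 s p Omega v -> (forall x, 0 <= v x) -> (G v <= 1%:E)%E ->
  (1%:E <= \int[mu]_(x in Omega) (h x * `|v x| `^ p)%:E)%E -> False.
Proof.
move=> Lh hl mA AO A0 hA Xv v0 Gv hw1.
have vn0 : ~ {ae mu, forall x, v x = 0}.
  by move=> va; move: hw1; rewrite (ae0_integral_weight Xv Lh va) lee_fin ler10.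
have [L L0 LE] : exists2 L : R, 0 <= L & lambda1 s p Omega = L%:E.
  have := lambda1_ge0; have := lambda1_le p1 oO Xv vn0.
  by case: (lambda1 _ _ _) => [L|//|//] _ L0; exists L.
have hL u : X0 s p Omega u -> (L%:E * int_pow p Omega u <= G u)%E.
  by move=> Xu; apply: (lambda1_poincare p1 oO Xu); rewrite LE.
have {}hl : {ae mu, forall x, Omega x -> h x <= L}.
  by apply: filterS hl => x; rewrite LE lee_fin.
have {}hA x : A x -> h x < L by move=> /hA; rewrite LE lte_fin.
have If := int_pow_fin_num Xv.
have iLv := integrableZl mO L (integrable_X0_powR Xv).
have ihv := integrable_weight_powR Lh Xv.
have hvL : {ae mu, forall x, Omega x ->
    ((h x * `|v x| `^ p)%:E <= L%:E * (`|v x| `^ p)%:E)%E}.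
  apply: filterS hl => x hx Ox; rewrite -EFinM lee_fin.
  by apply: ler_wpM2r; [exact: powR_ge0|exact: hx].
have IL : (\int[mu]_(x in Omega) (L%:E * (`|v x| `^ p)%:E) = L%:E * int_pow p Omega v)%E.
  exact: (integralZl mO (integrable_X0_powR Xv)).
have hLv := ae_le_integral mO ihv iLv hvL; rewrite IL in hLv.
have LG : (L%:E * int_pow p Omega v = G v)%E.
  apply: le_anti; rewrite (hL v Xv) /=.
  exact: (le_trans Gv (le_trans hw1 hLv)).
have hE : (\int[mu]_(x in Omega) (h x * `|v x| `^ p)%:E = L%:E * int_pow p Omega v)%E.
  by apply: le_anti; rewrite hLv /= LG; exact: (le_trans Gv hw1).
clear hw1 Gv hLv.
suff vA : {ae mu, forall x, A x -> v x = 0}.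
  exact: (vanishing_not_minimizer N0 s01 p1 oO bO Xv v0 vn0 mA AO A0 vA hL L0 LG).
clear LG hL.
have iD := integrableB mO iLv ihv.
have : (\int[mu]_(x in Omega) `|L%:E * (`|v x| `^ p)%:E - (h x * `|v x| `^ p)%:E| = 0)%E.
  transitivity (\int[mu]_(x in Omega) (L%:E * (`|v x| `^ p)%:E - (h x * `|v x| `^ p)%:E))%E.
    apply: ae_eq_integral; [exact: mO| |exact: measurable_int iD|].
      by apply: measurableT_comp; [|exact: measurable_int iD].
    by apply: filterS hvL => x hx Ox; rewrite gee0_abs // sube_ge0 // hx.
  rewrite (integralB mO iLv ihv) hE IL; apply: subee; exact: fin_numM.
move/(ae_eq_integral_abs mu mO (measurable_int _ iD)); apply: filterS => x h0 Ax.
have := h0 (AO _ Ax); rewrite -EFinM -EFinB => -[/eqP].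
rewrite -mulrBl mulf_eq0 => /orP[|/eqP/powR_eq0_eq0/normr0_eq0 //].
by have := hA x Ax; rewrite -subr_gt0 => /gt_eqF ->.
Qed.

(** If no [d] works, there are functions of seminorm at most 1 whose weighted integrals tend to at
    least 1. In the limit the seminorm stays at most 1 by lower semicontinuity and the weighted
    integral at least 1 by dominated convergence; the absolute value of the limit is then excluded
    by [no_rayleigh_equality]. *)
Lemma spectral_gap (h : T -> R) (A : set T) : Linfty Omega h ->
  {ae mu, forall x, Omega x -> ((h x)%:E <= lambda1 s p Omega)%E} ->
  measurable A -> A `<=` Omega -> (0 < mu A)%E ->
  (forall x, A x -> ((h x)%:E < lambda1 s p Omega)%E) ->
  exists2 d : R, 0 < d & forall u, X0 s p Omega u ->
    (\int[mu]_(x in Omega) (h x * `|u x| `^ p)%:E <= (1 - d)%:E * G u)%E.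
Proof.
move=> Lh hl mA AO A0 hA; apply: contrapT => nd.
have Lh' := Lh; case: Lh' => mh [M hM].
have norm n : exists w, [/\ X0 s p Omega w, (G w <= 1%:E)%E &
    ((1 - n.+1%:R^-1)%:E <= \int[mu]_(x in Omega) (h x * `|w x| `^ p)%:E)%E].
  have [u Xu hu] : exists2 u, X0 s p Omega u &
      ((1 - n.+1%:R^-1)%:E * G u < \int[mu]_(x in Omega) (h x * `|u x| `^ p)%:E)%E.
    apply: contrapT => hh; apply: nd; exists n.+1%:R^-1; first by rewrite invr_gt0.
    by move=> u Xu; rewrite leNgt; apply/negP => h1; apply: hh; exists u.
  have Gf := X0_fin_num p1 mO Xu; have If := int_pow_fin_num Xu.
  have hf := integrable_fin_num mO (integrable_weight_powR Lh Xu).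
  (* Seminorm 0 would mean [u = 0] almost everywhere by Poincaré, and the strict inequality would
     read [0 < 0]. *)
  have G0 : 0 < fine (G u).
    rewrite lt_neqAle fine_ge0 ?gagliardo_ge0 // andbT; apply/eqP => /esym Gu0.
    have GE : G u = 0%E by rewrite -(fineK Gf) Gu0.
    have [C C0 /(_ u Xu)] := X0_poincare N0 s0 p1 mO bO.
    rewrite GE mule0 => I0.
    have Iu0 : int_pow p Omega u = 0%E.
      apply/eqP; rewrite eq_le I0 /=; apply: integral_ge0 => x _.
      by rewrite lee_fin powR_ge0.
    move: hu; rewrite GE mule0 (ae0_integral_weight Xu Lh) ?ltxx //.
    exact: (int_pow_eq0 p1 oO Xu).
  pose c := (fine (G u))^-1 `^ p^-1.
  have c0 : 0 <= c by exact: powR_ge0.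
  have cp : c `^ p = (fine (G u))^-1.
    by rewrite /c -powRrM mulVf ?gt_eqF // powRr1 // invr_ge0 ltW.
  exists (fun x => c * u x); split.
  - exact: X0_scale.
  - rewrite (gagliardo_scale (X0_measurable Xu) c0) cp -{2}(fineK Gf) -EFinM.
    by rewrite mulVf // gt_eqF.
  - rewrite (_ : (\int[mu]_(x in Omega) _ =
        \int[mu]_(x in Omega) ((c `^ p)%:E * (h x * `|u x| `^ p)%:E))%E); last first.
      apply: eq_integral => x _; rewrite -EFinM normrM powRM // ger0_norm //.
      by congr EFin; ring.
    rewrite integralZl //; last exact: integrable_weight_powR.
    rewrite cp -(fineK hf) -EFinM lee_fin mulrC ler_pdivlMr //.
    by move: hu; rewrite -(fineK Gf) -(fineK hf) -EFinM lte_fin => /ltW.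
have /choice[w_ wP] := norm.
have Xw n : X0 s p Omega (w_ n) by case: (wP n).
have Gw1 n : (G (w_ n) <= 1%:E)%E by case: (wP n).
have [phi [w [g [kphi [X_w cw ig gw lsc]]]]] := X0_compact Xw Gw1.
have Gw : (G w <= 1%:E)%E.
  rewrite leNgt; apply/negP => /lsc [n _ /(_ n (leqnn n))] /=.
  by rewrite ltNge Gw1.
have hww := integrable_weight_powR Lh X_w.
have cvI : (\int[mu]_(x in Omega) (h x * `|w_ (phi n) x| `^ p)%:E @[n --> \oo] -->
    \int[mu]_(x in Omega) (h x * `|w x| `^ p)%:E)%E.
  have [] := @dominated_convergence _ _ _ mu Omega mO
    (fun n x => (h x * `|w_ (phi n) x| `^ p)%:E) (fun x => (h x * `|w x| `^ p)%:E)
    (fun x => `|M|%:E * g x)%E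
    (fun n => measurable_int _ (integrable_weight_powR Lh (Xw (phi n))))
    (measurable_int _ hww) _ (integrableZl mO `|M| ig) _ => //.
  - apply: filterS cw => x cx Ox; apply: cvg_EFin; first by near=> n.
    by apply: cvgMr; exact: cvg_normr_powR.
  - apply: filterS2 gw hM => x gx hx n Ox.
    rewrite abse_EFin normrM (ger0_norm (powR_ge0 _ _)) EFinM.
    apply: lee_pmul => //; rewrite ?lee_fin ?powR_ge0 //.
      by rewrite (le_trans (hx Ox)) // ler_norm.
    exact: gx.
have hw1 : (1%:E <= \int[mu]_(x in Omega) (h x * `|w x| `^ p)%:E)%E.
  have hl1 : ((1 - n.+1%:R^-1 : R)%:E @[n --> \oo] --> 1%:E)%E.
    apply: cvg_EFin; first by near=> n.
    rewrite -[X in _ --> X]subr0; apply: cvgB; first exact: cvg_cst.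
    exact: cvg_harmonic.
  apply: (lee_cvg_to hl1 cvI); near=> n.
  case: (wP (phi n)) => _ _; apply: le_trans; rewrite lee_fin lerD2l lerN2.
  by rewrite lef_pV2 ?posrE // ler_nat ltnS.
pose v x := `|w x|.
have Xv : X0 s p Omega v by exact: (X0_norm_fun N0 s0 p1 mO bO).
have Gv : (G v <= 1%:E)%E.
  by apply: le_trans Gw; apply: gagliardo_norm_fun => //; exact: X0_measurable X_w.
have vE : (\int[mu]_(x in Omega) (h x * `|w x| `^ p)%:E =
    \int[mu]_(x in Omega) (h x * `|v x| `^ p)%:E)%E.
  by apply: eq_integral => x _; rewrite /v normr_id.
rewrite vE in hw1.
exact: (no_rayleigh_equality Lh hl mA AO A0 hA Xv (fun x => normr_ge0 _) Gv hw1).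
Unshelve. all: by end_near. Qed.

End spectral_gap.

(** * The nonlinearity *)

Section derivative_ge0.
Context {R : realType}.
Implicit Types (g : R -> R) (a l : R).

(** Clearing the denominator makes the estimate hold at [t = a] as well, where the punctured limit
    says nothing. *)
Lemma is_derive_ge0P g a l : is_derive_ge0 g a l -> forall e, 0 < e ->
  exists2 d, 0 < d & forall t, 0 <= t -> `|t - a| < d ->
    `|g t - g a - l * (t - a)| <= e * `|t - a|.
Proof.
move=> /cvgr_dist_le h e e0; have /nbhs_ballP[d /= d0 hd] := h e e0.
exists d => // t t0 ta.
have [->|tna] := eqVneq t a; first by rewrite !subrr mulr0 subr0 normr0 mulr0.
have tan0 : t - a != 0 by rewrite subr_eq0.
have := hd t _ tna t0; rewrite /ball /= distrC => /(_ ta) h1.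
rewrite (_ : g t - g a - _ = ((g t - g a) / (t - a) - l) * (t - a)).
  by rewrite normrM ler_wpM2r // distrC.
by rewrite mulrBl divfK.
Qed.

Lemma is_derive_ge0_lipschitz g a l : is_derive_ge0 g a l ->
  exists2 d, 0 < d & forall t, 0 <= t -> `|t - a| < d ->
    `|g t - g a| <= (`|l| + 1) * `|t - a|.
Proof.
move=> /is_derive_ge0P/(_ 1 ltr01)[d d0 hd]; exists d => // t t0 ta.
have := hd t t0 ta; rewrite mul1r => h.
rewrite -[g t - g a](subrK (l * (t - a))) (le_trans (ler_normD _ _)) //.
by rewrite normrM mulrDl mul1r addrC lerD2l.
Qed.

Lemma is_derive_ge0_cvg g a l (a_ : nat -> R) : is_derive_ge0 g a l ->
  (forall n, 0 <= a_ n) -> a_ @ \oo --> a -> g (a_ n) @[n --> \oo] --> g a.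
Proof.
move=> /is_derive_ge0_lipschitz[d d0 hd] a0 aa; apply/cvgrPdist_le => e e0.
have l0 : 0 < `|l| + 1 by rewrite ltr_wpDl.
near=> n; rewrite distrC (le_trans (hd _ (a0 n) _)) //.
  near: n; have /cvgr_dist_lt/(_ d d0) := aa; apply: filterS => n.
  by rewrite distrC.
rewrite mulrC -ler_pdivlMr //.
near: n; have /cvgr_dist_le/(_ (e / (`|l| + 1))) := aa.
rewrite divr_gt0 // => /(_ isT); apply: filterS => n.
by rewrite distrC.
Unshelve. all: by end_near. Qed.

(** A chain rule along sequences. Dividing by [t_ n] rather than by [a_ n - a] allows increments
    that vanish. It will be applied to [a_ n = |u + w / (n + 1)|], which depends on the step in a
    non-differentiable way where [u = 0]. *)
Lemma is_derive_ge0_quotient_cvg g a l (a_ t_ : nat -> R) m C :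
  is_derive_ge0 g a l -> (forall n, 0 <= a_ n) -> (forall n, 0 < t_ n) ->
  t_ @ \oo --> 0 -> (forall n, `|a_ n - a| <= C * t_ n) ->
  (a_ n - a) / t_ n @[n --> \oo] --> m ->
  (g (a_ n) - g a) / t_ n @[n --> \oo] --> l * m.
Proof.
move=> dg a0 t0 ct aC cm.
have C0 : 0 <= C.
  by rewrite -(pmulr_lge0 _ (t0 0%N)) (le_trans _ (aC 0%N)).
have ca : a_ @ \oo --> a.
  apply/cvgrPdist_le => e e0; near=> n; rewrite distrC (le_trans (aC n)) //.
  have : t_ n <= e / (C + 1).
    near: n; have /cvgr_dist_le/(_ (e / (C + 1))) := ct.
    rewrite divr_gt0 // ?ltr_wpDl // => /(_ isT); apply: filterS => n.
    by rewrite sub0r normrN => /(le_trans (ler_norm _)).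
  rewrite ler_pdivlMr ?ltr_wpDl // => h; apply: le_trans h.
  by rewrite mulrC ler_wpM2l ?lerDl // ltW.
have h1 : (g (a_ n) - g a) / t_ n - l * ((a_ n - a) / t_ n) @[n --> \oo] --> (0 : R).
  apply/cvgrPdist_le => e e0.
  have [|d d0 hd] := is_derive_ge0P dg (e := e / (C + 1)).
    by rewrite divr_gt0 // ltr_wpDl.
  near=> n; rewrite sub0r normrN mulrA -mulrBl normrM normfV (gtr0_norm (t0 n)).
  rewrite ler_pdivrMr // (le_trans (hd _ (a0 n) _)) //.
    near: n; have /cvgr_dist_lt/(_ d d0) := ca; apply: filterS => n.
    by rewrite distrC.
  rewrite mulrAC ler_pdivrMr ?ltr_wpDl // -mulrA ler_wpM2l ?(ltW e0) //.
  by rewrite (le_trans (aC n)) // mulrC ler_wpM2l ?lerDl // ltW.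
have h2 : l * ((a_ n - a) / t_ n) @[n --> \oo] --> l * m by apply: cvgMr.
rewrite (_ : (fun n => (g (a_ n) - g a) / t_ n) =
    (fun n => (g (a_ n) - g a) / t_ n - l * ((a_ n - a) / t_ n)) +
    (fun n => l * ((a_ n - a) / t_ n))).
  by rewrite -[X in _ --> X]add0r; exact: cvgD.
by apply/funext => n; rewrite !fctE subrK.
Unshelve. all: by end_near. Qed.

Lemma is_derive_ge0_is_derive g a l : 0 < a -> is_derive_ge0 g a l -> is_derive a 1 g l.
Proof.
move=> a0 /is_derive_ge0P h.
have L : h^-1 *: (g (h *: 1 + a) - g a) @[h --> 0^'] --> l.
  apply/cvgrPdist_le => e e0; have [d d0 hd] := h e e0.
  near=> t.
  have tn0 : t != 0 by near: t; exact: nbhs_dnbhs_neq.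
  have td : `|t| < Num.min d a.
    near: t; apply: dnbhs0_lt; by rewrite lt_min d0.
  move: td; rewrite lt_min => /andP[td ta].
  have t0 : 0 <= t + a by move: ta; rewrite ltr_norml => /andP[? ?]; lra.
  have := hd (t + a) t0; rewrite addrK => /(_ td) h1.
  rewrite /GRing.scale /= mulr1 distrC.
  rewrite (_ : _ - l = t^-1 * (g (t + a) - g a - l * t)).
    by rewrite normrM normfV mulrC ler_pdivrMr ?normr_gt0.
  by rewrite [in RHS]mulrBr [t^-1 * (l * t)]mulrCA mulVf // mulr1.
by apply: DeriveDef; [exact: cvgP L|exact: cvg_lim L].
Unshelve. all: by end_near. Qed.

(** Interior points are positive, so the derivative is two-sided there; at the end points, one of
    which may be 0, continuity is enough. *)
Lemma MVT_ge0 g (dg : R -> R) a b : (forall t, 0 <= t -> is_derive_ge0 g t (dg t)) ->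
  0 <= a -> a <= b -> exists2 c, a <= c <= b & g b - g a = dg c * (b - a).
Proof.
move=> hg a0 ab; have [| |c cab ->] := MVT_segment ab (f := g) (df := dg).
- move=> x; rewrite in_itv /= => /andP[ax _].
  by apply: is_derive_ge0_is_derive; [exact: le_lt_trans ax|apply: hg; rewrite (le_trans a0) // ltW].
- apply/subspace_continuousP => x; rewrite /= in_itv /= => /andP[ax xb].
  have x0 : 0 <= x by exact: le_trans ax.
  have [d d0 hd] := is_derive_ge0_lipschitz (hg x x0).
  have l0 : 0 < `|dg x| + 1 by rewrite ltr_wpDl.
  apply/cvgrPdist_le => e e0.
  have e1 : 0 < Num.min d (e / (`|dg x| + 1)) by rewrite lt_min d0 divr_gt0.
  apply/nbhs_ballP; exists (Num.min d (e / (`|dg x| + 1))) => //= t.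
  rewrite /ball /= distrC lt_min => /andP[td te]; rewrite /= in_itv /= => /andP[at_ _].
  rewrite distrC (le_trans (hd _ _ td)) // ?(le_trans a0) //.
  by rewrite mulrC -ler_pdivlMr // ltW.
- by exists c => //; move: cab; rewrite in_itv.
Qed.

End derivative_ge0.

(** * Measurability of superpositions *)

Section composition.
Context d (S : measurableType d) {R : realType}.
Variables (D : set S) (mD : measurable D).

Lemma measurable_countable_comp (k : S -> nat) (g : nat -> S -> R) :
  (forall j, measurable (D `&` k @^-1` [set j])) ->
  (forall j, measurable_fun D (g j)) -> measurable_fun D (fun x => g (k x) x).
Proof.
move=> mk mg _ B mB.
rewrite (_ : _ `&` _ = \bigcup_j ((D `&` k @^-1` [set j]) `&` (D `&` g j @^-1` B))).
  apply: bigcupT_measurable => j; apply: measurableI; [exact: mk|exact: mg].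
apply/seteqP; split => [x [Dx Bx]|x [j _ [[Dx <-] [_ Bx]]]] //.
by exists (k x).
Qed.

(** [u] is approximated from below by multiples of [1 / (n + 1)]. The approximations take countably
    many values, so the composite is glued from the functions [H ^~ a], and continuity in the second
    argument passes to the limit. *)
Lemma measurable_separately_continuous_comp (H : S -> R -> R) (u : S -> R) :
  (forall a, 0 <= a -> measurable_fun D (H ^~ a)) ->
  (forall x, D x -> forall (a : R) (a_ : nat -> R), (forall n, 0 <= a_ n) -> 0 <= a ->
    a_ @ \oo --> a -> H x (a_ n) @[n --> \oo] --> H x a) ->
  measurable_fun D u -> (forall x, D x -> 0 <= u x) -> measurable_fun D (fun x => H x (u x)).
Proof.
move=> mH cH mu_ u0.
pose k n x := Num.truncn (u x * n.+1%:R).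
apply: (@measurable_fun_cvg _ _ _ D (fun n x => H x ((k n x)%:R / n.+1%:R))).
- move=> n; apply: (measurable_countable_comp (k := k n) (g := fun j x => H x (j%:R / n.+1%:R))).
  + move=> j.
    rewrite (_ : _ `&` _ = D `&` u @^-1` `[j%:R / n.+1%:R, j.+1%:R / n.+1%:R[%classic).
      by apply: mu_ => //; exact: measurable_itv.
    apply/seteqP; split => [x [Dx]|x [Dx]] /=.
      move=> kx; split => //; rewrite in_itv /= ler_pdivrMr // ltr_pdivlMr // -kx.
      by apply: truncn_itv; rewrite mulr_ge0 // u0.
    rewrite in_itv /= ler_pdivrMr // ltr_pdivlMr // => h; split => //.
    exact: truncn_def.
  + by move=> j; apply: mH; rewrite divr_ge0.
- move=> x Dx; apply: cH => //; first exact: u0.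
  apply/cvgrPdist_le => e e0; near=> n.
  have /andP[h1 h2] : (k n x)%:R <= u x * n.+1%:R < (k n x).+1%:R.
    by apply: truncn_itv; rewrite mulr_ge0 // u0.
  have n0 : 0 < n.+1%:R :> R by [].
  have h3 : n.+1%:R^-1 <= e by apply: ltW; near: n; exact: (near_infty_natSinv_lt (PosNum e0)).
  rewrite ger0_norm; last by rewrite subr_ge0 ler_pdivrMr.
  apply: le_trans h3; rewrite -(ler_pM2r n0) mulrBl divfK ?gt_eqF // mulVf ?gt_eqF //.
  by rewrite lerBlDl natr1 ltW.
Unshelve. all: by end_near. Qed.

End composition.

Section xuv.
Context {R : realType} {N : nat}.
Local Notation T := 'rV[R]_N.
Variable Omega : set T.

Lemma xuv_cvg (K : T * R * R -> R) x (a b : R) (a_ b_ : nat -> R) :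
  {within xuv_domain Omega, continuous K} -> Omega x ->
  (forall n, 0 <= a_ n) -> (forall n, 0 <= b_ n) -> 0 <= a -> 0 <= b ->
  a_ @ \oo --> a -> b_ @ \oo --> b -> K (x, a_ n, b_ n) @[n --> \oo] --> K (x, a, b).
Proof.
move=> /subspace_continuousP cK Ox a_0 b_0 a0 b0 ca cb.
apply: (@cvg_comp _ _ _ (fun n => (x, a_ n, b_ n)) K _ _ _ _ (cK (x, a, b) _)) => //.
move=> P; rewrite /within /= => hP.
have c : (x, a_ n, b_ n) @[n --> \oo] --> (x, a, b).
  exact: (cvg_pair (cvg_pair (cvg_cst x) ca) cb).
have h : \forall n \near \oo, xuv_domain Omega (x, a_ n, b_ n) -> P (x, a_ n, b_ n).
  exact: (c _ hP).
by apply: filterS h => n; apply; split => /=.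
Qed.

Lemma xuv_measurable (K : T * R * R -> R) (a b : R) : open Omega ->
  {within xuv_domain Omega, continuous K} -> 0 <= a -> 0 <= b ->
  measurable_fun Omega (fun x => K (x, a, b)).
Proof.
move=> oO /subspace_continuousP cK a0 b0; apply: measurable_fun_within => //.
apply/subspace_continuousP => x Ox.
apply: (@cvg_comp _ _ _ (fun y => (y, a, b)) K _ _ _ _ (cK (x, a, b) _)) => //.
move=> P; rewrite /within /= => hP.
have c : (y, a, b) @[y --> x] --> (x, a, b).
  have ca : (fun _ : T => a) @ nbhs x --> a by exact: cvg_cst.
  have cb : (fun _ : T => b) @ nbhs x --> b by exact: cvg_cst.
  have cx : id @ nbhs x --> x by exact: cvg_id.
  exact: (cvg_pair (cvg_pair cx ca) cb).
have h : \forall y \near nbhs x, xuv_domain Omega (y, a, b) -> P (y, a, b).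
  exact: (c _ hP).
suff : \forall y \near nbhs x, Omega y -> P (y, a, b) by [].
by apply: filterS h => y h Oy; apply: h; split.
Qed.

End xuv.

Section potential.
Context {R : realType} {N : nat}.
Local Notation T := 'rV[R]_N.
Local Notation mu := (@leb R N).
Variables (Omega : set T) (f1 f2 F : T -> R -> R -> R) (q C3 : R).
Hypothesis oO : open Omega.
Hypothesis f1_ge0 : forall x u v, Omega x -> 0 <= u -> 0 <= v -> 0 <= f1 x u v.
Hypothesis f2_ge0 : forall x u v, Omega x -> 0 <= u -> 0 <= v -> 0 <= f2 x u v.
Hypothesis cF : {within xuv_domain Omega, continuous (fun z => F z.1.1 z.1.2 z.2)}.
Hypothesis F_u : forall x u v, Omega x -> 0 <= u -> 0 <= v ->
  is_derive_ge0 (fun t => F x t v) u (f1 x u v).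
Hypothesis F_v : forall x u v, Omega x -> 0 <= u -> 0 <= v ->
  is_derive_ge0 (fun t => F x u t) v (f2 x u v).
Hypothesis q1 : 1 < q.
Hypothesis C30 : 0 < C3.
Hypothesis f_growth : forall x u v, Omega x -> 0 <= u -> 0 <= v ->
  `|f1 x u v| + `|f2 x u v| <= C3 * (`|u| `^ (q - 1) + `|v| `^ (q - 1) + 1).

Let mO : measurable Omega. Proof. exact: measurable_open. Qed.

(** The variables are substituted one after the other; continuity in each of them comes from the
    one-sided derivative. *)
Lemma measurable_potential (u v : T -> R) :
  measurable_fun Omega u -> measurable_fun Omega v ->
  (forall x, 0 <= u x) -> (forall x, 0 <= v x) ->
  measurable_fun Omega (fun x => F x (u x) (v x)).
Proof.
move=> mu_ mv u0 v0.
apply: (measurable_separately_continuous_comp mO (H := fun x b => F x (u x) b)) => //.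
- move=> b b0.
  apply: (measurable_separately_continuous_comp mO (H := fun x a => F x a b)) => //.
    by move=> a a0; exact: (xuv_measurable oO cF a0 b0).
  by move=> x Ox a a_ a_0 a0; apply: (is_derive_ge0_cvg (g := fun t => F x t b)) => //; exact: F_u.
- by move=> x Ox b b_ b_0 b0; apply: (is_derive_ge0_cvg (g := F x (u x))) => //; exact: F_v.
Qed.

Lemma quotient_cvg (g : R -> R) a l : 0 <= a -> is_derive_ge0 g a l ->
  (g (a + n.+1%:R^-1) - g a) / n.+1%:R^-1 @[n --> \oo] --> l.
Proof.
move=> a0 dg; rewrite -[X in _ --> X]mulr1.
apply: (is_derive_ge0_quotient_cvg dg (C := 1)) => //.
- by move=> n; rewrite addr_ge0.
- exact: cvg_harmonic.
- by move=> n; rewrite mul1r addrAC subrr add0r ger0_norm.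
- rewrite (_ : (fun n => _) = cst 1); first exact: cvg_cst.
  by apply/funext => n /=; rewrite addrAC subrr add0r divff.
Qed.

(** [f1] is the limit of forward difference quotients of [F]; a forward step keeps the argument
    nonnegative. *)
Lemma measurable_potential_u (u v : T -> R) :
  measurable_fun Omega u -> measurable_fun Omega v ->
  (forall x, 0 <= u x) -> (forall x, 0 <= v x) ->
  measurable_fun Omega (fun x => f1 x (u x) (v x)).
Proof.
move=> mu_ mv u0 v0.
apply: (@measurable_fun_cvg _ _ _ _ (fun n x =>
  (F x (u x + n.+1%:R^-1) (v x) - F x (u x) (v x)) / n.+1%:R^-1)).
- move=> n; apply: measurable_funM => //; apply: measurable_funB.
    apply: (measurable_potential (u := fun x => u x + n.+1%:R^-1)) => //.
      exact: measurable_funD.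
    by move=> x; rewrite addr_ge0.
  exact: measurable_potential.
- by move=> x Ox; apply: (quotient_cvg (g := fun t => F x t (v x))) => //; exact: F_u.
Qed.

Lemma measurable_potential_v (u v : T -> R) :
  measurable_fun Omega u -> measurable_fun Omega v ->
  (forall x, 0 <= u x) -> (forall x, 0 <= v x) ->
  measurable_fun Omega (fun x => f2 x (u x) (v x)).
Proof.
move=> mu_ mv u0 v0.
apply: (@measurable_fun_cvg _ _ _ _ (fun n x =>
  (F x (u x) (v x + n.+1%:R^-1) - F x (u x) (v x)) / n.+1%:R^-1)).
- move=> n; apply: measurable_funM => //; apply: measurable_funB.
    apply: (measurable_potential (v := fun x => v x + n.+1%:R^-1)) => //.
      exact: measurable_funD.
    by move=> x; rewrite addr_ge0.
  exact: measurable_potential.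
- by move=> x Ox; apply: (quotient_cvg (g := fun t => F x (u x) t)) => //; exact: F_v.
Qed.

Lemma f1_le x u v : Omega x -> 0 <= u -> 0 <= v ->
  f1 x u v <= C3 * (u `^ (q - 1) + v `^ (q - 1) + 1).
Proof.
move=> Ox u0 v0; have := f_growth Ox u0 v0.
rewrite (ger0_norm u0) (ger0_norm v0); apply: le_trans.
by rewrite (le_trans (ler_norm _)) // lerDl.
Qed.

Lemma f2_le x u v : Omega x -> 0 <= u -> 0 <= v ->
  f2 x u v <= C3 * (v `^ (q - 1) + u `^ (q - 1) + 1).
Proof.
move=> Ox u0 v0; have := f_growth Ox u0 v0.
rewrite (ger0_norm u0) (ger0_norm v0) (addrC (v `^ _)); apply: le_trans.
by rewrite (le_trans (ler_norm _)) // lerDr.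
Qed.

Lemma potential_mono x u v u' v' : Omega x -> 0 <= u -> 0 <= v -> u <= u' -> v <= v' ->
  F x u v <= F x u' v'.
Proof.
move=> Ox u0 v0 uu vv; have u0' := le_trans u0 uu.
apply: (@le_trans _ _ (F x u' v)).
  have [|c /andP[uc _] h] := MVT_ge0 (g := fun t => F x t v) (dg := fun t => f1 x t v) _ u0 uu.
    by move=> t t0; exact: F_u.
  rewrite -subr_ge0 h mulr_ge0 ?subr_ge0 //.
  by apply: f1_ge0 => //; exact: le_trans uc.
have [|c /andP[vc _] h] := MVT_ge0 (g := fun t => F x u' t) (dg := fun t => f2 x u' t) _ v0 vv.
  by move=> t t0; exact: F_v.
rewrite -subr_ge0 h mulr_ge0 ?subr_ge0 //.
by apply: f2_ge0 => //; exact: le_trans vc.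
Qed.

(** The growth of [f1] and [f2] is integrated along the path from [(0, 0)] through [(0, M)] to
    [(M, M)]; the factor 2 counts the two legs. *)
Lemma potential_box x M : Omega x -> 0 <= M ->
  F x M M <= F x 0 0 + 2 * (C3 * (M `^ (q - 1) + M `^ (q - 1) + 1) * M).
Proof.
move=> Ox M0.
have q0 : 0 <= q - 1 by rewrite subr_ge0 ltW.
have [|c /andP[c0 cM] h1] := MVT_ge0 (g := fun t => F x t M) (dg := fun t => f1 x t M) _ (lexx 0) M0.
  by move=> t t0; exact: F_u.
have [|d /andP[d0 dM] h2] := MVT_ge0 (g := fun t => F x 0 t) (dg := fun t => f2 x 0 t) _ (lexx 0) M0.
  by move=> t t0; exact: F_v.
have b1 : f1 x c M * M <= C3 * (M `^ (q - 1) + M `^ (q - 1) + 1) * M.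
  rewrite ler_wpM2r // (le_trans (f1_le Ox c0 M0)) // ler_wpM2l ?(ltW C30) //.
  by rewrite lerD2r lerD2r powR_le.
have b2 : f2 x 0 d * M <= C3 * (M `^ (q - 1) + M `^ (q - 1) + 1) * M.
  rewrite ler_wpM2r // (le_trans (f2_le Ox (lexx 0) d0)) // ler_wpM2l ?(ltW C30) //.
  by rewrite lerD2r lerD // powR_le.
move: h1 h2; rewrite !subr0.
by move: (_ * M) (f1 x c M * M) (f2 x 0 d * M) b1 b2 => *; lra.
Qed.

(** For [S > M] the condition at infinity applies directly. For [S <= M] both variables are at most
    [M], because [M >= 1], and monotonicity reduces to the corner of the box. *)
Lemma potential_upper p1 p2 h : 1 < p1 -> 1 < p2 -> Linfty Omega h ->
  limsup_le_unif p1 p2 Omega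
    (fun x u v => Num.max p1 p2 * F x u v / (`|u| `^ p1 + `|v| `^ p2)) h ->
  forall e, 0 < e -> exists2 C, 0 <= C & {ae mu, forall x, Omega x -> forall u v, 0 <= u -> 0 <= v ->
    F x u v <= (Num.max p1 p2)^-1 * ((h x + e) * (u `^ p1 + v `^ p2)) + C + `|F x 0 0|}.
Proof.
move=> p11 p21 [_ [H hH]] hF e e0; have [M0 hM0] := hF e e0.
pose M := Num.max M0 1; set m := Num.max p1 p2.
have M1 : 1 <= M by rewrite le_max lexx orbT.
have m0 : 0 < m by rewrite lt_max (lt_trans _ p11).
pose C1 := 2 * (C3 * (M `^ (q - 1) + M `^ (q - 1) + 1) * M).
have C10 : 0 <= C1.
  by rewrite !mulr_ge0 ?(ltW C30) ?addr_ge0 ?powR_ge0 // (le_trans _ M1).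
(* Compensates the main term when [S <= M], where [h x + e] may be negative. *)
pose C2 := m^-1 * ((`|H| + e) * M).
have C20 : 0 <= C2.
  by rewrite mulr_ge0 ?invr_ge0 ?(ltW m0) // mulr_ge0 ?(le_trans _ M1) // addr_ge0 // ltW.
exists (C1 + C2); first exact: addr_ge0.
apply: filterS2 hM0 hH => x hx Hx Ox u v u0 v0.
have := hx Ox u v u0 v0; rewrite (ger0_norm u0) (ger0_norm v0).
set S := u `^ p1 + v `^ p2 => hS.
have S0 : 0 <= S by rewrite addr_ge0 ?powR_ge0.
have [MS|SM] := ltP M S.
  have Spos : 0 < S by rewrite (lt_trans _ MS) // (lt_le_trans _ M1).
  have := hS (le_lt_trans _ MS); rewrite le_max lexx => /(_ isT).
  rewrite ler_pdivrMr // mulrC -ler_pdivlMr // mulrC => h1.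
  rewrite (le_trans h1) // -[X in X <= _]addr0 -[X in _ <= X]addrA lerD2l.
  by rewrite !addr_ge0.
have small r t : 1 < r -> 0 <= t -> t `^ r <= S -> t <= M.
  move=> r1 t0 tS; have [t1|t1] := leP t 1; first exact: le_trans M1.
  rewrite (le_trans _ (le_trans tS SM)) // -[X in X <= _]powRr1 //.
  by rewrite ler_powR ?ltW.
have uM : u <= M by apply: (small p1) => //; rewrite lerDl powR_ge0.
have vM : v <= M by apply: (small p2) => //; rewrite lerDr powR_ge0.
have h1 := potential_mono Ox u0 v0 uM vM.
have h2 := potential_box Ox (le_trans ler01 M1).
have h3 : - C2 <= m^-1 * ((h x + e) * S).
  rewrite -mulrN ler_pM2l ?invr_gt0 // lerNl -mulNr.
  apply: (@le_trans _ _ ((`|H| + e) * S)); last first.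
    by rewrite ler_wpM2l // addr_ge0 // ltW.
  rewrite ler_wpM2r //; have := Hx Ox; have := ler_norm H.
  by rewrite ler_norml => h5 /andP[h6 _]; move: `|H| h5 => ? ?; lra.
have h4 := ler_norm (F x 0 0).
by move: h1 h2 h3 h4; rewrite -/C1; lra.
Qed.

End potential.

(** * Minimization of the energy *)

Lemma cvg_subseq_infty (phi : nat -> nat) : (forall n, (n <= phi n)%N) -> phi @ \oo --> \oo.
Proof.
move=> h; apply/cvgnyPge => A; near=> n; apply: leq_trans (h n).
by near: n; exact: nbhs_infty_ge.
Unshelve. all: by end_near. Qed.

Lemma near_and4 (P Q S W : nat -> Prop) : (\forall n \near \oo, P n) ->
  (\forall n \near \oo, Q n) -> (\forall n \near \oo, S n) ->
  (\forall n \near \oo, W n) -> exists n, [/\ P n, Q n, S n & W n].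
Proof.
move=> [a _ ha] [b _ hb] [c _ hc] [d _ hd]; exists (a + b + c + d)%N.
by split; [apply: ha|apply: hb|apply: hc|apply: hd] => /=; lia.
Qed.

Section integrability.
Context d (S : measurableType d) {R : realType} (m : {measure set S -> \bar R}).
Variables (D : set S) (mD : measurable D).

Lemma ae_le_integrable (f g : S -> \bar R) : measurable_fun D f ->
  {ae m, forall x, D x -> (`|f x| <= `|g x|)%E} -> m.-integrable D g -> m.-integrable D f.
Proof.
move=> mf fg /integrableP[mg goo]; apply/integrableP; split => //.
apply: le_lt_trans goo; apply: ae_ge0_le_integral => //; exact: measurableT_comp.
Qed.

Lemma integrable_cst_lty (c : R) : (m D < +oo)%E -> m.-integrable D (fun=> c%:E).
Proof.
move=> Doo; apply/integrableP; split; first exact: measurable_cst.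
rewrite integral_cst // lte_mul_pinfty //.
Qed.

End integrability.

Lemma lee_fin_affine (R : realType) (I k a b c d e K : R) :
  (I%:E <= k%:E * ((a%:E + e%:E * b%:E) + (c%:E + e%:E * d%:E)) + K%:E)%E ->
  I <= k * ((a + e * b) + (c + e * d)) + K.
Proof. by rewrite -lee_fin. Qed.

(** Replacing [1 / p_i] by the smaller [1 / m] gives the seminorms the same factor as the potential;
    half of the smaller gap survives the subtraction. *)
Lemma coercive_arith (R : realType) (p1 p2 d1 d2 g1 g2 a1 a2 I K : R) :
  1 < p1 -> 1 < p2 -> 0 < d1 -> 0 < d2 -> 0 <= g1 -> 0 <= g2 ->
  a1 <= (1 - d1 / 2) * g1 -> a2 <= (1 - d2 / 2) * g2 ->
  I <= (Num.max p1 p2)^-1 * (a1 + a2) + K ->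
  (Num.max p1 p2)^-1 * (Num.min d1 d2 / 2) * (g1 + g2) - K <= g1 / p1 + g2 / p2 - I.
Proof.
move=> p1_gt1 p2_gt1 d10 d20 g10 g20 ha1 ha2; set m := Num.max p1 p2; set d := Num.min d1 d2 => hI.
have m0 : 0 < m by rewrite lt_max (lt_trans _ p1_gt1).
have b1 : m^-1 * g1 <= g1 / p1.
  by rewrite mulrC ler_wpM2l // lef_pV2 ?posrE ?(lt_trans _ p1_gt1) // le_max lexx.
have b2 : m^-1 * g2 <= g2 / p2.
  by rewrite mulrC ler_wpM2l // lef_pV2 ?posrE ?(lt_trans _ p2_gt1) // le_max lexx orbT.
have b3 : m^-1 * (a1 + a2) <= m^-1 * ((1 - d1 / 2) * g1 + (1 - d2 / 2) * g2).
  by rewrite ler_wpM2l ?invr_ge0 ?(ltW m0) // lerD.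
have b4 : m^-1 * (d / 2 * (g1 + g2)) <= m^-1 * (d1 / 2 * g1 + d2 / 2 * g2).
  rewrite ler_wpM2l ?invr_ge0 ?(ltW m0) // mulrDr lerD // ler_wpM2r // ler_wpM2r //.
    by rewrite ge_min lexx.
  by rewrite ge_min lexx orbT.
have b5 : m^-1 * ((1 - d1 / 2) * g1 + (1 - d2 / 2) * g2) =
  m^-1 * g1 + m^-1 * g2 - m^-1 * (d1 / 2 * g1 + d2 / 2 * g2) by ring.
rewrite -mulrA; rewrite b5 in b3.
move: (m^-1 * (d1 / 2 * _ + _)) (m^-1 * (d / 2 * _)) (m^-1 * g1) (m^-1 * g2) (m^-1 * (a1 + a2))
  (g1 / p1) (g2 / p2) b1 b2 b3 b4 hI => *; lra.
Qed.

(** Four errors of size [e / 4]: one from each seminorm, one from the potential, one from the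
    minimizing sequence. Division by [p_i > 1] does not enlarge the first two. *)
Lemma lsc_arith (R : realType) (p1 p2 e a b I A B J j t : R) : 1 < p1 -> 1 < p2 ->
  a - e / 4 < A -> b - e / 4 < B -> `|I - J| <= e / 4 -> t <= e / 4 ->
  A / p1 + B / p2 - J < j + t -> a / p1 + b / p2 - I <= j + e.
Proof.
move=> p11 p21 hA hB hI ht hj.
have e0 : 0 <= e / 4 by exact: le_trans hI.
have div p c C : 1 < p -> c - e / 4 < C -> c / p <= C / p + e / 4.
  move=> p1' hc; rewrite (le_trans (y := (C + e / 4) / p)) //.
    by rewrite ler_wpM2r ?invr_ge0 ?(le_trans _ (ltW p1')) // -lerBlDr ltW.
  by rewrite mulrDl lerD2l ler_pdivrMr ?(lt_trans _ p1') // ler_peMr // ltW.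
have hA' := div _ _ _ p11 hA; have hB' := div _ _ _ p21 hB.
move: hI; rewrite ler_norml => /andP[hI1 hI2].
by move: (a / p1) (b / p2) (A / p1) (B / p2) hA' hB' hj => *; lra.
Qed.

Section energy.
Context {R : realType} {N : nat}.
Local Notation T := 'rV[R]_N.
Local Notation mu := (@leb R N).
Variables (Omega : set T) (s1 s2 p1 p2 : R) (F : T -> R -> R -> R) (h : T -> R).
Hypotheses (N0 : (0 < N)%N) (s1_01 : 0 < s1 < 1) (s2_01 : 0 < s2 < 1).
Hypotheses (p1_gt1 : 1 < p1) (p2_gt1 : 1 < p2).
Hypotheses (oO : open Omega) (bO : bounded_set Omega).
Hypothesis F_measurable : forall u v : T -> R,
  measurable_fun Omega u -> measurable_fun Omega v ->
  (forall x, 0 <= u x) -> (forall x, 0 <= v x) ->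
  measurable_fun Omega (fun x => F x (u x) (v x)).
Hypothesis F_min : forall x a b, Omega x -> 0 <= a -> 0 <= b -> F x 0 0 <= F x a b.
Hypothesis F_cvg : forall x (a b : R) (a_ b_ : nat -> R), Omega x ->
  (forall n, 0 <= a_ n) -> (forall n, 0 <= b_ n) -> 0 <= a -> 0 <= b ->
  a_ @ \oo --> a -> b_ @ \oo --> b -> F x (a_ n) (b_ n) @[n --> \oo] --> F x a b.
Local Notation m := (Num.max p1 p2).
Hypothesis F_upper : forall e, 0 < e -> exists2 C, 0 <= C &
  {ae mu, forall x, Omega x -> forall u v, 0 <= u -> 0 <= v ->
    F x u v <= m^-1 * ((h x + e) * (u `^ p1 + v `^ p2)) + C + `|F x 0 0|}.
Hypothesis F_00 : mu.-integrable Omega (fun x => (F x 0 0)%:E).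
Hypothesis h_bounded : Linfty Omega h.
Local Notation G1 u := (gagliardo s1 p1 setT u).
Local Notation G2 u := (gagliardo s2 p2 setT u).
Hypothesis gap1 : exists2 d : R, 0 < d & forall u, X0 s1 p1 Omega u ->
    (\int[mu]_(x in Omega) (h x * `|u x| `^ p1)%:E <= (1 - d)%:E * G1 u)%E.
Hypothesis gap2 : exists2 d : R, 0 < d & forall u, X0 s2 p2 Omega u ->
    (\int[mu]_(x in Omega) (h x * `|u x| `^ p2)%:E <= (1 - d)%:E * G2 u)%E.

Let mO : measurable Omega. Proof. exact: measurable_open. Qed.
Let s1_0 : 0 < s1. Proof. by case/andP: s1_01. Qed.
Let s2_0 : 0 < s2. Proof. by case/andP: s2_01. Qed.
Let m0 : 0 < m. Proof. by rewrite lt_max (lt_trans _ p1_gt1). Qed.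
Let Ofin : (mu Omega < +oo)%E. Proof. exact: bounded_leb_lty. Qed.

Lemma potential_bound : exists c C, [/\ 0 <= c, 0 <= C &
  {ae mu, forall x, Omega x -> forall a b, 0 <= a -> 0 <= b ->
    `|F x a b| <= c * (a `^ p1 + b `^ p2) + (C + `|F x 0 0|)}].
Proof.
have [C C0 hC] := F_upper ltr01; have [_ [H hH]] := h_bounded.
have c0 : 0 <= m^-1 * (`|H| + 1).
  by rewrite mulr_ge0 ?invr_ge0 ?(ltW m0) // addr_ge0.
exists (m^-1 * (`|H| + 1)), C; split => //.
apply: filterS2 hC hH => x hx Hx Ox a b a0 b0.
have S0 : 0 <= a `^ p1 + b `^ p2 by rewrite addr_ge0 ?powR_ge0.
rewrite ler_norml; apply/andP; split.
  rewrite (le_trans _ (F_min Ox a0 b0)) // lerNl (le_trans (ler_norm _)) // normrN.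
  by rewrite addrA lerDr addr_ge0 // mulr_ge0.
rewrite (le_trans (hx Ox a b a0 b0)) // addrA !lerD2r -mulrA.
rewrite ler_wpM2l ?invr_ge0 ?(ltW m0) // ler_wpM2r // lerD2r.
by rewrite (le_trans (ler_norm _)) // (le_trans (Hx Ox)) // ler_norm.
Qed.

Lemma measurable_potential_norm (u v : T -> R) : measurable_fun setT u ->
  measurable_fun setT v -> measurable_fun Omega (fun x => (F x `|u x| `|v x|)%:E).
Proof.
move=> mu_ mv; apply/measurable_EFinP.
apply: (F_measurable (u := fun x => `|u x|) (v := fun x => `|v x|)) => //.
  by apply: measurableT_comp => //; exact: measurable_funTS.
by apply: measurableT_comp => //; exact: measurable_funTS.
Qed.

Lemma integrable_bound (g1 g2 : T -> \bar R) (c C : R) :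
  mu.-integrable Omega g1 -> mu.-integrable Omega g2 ->
  mu.-integrable Omega (fun x => c%:E * (g1 x + g2 x) + (C%:E + `|(F x 0 0)%:E|))%E.
Proof.
move=> i1 i2; apply: integrableD => //.
  by apply: integrableZl => //; exact: integrableD.
by apply: integrableD => //; [exact: integrable_cst_lty|exact: integrable_abse].
Qed.

Lemma potential_integrable u v : X0 s1 p1 Omega u -> X0 s2 p2 Omega v ->
  mu.-integrable Omega (fun x => (F x `|u x| `|v x|)%:E).
Proof.
move=> Xu Xv; have [c [C [c0 C0 hF]]] := potential_bound.
apply: (ae_le_integrable mO _ _ (integrable_bound c C (integrable_X0_powR Xu)
  (integrable_X0_powR Xv))).
  by apply: measurable_potential_norm; [exact: X0_measurable Xu|exact: X0_measurable Xv].
apply: filterS hF => x hx Ox.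
have := le_trans (hx Ox _ _ (normr_ge0 (u x)) (normr_ge0 (v x))) (ler_norm _).
by rewrite -lee_fin.
Qed.

(** The absolute values make the energy meaningful on signed functions, although [F] is given on the
    quadrant only. *)
Definition potential_integral (u v : T -> R) : R :=
  fine (\int[mu]_(x in Omega) (F x `|u x| `|v x|)%:E)%E.

Definition energy (u v : T -> R) : R :=
  fine (G1 u) / p1 + fine (G2 v) / p2 - potential_integral u v.

(** The error [e] in the upper bound of [F] is absorbed through the Poincaré inequality at the price
    of half the gap. *)
Lemma gap_fine s p u d e C : 0 < s < 1 -> 1 < p -> X0 s p Omega u -> 0 <= e ->
  (\int[mu]_(x in Omega) (h x * `|u x| `^ p)%:E <= (1 - d)%:E * gagliardo s p setT u)%E ->
  (int_pow p Omega u <= C%:E * gagliardo s p setT u)%E -> e * C <= d / 2 ->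
  fine (\int[mu]_(x in Omega) (h x * `|u x| `^ p)%:E)%E + e * fine (int_pow p Omega u) <=
  (1 - d / 2) * fine (gagliardo s p setT u).
Proof.
move=> s01 p_1 Xu e0.
have If := int_pow_fin_num Xu; have Gf := X0_fin_num p_1 mO Xu.
have hf := integrable_fin_num mO (integrable_weight_powR oO h_bounded Xu).
have G0 : 0 <= fine (gagliardo s p setT u) by rewrite fine_ge0 // gagliardo_ge0.
rewrite -(fineK If) -(fineK Gf) -(fineK hf) -!EFinM !lee_fin /=.
move: (fine _) (fine _) (fine (gagliardo _ _ _ _)) G0 => b a c c0 h1 h2 h3.
have h4 : e * b <= e * (C * c) by exact: ler_wpM2l.
have h5 : e * C * c <= d / 2 * c by exact: ler_wpM2r.
rewrite mulrA in h4; rewrite mulrBl mul1r in h1; rewrite mulrBl mul1r.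
rewrite (_ : d * c = d / 2 * c + d / 2 * c) in h1; last by field.
by move: (d / 2 * c) (e * b) (e * C * c) h1 h4 h5 => *; lra.
Qed.

Lemma energy_coercive : exists2 k : R, 0 < k & exists K : R,
  forall u v, X0 s1 p1 Omega u -> X0 s2 p2 Omega v ->
  k * (fine (G1 u) + fine (G2 v)) - K <= energy u v.
Proof.
have [d1 d10 gd1] := gap1; have [d2 d20 gd2] := gap2.
have [C1 C10 pC1] := X0_poincare N0 s1_0 p1_gt1 mO bO.
have [C2 C20 pC2] := X0_poincare N0 s2_0 p2_gt1 mO bO.
pose e := Num.min (d1 / 2 / C1) (d2 / 2 / C2).
have e0 : 0 < e by rewrite lt_min !divr_gt0.
have eC1 : e * C1 <= d1 / 2 by rewrite -ler_pdivlMr // ge_min lexx.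
have eC2 : e * C2 <= d2 / 2 by rewrite -ler_pdivlMr // ge_min lexx orbT.
have [C C0 hC] := F_upper e0.
pose d := Num.min d1 d2.
exists (m^-1 * (d / 2)).
  by rewrite mulr_gt0 ?invr_gt0 // divr_gt0 // lt_min d10.
exists (fine (\int[mu]_(x in Omega) (C%:E + `|(F x 0 0)%:E|))%E) => u v Xu Xv.
have i1 := integrable_X0_powR Xu.
have i2 := integrable_X0_powR Xv.
have h1 := integrable_weight_powR oO h_bounded Xu.
have h2 := integrable_weight_powR oO h_bounded Xv.
have ei1 := integrableZl mO e i1; have ei2 := integrableZl mO e i2.
have hi1 := integrableD mO h1 ei1; have hi2 := integrableD mO h2 ei2.
have hi := integrableD mO hi1 hi2.
have mhi := integrableZl mO m^-1 hi.
have iC : mu.-integrable Omega (fun x => C%:E + `|(F x 0 0)%:E|)%E.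
  by apply: integrableD => //; [exact: integrable_cst_lty|exact: integrable_abse].
have iF := potential_integrable Xu Xv.
have le1 := ae_le_integral mO iF (integrableD mO mhi iC).
have {le1} : (\int[mu]_(x in Omega) (F x `|u x| `|v x|)%:E <=
    m^-1%:E * ((\int[mu]_(x in Omega) (h x * `|u x| `^ p1)%:E + e%:E * int_pow p1 Omega u)
     + (\int[mu]_(x in Omega) (h x * `|v x| `^ p2)%:E + e%:E * int_pow p2 Omega v))
    + \int[mu]_(x in Omega) (C%:E + `|(F x 0 0)%:E|))%E.
  apply: le_trans (le1 _) _.
    apply: filterS hC => x hx Ox.
    have := hx Ox _ _ (normr_ge0 (u x)) (normr_ge0 (v x)).
    by rewrite mulrDr !mulrDl -[_ + C + _]addrA -lee_fin.
  rewrite (integralD mO mhi iC) (integralZl mO hi) (integralD mO hi1 hi2).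
  rewrite (integralD mO h1 ei1) (integralD mO h2 ei2) (integralZl mO i1) (integralZl mO i2).
  exact: lexx.
have g1 := gap_fine s1_01 p1_gt1 Xu (ltW e0) (gd1 u Xu) (pC1 u Xu) eC1.
have g2 := gap_fine s2_01 p2_gt1 Xv (ltW e0) (gd2 v Xv) (pC2 v Xv) eC2.
rewrite -(fineK (integrable_fin_num mO iF)) -(fineK (integrable_fin_num mO h1)).
rewrite -(fineK (integrable_fin_num mO h2)) -(fineK (integrable_fin_num mO iC)).
rewrite -(fineK (int_pow_fin_num Xu)) -(fineK (int_pow_fin_num Xv)).
move=> /lee_fin_affine hI.
have G10 : 0 <= fine (G1 u) by rewrite fine_ge0 // gagliardo_ge0.
have G20 : 0 <= fine (G2 v) by rewrite fine_ge0 // gagliardo_ge0.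
exact: (coercive_arith p1_gt1 p2_gt1 d10 d20 G10 G20 g1 g2 hI).
Qed.

Lemma X0_zero s p : 0 < s -> 1 < p -> X0 s p Omega (fun=> 0).
Proof.
move=> s0 p_1; apply: (X0_intro N0 s0 p_1 mO bO) => //; first exact: aeW.
rewrite /gagliardo (_ : (fun z => _) = cst 0%E); first by rewrite integral0 ltry.
by apply/funext => z; rewrite subrr normr0 powR0 ?mul0r // gt_eqF // (lt_trans _ p_1).
Qed.

Lemma potential_integral_cvg (u_ v_ : nat -> T -> R) u v (g1 g2 : T -> \bar R) :
  (forall n, X0 s1 p1 Omega (u_ n)) -> (forall n, X0 s2 p2 Omega (v_ n)) ->
  X0 s1 p1 Omega u -> X0 s2 p2 Omega v ->
  {ae mu, forall x, u_ n x @[n --> \oo] --> u x} ->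
  {ae mu, forall x, v_ n x @[n --> \oo] --> v x} ->
  mu.-integrable Omega g1 -> mu.-integrable Omega g2 ->
  {ae mu, forall x, Omega x -> forall n, ((`|u_ n x| `^ p1)%:E <= g1 x)%E} ->
  {ae mu, forall x, Omega x -> forall n, ((`|v_ n x| `^ p2)%:E <= g2 x)%E} ->
  potential_integral (u_ n) (v_ n) @[n --> \oo] --> potential_integral u v.
Proof.
move=> Xu_ Xv_ Xu Xv cu cv i1 i2 ug vg; have [c [C [c0 C0 hF]]] := potential_bound.
have iF := potential_integrable Xu Xv.
apply: fine_cvg; rewrite fineK; last exact: integrable_fin_num.
have [] := @dominated_convergence _ _ _ mu Omega mO
    (fun n x => (F x `|u_ n x| `|v_ n x|)%:E) (fun x => (F x `|u x| `|v x|)%:E)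
    (fun x => c%:E * (g1 x + g2 x) + (C%:E + `|(F x 0 0)%:E|))%E
    (fun n => measurable_int _ (potential_integrable (Xu_ n) (Xv_ n)))
    (measurable_int _ iF) _ (integrable_bound c C i1 i2) _ => //.
- apply: filterS2 cu cv => x cux cvx Ox; apply: cvg_EFin; first by near=> n.
  by apply: F_cvg => //; exact: cvg_norm.
- apply: filterS3 hF ug vg => x hx ux vx n Ox; rewrite abse_EFin.
  apply: (@le_trans _ _ (c%:E * ((`|u_ n x| `^ p1)%:E + (`|v_ n x| `^ p2)%:E) +
    (C%:E + `|(F x 0 0)%:E|))%E).
    have := hx Ox _ _ (normr_ge0 (u_ n x)) (normr_ge0 (v_ n x)).
    by rewrite -lee_fin.
  apply: leeD => //; apply: lee_wpmul2l; first by rewrite lee_fin.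
  by apply: leeD; [exact: ux|exact: vx].
Unshelve. all: by end_near. Qed.

Lemma energy_norm u v : X0 s1 p1 Omega u -> X0 s2 p2 Omega v ->
  energy (fun x => `|u x|) (fun x => `|v x|) <= energy u v.
Proof.
move=> Xu Xv; rewrite /energy.
have -> : potential_integral (fun x => `|u x|) (fun x => `|v x|) = potential_integral u v.
  by rewrite /potential_integral; under eq_integral do rewrite !normr_id.
rewrite lerD2r; apply: lerD; apply: ler_wpM2r.
- by rewrite invr_ge0; exact: (le_trans ler01 (ltW p1_gt1)).
- apply: fine_le (gagliardo_norm_fun s1 p1_gt1 (X0_measurable Xu)).
    exact: (X0_fin_num p1_gt1 mO (X0_norm_fun N0 s1_0 p1_gt1 mO bO Xu)).
  exact: (X0_fin_num p1_gt1 mO Xu).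
- by rewrite invr_ge0; exact: (le_trans ler01 (ltW p2_gt1)).
- apply: fine_le (gagliardo_norm_fun s2 p2_gt1 (X0_measurable Xv)).
    exact: (X0_fin_num p2_gt1 mO (X0_norm_fun N0 s2_0 p2_gt1 mO bO Xv)).
  exact: (X0_fin_num p2_gt1 mO Xv).
Qed.

Lemma energy_minimizer : exists u v, [/\ X0 s1 p1 Omega u, X0 s2 p2 Omega v,
  forall x, 0 <= u x, forall x, 0 <= v x &
  forall u' v', X0 s1 p1 Omega u' -> X0 s2 p2 Omega v' -> energy u v <= energy u' v'].
Proof.
have [k k0 [K hK]] := energy_coercive.
pose E := [set t | exists u v, [/\ X0 s1 p1 Omega u, X0 s2 p2 Omega v & t = energy u v]].
have fG1 u : 0 <= fine (G1 u) by rewrite fine_ge0 // gagliardo_ge0.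
have fG2 u : 0 <= fine (G2 u) by rewrite fine_ge0 // gagliardo_ge0.
have lbE : has_lbound E.
  exists (- K) => _ [u [v [Xu Xv ->]]]; apply: le_trans (hK u v Xu Xv).
  by rewrite -[leLHS]add0r lerD2r mulr_ge0 ?(ltW k0) // addr_ge0.
have infE : has_inf E.
  split => //; exists (energy (fun=> 0) (fun=> 0)), (fun=> 0), (fun=> 0).
  by split => //; exact: X0_zero.
have {infE}/choice[w hw] n : exists w : (T -> R) * (T -> R), [/\ X0 s1 p1 Omega w.1,
    X0 s2 p2 Omega w.2 & energy w.1 w.2 < inf E + n.+1%:R^-1].
  have n0 : 0 < n.+1%:R^-1 :> R by rewrite invr_gt0.
  have [_ [u [v [Xu Xv ->]]] h1] := inf_adherent n0 infE.
  by exists (u, v); split; [exact: Xu|exact: Xv|exact: h1].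
have Xw1 n : X0 s1 p1 Omega (w n).1 by case: (hw n).
have Xw2 n : X0 s2 p2 Omega (w n).2 by case: (hw n).
(* The energies stay below [inf E + 1], so coercivity bounds both seminorms. *)
pose M := (inf E + 1 + K) / k.
have wM n : fine (G1 (w n).1) + fine (G2 (w n).2) <= M.
  have [_ _ h1] := hw n; have h2 := hK _ _ (Xw1 n) (Xw2 n).
  have h3 : n.+1%:R^-1 <= 1 :> R by rewrite invf_le1 // ler1n.
  rewrite /M ler_pdivlMr // mulrC; move: h1 h2 h3.
  move: (k * _) (energy _ _) (n.+1%:R^-1) => *; lra.
have GM1 n : (G1 (w n).1 <= M%:E)%E.
  rewrite -(fineK (X0_fin_num p1_gt1 mO (Xw1 n))) lee_fin.
  by rewrite (le_trans _ (wM n)) // lerDl.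
have GM2 n : (G2 (w n).2 <= M%:E)%E.
  rewrite -(fineK (X0_fin_num p2_gt1 mO (Xw2 n))) lee_fin.
  by rewrite (le_trans _ (wM n)) // lerDr.
have [phi [u [g1 [kphi [Xu cu ig1 ug1 lsc1]]]]] :=
  X0_compact N0 s1_01 p1_gt1 oO bO Xw1 GM1.
(* The second extraction runs along the first subsequence; what is known of the first component is
   then carried over to the composed subsequence. *)
have [psi [v [g2 [kpsi [Xv cv ig2 vg2 lsc2]]]]] :=
  X0_compact N0 s2_01 p2_gt1 oO bO (fun n => Xw2 (phi n)) (fun n => GM2 (phi n)).
have psioo := cvg_subseq_infty kpsi.
have psi_near (P : nat -> Prop) : (\forall n \near \oo, P n) -> \forall n \near \oo, P (psi n).
  exact: psioo.
pose U n := (w (phi (psi n))).1; pose V n := (w (phi (psi n))).2.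
have XU n : X0 s1 p1 Omega (U n) by exact: Xw1.
have XV n : X0 s2 p2 Omega (V n) by exact: Xw2.
have cU : {ae mu, forall x, U n x @[n --> \oo] --> u x}.
  by apply: filterS cu => x cx; exact: (cvg_comp _ _ psioo cx).
have gU : {ae mu, forall x, Omega x -> forall n, ((`|U n x| `^ p1)%:E <= g1 x)%E}.
  by apply: filterS ug1 => x gx Ox n; exact: (gx Ox (psi n)).
have cP := potential_integral_cvg XU XV Xu Xv cU cv ig1 ig2 gU vg2.
have Gf1 := X0_fin_num p1_gt1 mO Xu; have Gf2 := X0_fin_num p2_gt1 mO Xv.
have le_inf : energy u v <= inf E.
  apply/ler_addgt0Pr => e e0; pose e' := e / 4.
  have e'0 : 0 < e' by rewrite divr_gt0.
  have e1 : ((fine (G1 u) - e')%:E < G1 u)%E.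
    by rewrite -[X in (_ < X)%E](fineK Gf1) lte_fin ltrBlDr ltrDl.
  have e2 : ((fine (G2 v) - e')%:E < G2 v)%E.
    by rewrite -[X in (_ < X)%E](fineK Gf2) lte_fin ltrBlDr ltrDl.
  have near1 : \forall n \near \oo, ((fine (G1 u) - e')%:E < G1 (U n))%E.
    exact: (psi_near (fun n => ((fine (G1 u) - e')%:E < G1 (w (phi n)).1)%E) (lsc1 _ e1)).
  have near2 : \forall n \near \oo, ((fine (G2 v) - e')%:E < G2 (V n))%E.
    exact: (lsc2 _ e2).
  have near3 : \forall n \near \oo, `|potential_integral u v - potential_integral (U n) (V n)| <= e'.
    by move/cvgrPdist_le : cP; exact.
  have near4 := near_infty_natSinv_lt (PosNum e'0).
  have [n [n1 n2 h3 n4]] := near_and4 near1 near2 near3 near4.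
  have h1 : fine (G1 u) - e' < fine (G1 (U n)).
    rewrite -lte_fin (fineK (X0_fin_num p1_gt1 mO (XU n))); exact: n1.
  have h2 : fine (G2 v) - e' < fine (G2 (V n)).
    rewrite -lte_fin (fineK (X0_fin_num p2_gt1 mO (XV n))); exact: n2.
  have h4 : (phi (psi n)).+1%:R^-1 <= e'.
    apply: le_trans (ltW n4).
    by rewrite lef_pV2 ?posrE // ler_nat ltnS (leq_trans (kpsi n)).
  have [_ _ h5] := hw (phi (psi n)).
  exact: (lsc_arith p1_gt1 p2_gt1 h1 h2 h3 h4 h5).
exists (fun x => `|u x|), (fun x => `|v x|); split.
- exact: (X0_norm_fun N0 s1_0 p1_gt1 mO bO).
- exact: (X0_norm_fun N0 s2_0 p2_gt1 mO bO).
- by move=> x; exact: normr_ge0.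
- by move=> x; exact: normr_ge0.
- move=> u' v' Xu' Xv'; apply: le_trans (energy_norm Xu Xv) (le_trans le_inf _).
  by apply: (ge_inf lbE); exists u', v'.
Qed.

End energy.

(** * The Euler-Lagrange equations *)

Lemma fine_quotient (R : realType) (a b : \bar R) (n : nat) :
  a \is a fin_num -> b \is a fin_num ->
  (fine a - fine b) / n.+1%:R^-1 = fine (n.+1%:R%:E * (a - b))%E.
Proof. by case: a => //= a; case: b => //= b _ _; rewrite invrK mulrC. Qed.

Lemma quotient_arith (R : realFieldType) (a A I J t p : R) : 0 < t ->
  a / p - I <= A / p - J -> (J - I) / t <= (A - a) / t / p.
Proof.
move=> t0 h; rewrite mulrAC ler_pM2r ?invr_gt0 // mulrBl.
by move: (a / p) (A / p) h => *; lra.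
Qed.

Section euler_lagrange.
Context {R : realType} {N : nat}.
Local Notation T := 'rV[R]_N.
Local Notation mu := (@leb R N).
Variables (s p q : R) (Omega : set T).
Hypotheses (N0 : (0 < N)%N) (s01 : 0 < s < 1) (p1 : 1 < p).
Hypotheses (oO : open Omega) (bO : bounded_set Omega).
Hypothesis spN : s * p < N%:R.
Hypothesis q1 : 1 < q.
Hypothesis qsub : q < N%:R * p / (N%:R - s * p).
Local Notation G u := (gagliardo s p setT u).

Let s0 : 0 < s. Proof. by case/andP: s01. Qed.
Let p0 : 0 < p. Proof. exact: lt_trans p1. Qed.
Let q0 : 0 < q. Proof. exact: lt_trans q1. Qed.
Let mO : measurable Omega. Proof. exact: measurable_open. Qed.
Let Ofin : (mu Omega < +oo)%E. Proof. exact: bounded_leb_lty. Qed.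

Definition plap_kernel (u w : T -> R) (z : T * T) : R :=
  `|u z.1 - u z.2| `^ (p - 2) * (u z.1 - u z.2) * (w z.1 - w z.2)
      / enorm (z.1 - z.2) `^ (N%:R + s * p).

Lemma measurable_plap_kernel u w : measurable_fun setT u -> measurable_fun setT w ->
  measurable_fun setT (plap_kernel u w).
Proof.
move=> mu_ mw; have md (f : T -> R) : measurable_fun setT f ->
    measurable_fun setT (fun z : T * T => f z.1 - f z.2).
  by move=> mf; apply: measurable_funB; apply: measurableT_comp.
apply: measurable_funM; last exact: measurable_kernel_rV.
apply: measurable_funM; last exact: md.
by apply: measurable_funM; [apply: measurable_normr_powR|]; exact: md.
Qed.

Lemma integrable_gag u : X0 s p Omega u -> (mu \x mu)%E.-integrable setT (fun z => (gag s p u z)%:E).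
Proof.
move=> Xu; apply/integrableP; split.
  by apply/measurable_EFinP; apply: measurable_gag; exact: X0_measurable Xu.
under eq_integral do rewrite gee0_abs ?lee_fin ?gag_ge0 //.
by have := X0_gagliardo p1 mO Xu.
Qed.

Lemma gag_quotient_le (u w : T -> R) z t : 0 < t <= 1 ->
  `|(gag s p (fun x : T => u x + t * w x) z - gag s p u z) / t| <=
  p * (2 `^ p * (gag s p u z + gag s p w z)).
Proof.
move=> t01; rewrite /gag; set K := enorm _ `^ _.
have K0 : 0 <= K^-1 by rewrite invr_ge0 powR_ge0.
rewrite -mulrBl mulrAC normrM (ger0_norm K0).
have -> : u z.1 + t * w z.1 - (u z.2 + t * w z.2) = u z.1 - u z.2 + t * (w z.1 - w z.2) by ring.
rewrite -mulrDl mulrA [X in _ <= X]mulrA ler_wpM2r // -mulrA.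
exact: normr_powR_quotient_le.
Qed.

Lemma gag_quotient_cvg (u w : T -> R) z :
  (gag s p (fun x : T => u x + n.+1%:R^-1 * w x) z - gag s p u z) / n.+1%:R^-1 @[n --> \oo] -->
  p * plap_kernel u w z.
Proof.
rewrite /gag /plap_kernel; set K := enorm _ `^ _.
rewrite [X in _ --> X]mulrA.
rewrite (_ : (fun n => _) = (fun n => (`|(u z.1 - u z.2) + n.+1%:R^-1 * (w z.1 - w z.2)| `^ p -
    `|u z.1 - u z.2| `^ p) / n.+1%:R^-1 * K^-1)).
  by apply: cvgMl; exact: normr_powR_quotient_cvg.
apply/funext => n; rewrite -mulrBl mulrAC; congr (_ * _ * _).
by congr (`|_| `^ _ - _); ring.
Qed.

Lemma inv_natS_itv n : 0 < (n.+1%:R^-1 : R) <= 1.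
Proof. by rewrite invr_gt0 invf_le1 // ler1n ltr0n. Qed.

(** A derivative along the steps [1 / (n + 1)] suffices, as minimality is tested on one side only
    and [w] may be replaced by [- w]. Dominated convergence also yields the integrability of the
    kernel, so that [plap_form] is a finite number. *)
Lemma gagliardo_derivative u w : X0 s p Omega u -> X0 s p Omega w ->
  (mu \x mu)%E.-integrable setT (fun z => (plap_kernel u w z)%:E) /\
  (fine (G (fun x => u x + n.+1%:R^-1 * w x)%R) - fine (G u)) / n.+1%:R^-1 @[n --> \oo] -->
  p * fine (plap_form s p u w).
Proof.
move=> Xu Xw.
have mu_ := X0_measurable Xu; have mw := X0_measurable Xw.
pose u_ n x := u x + n.+1%:R^-1 * w x.
have Xu_ n : X0 s p Omega (u_ n) by exact: (X0_addZ N0 s0 p1 mO bO).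
have iu := integrable_gag Xu; have iw := integrable_gag Xw.
have iu_ n := integrable_gag (Xu_ n).
have iD n := integrableB measurableT (iu_ n) iu.
have iQ n := integrableZl measurableT n.+1%:R (iD n).
have mk : measurable_fun setT (fun z => (plap_kernel u w z)%:E).
  by apply/measurable_EFinP; exact: measurable_plap_kernel.
have mpk : measurable_fun setT (fun z => (p * plap_kernel u w z)%:E).
  by apply/measurable_EFinP; apply: measurable_funM => //; exact: measurable_plap_kernel.
have iM := integrableZl measurableT (p * 2 `^ p) (integrableD measurableT iu iw).
have hc : {ae (mu \x mu)%E, forall z, setT z ->
    n.+1%:R%:E * ((gag s p (u_ n) z)%:E - (gag s p u z)%:E) @[n --> \oo] -->
    (p * plap_kernel u w z)%:E}%E.
  apply: aeW => z _; apply: cvg_EFin; first by near=> n.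
  have := @gag_quotient_cvg u w z.
  by under eq_fun do rewrite invrK mulrC.
have hb : {ae (mu \x mu)%E, forall z n, setT z ->
    `|n.+1%:R%:E * ((gag s p (u_ n) z)%:E - (gag s p u z)%:E)| <=
    (p * 2 `^ p)%:E * ((gag s p u z)%:E + (gag s p w z)%:E)}%E.
  apply: aeW => z n _; have := gag_quotient_le u w z (inv_natS_itv n).
  by rewrite invrK mulrC mulrA -lee_fin.
have [ipk _ cv] := @dominated_convergence _ _ _ (mu \x mu)%E setT measurableT
  _ _ _ (fun n => measurable_int _ (iQ n)) mpk hc iM hb.
have ik : (mu \x mu)%E.-integrable setT (fun z => (plap_kernel u w z)%:E).
  have := integrableZl measurableT p^-1 ipk; congr (_.-integrable _ _).
  by apply/funext => z; rewrite -EFinM mulrA mulVf ?mul1r // gt_eqF.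
have fk : plap_form s p u w \is a fin_num by exact: (integrable_fin_num measurableT ik).
split => //.
rewrite (_ : (fun n => _) = fun n => fine (\int[mu \x mu]_z
   (n.+1%:R%:E * ((gag s p (u_ n) z)%:E - (gag s p u z)%:E)))%E); last first.
  apply/funext => n; rewrite (integralZl measurableT (iD n)).
  rewrite (integralB measurableT (iu_ n) iu).
  exact: (fine_quotient _ (X0_fin_num p1 mO (Xu_ n)) (X0_fin_num p1 mO Xu)).
apply: fine_cvg; move: cv; rewrite EFinM fineK //.
rewrite -(integralZl measurableT ik).
by [].
Unshelve. all: by end_near. Qed.

(** [g x] stands for the potential with the other unknown frozen at [b x], and [dg] for the matching
    nonlinearity; both equations are instances. *)
Variables (g dg : T -> R -> R) (b u : T -> R) (C : R).
Hypothesis C0 : 0 <= C.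
Hypothesis g_derive : forall x a, Omega x -> 0 <= a -> is_derive_ge0 (g x) a (dg x a).
Hypothesis dg_ge0 : forall x a, Omega x -> 0 <= a -> 0 <= dg x a.
Hypothesis dg_le : forall x a, Omega x -> 0 <= a ->
  dg x a <= C * (a `^ (q - 1) + b x `^ (q - 1) + 1).
Hypothesis b0 : forall x, 0 <= b x.
Hypothesis mb : measurable_fun Omega b.
Hypothesis bq : (int_pow q Omega b < +oo)%E.
Hypothesis Xu : X0 s p Omega u.
Hypothesis u0 : forall x, 0 <= u x.
Hypothesis ig : forall w, X0 s p Omega w -> mu.-integrable Omega (fun x => (g x `|w x|)%:E).
Hypothesis mdg : measurable_fun Omega (fun x => dg x (u x)).

Let mu_ : measurable_fun setT u. Proof. exact: X0_measurable Xu. Qed.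

Lemma increment_le x a a' S : Omega x -> 0 <= a <= S -> 0 <= a' <= S ->
  `|g x a - g x a'| <= C * (S `^ (q - 1) + b x `^ (q - 1) + 1) * `|a - a'|.
Proof.
move=> Ox; wlog aa : a a' / a' <= a.
  move=> h aS aS'; case/orP : (le_total a' a) => [/h|/h]; first exact.
  by rewrite distrC [`|a - _|]distrC; exact.
move=> /andP[a_0 aS] /andP[a'0 a'S].
have [|c /andP[ac ca] ->] := MVT_ge0 (g := g x) (dg := dg x) _ a'0 aa.
  by move=> t t0; exact: g_derive.
have c0 : 0 <= c by exact: le_trans ac.
rewrite normrM ler_wpM2r // ger0_norm ?dg_ge0 // (le_trans (dg_le Ox c0)) //.
by rewrite ler_wpM2l // !lerD2r powR_le ?subr_ge0 ?(ltW q1) // (le_trans ca).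
Qed.

(** [powR_young] is applied to the three products with bases [a + d], [c] and 1; each leaves one
    [d ^ q], hence the factor 3. *)
Lemma young_bound (a c d : R) : 0 <= a -> 0 <= c -> 0 <= d ->
  C * ((a + d) `^ (q - 1) + c `^ (q - 1) + 1) * d <=
  C * (2 `^ q * (a `^ q + d `^ q) + (c `^ q + (3 * d `^ q + 1))).
Proof.
move=> a0 c0 d0; rewrite -mulrA ler_wpM2l //.
have h1 := powR_young (ltW q1) (addr_ge0 a0 d0) d0.
have h2 := powR_young (ltW q1) c0 d0.
have h3 := powR_young (ltW q1) ler01 d0.
have h4 := powR_add_le (ltW q0) a0 d0.
move: h3; rewrite !powR1 mul1r => h3.
rewrite !mulrDl mul1r.
move: ((a + d) `^ q) (_ * d) (_ * d) (2 `^ q * _) h1 h2 h3 h4 => *; lra.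
Qed.

(** The right derivative at [t = 0] of [|u x + t * w x|], for [u x >= 0]. *)
Definition slope (w : T -> R) (x : T) : R := if u x == 0 then `|w x| else w x.

Lemma slope_cvg w x : (`|u x + n.+1%:R^-1 * w x| - u x) / n.+1%:R^-1 @[n --> \oo] --> slope w x.
Proof.
rewrite /slope; have [->|un0] := eqVneq (u x) 0.
  rewrite (_ : (fun n => _) = cst `|w x|); first exact: cvg_cst.
  apply/funext => n; rewrite add0r subr0 normrM gtr0_norm ?invr_gt0 //.
  by rewrite mulrAC mulfV ?mul1r // invr_eq0.
have upos : 0 < u x by rewrite lt_neqAle eq_sym un0 u0.
apply: cvg_near_cst.
have e0 : 0 < u x / (`|w x| + 1) by rewrite divr_gt0 // ltr_wpDl.
have := near_infty_natSinv_lt (PosNum e0); apply: filterS => n /= hn.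
have h1 : n.+1%:R^-1 * `|w x| <= u x.
  rewrite ltr_pdivlMr ?ltr_wpDl // in hn; apply: le_trans (ltW hn).
  by rewrite ler_wpM2l ?invr_ge0 // lerDl.
rewrite ger0_norm.
  by rewrite addrAC subrr add0r mulrAC mulfV ?mul1r // invr_eq0.
have : `|n.+1%:R^-1 * w x| <= u x by rewrite normrM gtr0_norm ?invr_gt0.
by rewrite ler_norml => /andP[h2 _]; rewrite -[leLHS](subrr (u x)) lerD2l.
Qed.

Lemma int_pow_integrable w r : measurable_fun Omega w -> (int_pow r Omega w < +oo)%E ->
  mu.-integrable Omega (fun x => (`|w x| `^ r)%:E).
Proof.
move=> mw wr; apply/integrableP; split.
  by apply/measurable_EFinP; exact: measurable_normr_powR.
by under eq_integral do rewrite gee0_abs ?lee_fin ?powR_ge0 //.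
Qed.

Lemma X0_integrable_q w : X0 s p Omega w -> mu.-integrable Omega (fun x => (`|w x| `^ q)%:E).
Proof.
move=> Xw; apply: int_pow_integrable; first exact: measurable_funTS (X0_measurable Xw).
by apply: (sobolev N0 s0 p1 mO Ofin spN Xw); rewrite q0.
Qed.

Lemma majorant_integrable w : X0 s p Omega w ->
  mu.-integrable Omega (fun x => (C * (2 `^ q * (u x `^ q + `|w x| `^ q) +
    (b x `^ q + (3 * `|w x| `^ q + 1))))%:E).
Proof.
move=> Xw; have iw := X0_integrable_q Xw; have iu := X0_integrable_q Xu.
have ib := int_pow_integrable mb bq.
have i1 := integrable_cst_lty mO 1 Ofin.
have := integrableZl mO C (integrableD mO (integrableZl mO (2 `^ q) (integrableD mO iu iw))
  (integrableD mO ib (integrableD mO (integrableZl mO 3 iw) i1))).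
congr (_.-integrable _ _); apply/funext => x /=.
by rewrite (ger0_norm (u0 x)) (ger0_norm (b0 x)).
Qed.

Lemma measurable_slope w : measurable_fun setT w -> measurable_fun Omega (slope w).
Proof.
move=> mw; apply: measurable_funTS.
apply: measurable_fun_ifT => //; last exact: measurableT_comp.
exact: measurable_fun_eqr.
Qed.

(** Pointwise this is the chain rule along [|u + w / (n + 1)|]. The quotients are dominated by
    [q]-th powers of [u], [w] and [b], which are integrable for [u] and [w] by subcriticality and
    for [b] by assumption. *)
Lemma potential_derivative w : X0 s p Omega w ->
  mu.-integrable Omega (fun x => (dg x (u x) * slope w x)%:E) /\
  (fine (\int[mu]_(x in Omega) (g x `|(u x + n.+1%:R^-1 * w x)%R|)%:E)%E -
   fine (\int[mu]_(x in Omega) (g x `|u x|)%:E)%E) / n.+1%:R^-1 @[n --> \oo] -->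
  fine (\int[mu]_(x in Omega) (dg x (u x) * slope w x)%:E)%E.
Proof.
move=> Xw; pose u_ n x := u x + n.+1%:R^-1 * w x.
have Xu_ n : X0 s p Omega (u_ n) by exact: (X0_addZ N0 s0 p1 mO bO).
have iu := ig Xu; have iu_ n := ig (Xu_ n).
have iD n := integrableB mO (iu_ n) iu.
have iQ n := integrableZl mO n.+1%:R (iD n).
have ms : measurable_fun Omega (fun x => (dg x (u x) * slope w x)%:E).
  apply/measurable_EFinP; apply: measurable_funM => //; apply: measurable_slope.
  exact: X0_measurable Xw.
have hd x n : `| `|u_ n x| - u x| <= `|w x| * n.+1%:R^-1.
  rewrite -[in X in `|_ - X|](ger0_norm (u0 x)) (le_trans (ler_dist_dist _ _)) //.
  rewrite /u_ addrAC subrr add0r normrM gtr0_norm ?invr_gt0 //.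
  by rewrite mulrC.
have hc : {ae mu, forall x, Omega x ->
    n.+1%:R%:E * ((g x `|u_ n x|)%:E - (g x `|u x|)%:E) @[n --> \oo] -->
    (dg x (u x) * slope w x)%:E}%E.
  apply: aeW => x Ox; apply: cvg_EFin; first by near=> n.
  rewrite (_ : _ \o _ = fun n => (g x `|u_ n x| - g x (u x)) / n.+1%:R^-1).
    apply: (is_derive_ge0_quotient_cvg (g_derive Ox (u0 x)) (a_ := fun n => `|u_ n x|)
      (C := `|w x|)) => //.
    - exact: cvg_harmonic.
    - exact: slope_cvg.
  by apply/funext => n /=; rewrite (ger0_norm (u0 x)) invrK mulrC.
have hb : {ae mu, forall x n, Omega x ->
    `|n.+1%:R%:E * ((g x `|u_ n x|)%:E - (g x `|u x|)%:E)| <=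
    (C * (2 `^ q * (u x `^ q + `|w x| `^ q) + (b x `^ q + (3 * `|w x| `^ q + 1))))%:E}%E.
  apply: aeW => x n Ox.
  suff : `|n.+1%:R * (g x `|u_ n x| - g x `|u x|)| <=
      C * (2 `^ q * (u x `^ q + `|w x| `^ q) + (b x `^ q + (3 * `|w x| `^ q + 1))).
    by rewrite -lee_fin.
  apply: le_trans (young_bound (u0 x) (b0 x) (normr_ge0 (w x))).
  rewrite normrM ger0_norm // mulrC (ger0_norm (u0 x)) -ler_pdivlMr //.
  have /andP[t0 t1] := inv_natS_itv n.
  have h1 : `|u_ n x| <= u x + `|w x|.
    rewrite (le_trans (ler_normD _ _)) // (ger0_norm (u0 x)) lerD2l normrM (gtr0_norm t0).
    by rewrite ler_piMl.
  have h2 : u x <= u x + `|w x| by rewrite lerDl.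
  have ha : 0 <= `|u_ n x| <= u x + `|w x| by rewrite normr_ge0.
  have hu : 0 <= u x <= u x + `|w x| by rewrite u0.
  apply: le_trans (increment_le Ox ha hu) _.
  rewrite -[X in _ <= X]mulrA ler_wpM2l //.
  by rewrite mulr_ge0 // !addr_ge0 // powR_ge0.
have [il _ cv] := @dominated_convergence _ _ _ mu Omega mO
  _ _ _ (fun n => measurable_int _ (iQ n)) ms hc (majorant_integrable Xw) hb.
split => //.
rewrite (_ : (fun n => _) = fun n => fine (\int[mu]_(x in Omega)
   (n.+1%:R%:E * ((g x `|u_ n x|)%:E - (g x `|u x|)%:E)))%E); last first.
  apply/funext => n; rewrite (integralZl mO (iD n)) (integralB mO (iu_ n) iu).
  exact: (fine_quotient _ (integrable_fin_num mO (iu_ n)) (integrable_fin_num mO iu)).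
by apply: fine_cvg; rewrite (fineK (integrable_fin_num mO il)).
Unshelve. all: by end_near. Qed.

Hypothesis u_min : forall w, X0 s p Omega w ->
  fine (G u) / p - fine (\int[mu]_(x in Omega) (g x `|u x|)%:E)%E <=
  fine (G w) / p - fine (\int[mu]_(x in Omega) (g x `|w x|)%:E)%E.

Lemma integrable_test w : X0 s p Omega w ->
  mu.-integrable Omega (fun x => (dg x (u x) * w x)%:E).
Proof.
move=> Xw; have [il _] := potential_derivative Xw.
apply: (ae_le_integrable mO _ _ il).
  apply/measurable_EFinP; apply: measurable_funM => //.
  exact: measurable_funTS (X0_measurable Xw).
apply: aeW => x Ox; rewrite !abse_EFin lee_fin !normrM /slope.
by case: ifP; rewrite ?normr_id.
Qed.

(* Where u = 0 the slope of |u + t w| in t is |w|, not w; as dg is nonnegative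
   this only helps, and replacing w by - w then turns the inequality into an
   equality. *)
Lemma euler_lagrange_le w : X0 s p Omega w ->
  (\int[mu]_(x in Omega) (dg x (u x) * w x)%:E <= plap_form s p u w)%E.
Proof.
move=> Xw; have [il cB] := potential_derivative Xw.
have [ik cA] := gagliardo_derivative Xu Xw.
have fk : plap_form s p u w \is a fin_num by exact: (integrable_fin_num measurableT ik).
have le1 : (\int[mu]_(x in Omega) (dg x (u x) * w x)%:E <=
    \int[mu]_(x in Omega) (dg x (u x) * slope w x)%:E)%E.
  apply: (ae_le_integral mO (integrable_test Xw) il); apply: aeW => x Ox.
  rewrite lee_fin ler_wpM2l ?dg_ge0 // /slope; case: ifP => // _; exact: ler_norm.
apply: (le_trans le1); rewrite -(fineK (integrable_fin_num mO il)) -(fineK fk) lee_fin.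
have cA' : (fine (G (fun x => u x + n.+1%:R^-1 * w x)%R) - fine (G u)) / n.+1%:R^-1 / p
    @[n --> \oo] --> fine (plap_form s p u w).
  rewrite -[X in _ --> X](mulKf (lt0r_neq0 p0)) [X in _ --> X]mulrC.
  by apply: cvgMl; exact: cA.
apply: (ler_cvg_to cB cA'); apply: nearW => n.
have Xn := X0_addZ N0 s0 p1 mO bO n.+1%:R^-1 Xu Xw.
apply: (quotient_arith _ (u_min Xn)); by rewrite invr_gt0.
Qed.

Lemma euler_lagrange w : X0 s p Omega w ->
  plap_form s p u w = (\int[mu]_(x in Omega) (dg x (u x) * w x)%:E)%E.
Proof.
move=> Xw; apply/le_anti; rewrite (euler_lagrange_le Xw) andbT.
have iw := integrable_test Xw.
have [ik _] := gagliardo_derivative Xu Xw.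
have := euler_lagrange_le (X0_opp N0 s0 p1 mO bO Xw).
have -> : (\int[mu]_(x in Omega) (dg x (u x) * - w x)%:E =
    (-1)%:E * \int[mu]_(x in Omega) (dg x (u x) * w x)%:E)%E.
  rewrite -(integralZl mO iw); apply: eq_integral => x _.
  by rewrite -EFinM mulN1r mulrN.
have -> : (plap_form s p u (fun x => - w x)%R = (-1)%:E * plap_form s p u w)%E.
  rewrite -(integralZl measurableT ik); apply: eq_integral => z _.
  by rewrite -EFinM /plap_kernel; congr EFin; ring.
by rewrite !EFinN !mulN1e leeN2.
Qed.

End euler_lagrange.

(** * The system, from its two scalar equations *)

Lemma subcritical_dim (R : realType) (N : nat) (s p : R) : 0 < s < 1 -> 1 < p < N%:R / s ->
  [/\ (0 < N)%N, 1 < p & s * p < N%:R].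
Proof.
move=> /andP[s0 _] /andP[p1 pN]; split => //; last by rewrite mulrC -ltr_pdivlMr.
by case: N pN => // /(lt_trans p1); rewrite mul0r ltr10.
Qed.

Lemma ler_cancel_mid (R : realType) (a b c a' c' : R) :
  a + b - c <= a' + b - c' -> a - c <= a' - c'.
Proof. by rewrite addrAC [leRHS]addrAC lerD2r. Qed.

Lemma ler_cancel_left (R : realType) (a b c b' c' : R) :
  a + b - c <= a + b' - c' -> b - c <= b' - c'.
Proof. by rewrite -!addrA lerD2l. Qed.

Theorem theorem2p3 (R : realType) (N : nat) (Omega : set 'rV[R]_N)
    (s1 s2 p1 p2 : R) (f1 f2 F : 'rV[R]_N -> R -> R -> R)
    (q C3 : R) (h : 'rV[R]_N -> R)
  (hOmega : smooth_bounded_domain Omega)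
  (hs1 : 0 < s1 < 1) (hs2 : 0 < s2 < 1)
  (hp1 : 1 < p1 < N%:R / s1) (hp2 : 1 < p2 < N%:R / s2)
  (hf1_ge0 : forall x u v, Omega x -> 0 <= u -> 0 <= v -> 0 <= f1 x u v)
  (hf2_ge0 : forall x u v, Omega x -> 0 <= u -> 0 <= v -> 0 <= f2 x u v)
  (hf1_car : caratheodory Omega f1) (hf2_car : caratheodory Omega f2)
  (hF_C1 : C1_xuv Omega F)
  (hF_u : forall x u v, Omega x -> 0 <= u -> 0 <= v ->
    is_derive_ge0 (fun t => F x t v) u (f1 x u v))
  (hF_v : forall x u v, Omega x -> 0 <= u -> 0 <= v ->
    is_derive_ge0 (fun t => F x u t) v (f2 x u v))
  (* The energy functional is finite at (0,0). F is determined by f1, f2 only up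
     to a function of x; if that function is arbitrary, the limsup condition
     can hold vacuously near the boundary and the conclusion fails. *)
  (hF_00 : (@leb R N).-integrable Omega (fun x => (F x 0 0)%:E))
  (hq : 1 < q < Num.min (N%:R * p1 / (N%:R - s1 * p1))
                        (N%:R * p2 / (N%:R - s2 * p2)))
  (hC3 : 0 < C3)
  (hf_growth : forall x u v, Omega x -> 0 <= u -> 0 <= v ->
    `|f1 x u v| + `|f2 x u v| <= C3 * (`|u| `^ (q - 1) + `|v| `^ (q - 1) + 1))
  (hh : Linfty Omega h)
  (hF_limsup : limsup_le_unif p1 p2 Omega
    (fun x u v => Num.max p1 p2 * F x u v / (`|u| `^ p1 + `|v| `^ p2)) h)
  (hh_le : {ae @leb R N, forall x, Omega x ->
    ((h x)%:E <= mine (lambda1 s1 p1 Omega) (lambda1 s2 p2 Omega))%E})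
  (hh_lt : exists A : set 'rV[R]_N,
    [/\ measurable A, A `<=` Omega, (0 < leb N A)%E &
        forall x, A x ->
        ((h x)%:E < mine (lambda1 s1 p1 Omega) (lambda1 s2 p2 Omega))%E]) :
  exists u v : 'rV[R]_N -> R, weak_solution s1 p1 s2 p2 Omega f1 f2 u v.
Proof.
have [_ oO _ bO _] := hOmega.
have [N0 p11 s1N] := subcritical_dim hs1 hp1.
have [_ p21 s2N] := subcritical_dim hs2 hp2.
have /andP[s10 _] := hs1; have /andP[s20 _] := hs2.
have /andP[q1] := hq; rewrite lt_min => /andP[qN1 qN2].
have q0 : 0 < q by exact: lt_trans q1.
have mO : measurable Omega by exact: measurable_open.
have Ofin := bounded_leb_lty mO bO.
have [cF _ _ _] := hF_C1.
have [A [mA AO A0 hA]] := hh_lt.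
(* [h] is compared with the smaller eigenvalue, so the same set [A] serves for both gaps. *)
have gap1 : exists2 d : R, 0 < d & forall u, X0 s1 p1 Omega u ->
    (\int[leb N]_(x in Omega) (h x * `|u x| `^ p1)%:E <= (1 - d)%:E * gagliardo s1 p1 setT u)%E.
  apply: (spectral_gap N0 hs1 p11 oO bO hh _ mA AO A0).
    apply: filterS hh_le => x hx Ox; move: (hx Ox); rewrite le_min => /andP[h1 _]; exact: h1.
  move=> x Ax; move: (hA x Ax); rewrite lt_min => /andP[h1 _]; exact: h1.
have gap2 : exists2 d : R, 0 < d & forall u, X0 s2 p2 Omega u ->
    (\int[leb N]_(x in Omega) (h x * `|u x| `^ p2)%:E <= (1 - d)%:E * gagliardo s2 p2 setT u)%E.
  apply: (spectral_gap N0 hs2 p21 oO bO hh _ mA AO A0).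
    apply: filterS hh_le => x hx Ox; move: (hx Ox); rewrite le_min => /andP[_ h2]; exact: h2.
  move=> x Ax; move: (hA x Ax); rewrite lt_min => /andP[_ h2]; exact: h2.
have mF (u v : 'rV[R]_N -> R) := measurable_potential oO cF hF_u hF_v (u := u) (v := v).
have minF x a b (Ox : Omega x) (a0 : 0 <= a) (b0 : 0 <= b) : F x 0 0 <= F x a b.
  exact: (potential_mono hf1_ge0 hf2_ge0 hF_u hF_v Ox).
have cvF x (a b : R) (a_ b_ : nat -> R) (Ox : Omega x) (a_0 : forall n, 0 <= a_ n)
    (b_0 : forall n, 0 <= b_ n) (a0 : 0 <= a) (b0 : 0 <= b) (ca : a_ @ \oo --> a)
    (cb : b_ @ \oo --> b) := xuv_cvg cF Ox a_0 b_0 a0 b0 ca cb.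
have upF e (e0 : 0 < e) := potential_upper hf1_ge0 hf2_ge0 hF_u hF_v q1 hC3 hf_growth
  p11 p21 hh hF_limsup e0.
have [u [v [Xu Xv u0 v0 uv_min]]] := energy_minimizer N0 hs1 hs2 p11 p21 oO bO mF minF cvF upF
  hF_00 hh gap1 gap2.
have intF w z (Xw : X0 s1 p1 Omega w) (Xz : X0 s2 p2 Omega z) :
  (leb N).-integrable Omega (fun x => (F x `|w x| `|z x|)%:E).
  exact: (potential_integrable p11 oO bO mF minF upF hF_00 hh Xw Xz).
have mu_ : measurable_fun Omega u by exact: measurable_funTS (X0_measurable Xu).
have mv : measurable_fun Omega v by exact: measurable_funTS (X0_measurable Xv).
exists u, v; split => //; first by apply: aeW => x; split.
(* Each side is a sum of a term in [w] and a term in [z], so the equations can be proved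
   separately. *)
move=> w z Xw Xz; congr (_ + _)%E.
- apply: (euler_lagrange N0 hs1 p11 oO bO s1N q1 qN1 (g := fun x a => F x a (v x))
    (dg := fun x a => f1 x a (v x)) (b := v) (C := C3)) => //.
  + exact: ltW.
  + by move=> x a Ox a0; exact: hF_u.
  + by move=> x a Ox a0; exact: hf1_ge0.
  + by move=> x a Ox a0; exact: (f1_le hf_growth).
  + by apply: (sobolev N0 s20 p21 mO Ofin s2N Xv); rewrite q0.
  + move=> w' Xw'; have := intF _ _ Xw' Xv; congr (_.-integrable _ _).
    by apply/funext => x; rewrite (ger0_norm (v0 x)).
  + exact: (measurable_potential_u oO cF hF_u hF_v).
  (* With [v] kept fixed, its seminorm cancels and minimality becomes a statement about the first
     component alone. *)
  + move=> w' Xw'; have := uv_min _ _ Xw' Xv.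
    have E w0 : potential_integral Omega F w0 v =
        fine (\int[leb N]_(x in Omega) (F x `|w0 x| (v x))%:E)%E.
      by congr fine; apply: eq_integral => x _; rewrite (ger0_norm (v0 x)).
    rewrite /energy !E; exact: ler_cancel_mid.
- apply: (euler_lagrange N0 hs2 p21 oO bO s2N q1 qN2 (g := fun x a => F x (u x) a)
    (dg := fun x a => f2 x (u x) a) (b := u) (C := C3)) => //.
  + exact: ltW.
  + by move=> x a Ox a0; exact: hF_v.
  + by move=> x a Ox a0; exact: hf2_ge0.
  + by move=> x a Ox a0; exact: (f2_le hf_growth).
  + by apply: (sobolev N0 s10 p11 mO Ofin s1N Xu); rewrite q0.
  + move=> z' Xz'; have := intF _ _ Xu Xz'; congr (_.-integrable _ _).
    by apply/funext => x; rewrite (ger0_norm (u0 x)).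
  + exact: (measurable_potential_v oO cF hF_u hF_v).
  + move=> z' Xz'; have := uv_min _ _ Xu Xz'.
    have E z0 : potential_integral Omega F u z0 =
        fine (\int[leb N]_(x in Omega) (F x (u x) `|z0 x|)%:E)%E.
      by congr fine; apply: eq_integral => x _; rewrite (ger0_norm (u0 x)).
    rewrite /energy !E; exact: ler_cancel_left.
Qed.
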